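(* Let $d\ge 1$, let $A_\star\in\mathbb{R}^{d\times d}$ have spectral radius $\rho(A_\star)<1$, let $\Sigma_w\succeq 0$, and let $\sigma_\epsilon>0$. Consider the model $$\beta_{t+1}=A_\star\beta_t+w_t,\qquad y_t=x_t^\top\beta_t+\epsilon_t,\qquad t=0,1,\dots,T,$$ where $x_t\stackrel{\text{i.i.d.}}{\sim}\mathcal{N}(0,I_d)$, $w_t\stackrel{\text{i.i.d.}}{\sim}\mathcal{N}(0,\Sigma_w)$, $\epsilon_t\stackrel{\text{i.i.d.}}{\sim}\mathcal{N}(0,\sigma_\epsilon^2)$, $\beta_0\sim\mathcal{N}(0,\Sigma_\infty)$, and all of these are mutually independent. Here $\Sigma_\infty$ is the unique positive semidefinite solution $P$ of $P=A_\star PA_\star^\top+\Sigma_w$. Let $\gamma\in(\rho(A_\star),1)$ and $\tau(A_\star,\gamma):=\sup\{\|A_\star^k\|\gamma^{-k}:k\ge 0\}$. Define the estimates $$\widehat{\Sigma}_\infty\in\arg\min_{M\in\mathbb{R}^{d\times d},\,M=M^\top}\sum_{t=0}^{T-1}\big(y_t^2-x_t^\top Mx_t-\sigma_\epsilon^2\big)^2,\qquad \widehat{M}\in\arg\min_{M\in\mathbb{R}^{d\times d}}\sum_{t=0}^{T-1}\big(y_ty_{t+1}-x_{t+1}^\top Mx_t\big)^2.$$ Then there is a universal constant $c>0$ such that for every $\delta\in(0,1)$, whenever $T\ge c\,d^4\log\!\big(c\,\tfrac{d^2}{\delta}\big)$, with probability at least $1-\delta$, $$\|\widehat{\Sigma}_\infty-\Sigma_\infty\|_F\le\sqrt{\frac{cd^2}{T\delta}\left[\sigma_\epsilon^4+\frac{\tau(A_\star,\gamma)^2}{1-\gamma^2}\|\Sigma_\infty\|^2\Big(d^2+\log\big(\tfrac{2T}{\delta}\big)^2\Big)\right]},$$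 $$\|\widehat{M}-A_\star\Sigma_\infty\|_F\le\sqrt{\frac{cd^2}{T\delta}\left[\sigma_\epsilon^4+\frac{\tau(A_\star,\gamma)^3}{1-\gamma^2}\|\Sigma_\infty\|^2\Big(d^2+\log\big(\tfrac{2T}{\delta}\big)^2\Big)\right]}.$$
   Context: $\|\cdot\|$ denotes the Euclidean norm for vectors and the operator norm for matrices; $\|\cdot\|_F$ is the Frobenius norm. The variance $\sigma_\epsilon^2$ is assumed known to the estimator. Only $(x_t,y_t)$ are observed; $\beta_t$ are hidden. The constant $c$ is universal (it may differ between occurrences). *)

(* Defs.v *)
From HB Require Import structures.
From mathcomp Require Import all_boot all_order all_algebra.
From mathcomp Require Import all_classical all_reals all_analysis.
From mathcomp Require Import complex.
Set Implicit Arguments. Unset Strict Implicit. Unset Printing Implicit Defensive.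
Import Order.TTheory GRing.Theory Num.Theory.
Local Open Scope classical_set_scope.
Local Open Scope ring_scope.

Definition vnorm {R : realType} {n : nat} (u : 'cV[R]_n) : R :=
  Num.sqrt (\sum_(i < n) (u i 0) ^+ 2).

Definition opnorm {R : realType} {m n : nat} (M : 'M[R]_(m, n)) : R :=
  sup [set vnorm (M *m u) | u in [set u : 'cV[R]_n | vnorm u <= 1]].

Definition frob {R : realType} {m n : nat} (M : 'M[R]_(m, n)) : R :=
  Num.sqrt (\sum_(i < m) \sum_(j < n) (M i j) ^+ 2).

Definition qform {R : realType} {n : nat} (S : 'M[R]_n) (u : 'cV[R]_n) : R :=
  (u^T *m S *m u) 0 0.

Definition symmetric {R : realType} {n : nat} (M : 'M[R]_n) : Prop := M^T = M.

Definition psd {R : realType} {n : nat} (S : 'M[R]_n) : Prop :=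
  symmetric S /\ forall u : 'cV[R]_n, 0 <= qform S u.

Definition spectral_radius {R : realType} {n : nat} (A : 'M[R]_n) : R :=
  sup [set Normc.normc z | z in
        [set z : R[i] | eigenvalue (map_mx (real_complex R) A) z]].

Definition tau {R : realType} {n : nat} (A : 'M[R]_n) (g : R) : R :=
  sup [set opnorm (A ^+ k) / g ^+ k | k in [set: nat]].

Definition gaussian_law {R : realType} (m v : R) : set R -> \bar R :=
  if v == 0 then (@dirac _ R m R : set R -> \bar R) else normal_prob m (Num.sqrt v).

Definition real_gaussian {R : realType} {dO : measure_display} {O : measurableType dO}
  (P : probability O R) (X : O -> R) (m v : R) : Prop :=
  measurable_fun setT X /\
  forall B : set R, measurable B -> P (X @^-1` B) = gaussian_law m v B.

Definition vec_gaussian {R : realType} {dO : measure_display} {O : measurableType dO}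
  (P : probability O R) {n : nat} (X : O -> 'cV[R]_n) (S : 'M[R]_n) : Prop :=
  (forall j, measurable_fun setT (fun w => X w j 0)) /\
  forall u : 'cV[R]_n, real_gaussian P (fun w => (u^T *m X w) 0 0) 0 (qform S u).

(* events generated (as a pi-system) by a random vector: joint coordinate preimages *)
Definition vec_events {R : realType} {O : Type} {n : nat} (X : O -> 'cV[R]_n)
  : set (set O) :=
  [set \bigcap_(j in [set: 'I_n]) ((fun w => X w j 0) @^-1` B j)
     | B in [set B : 'I_n -> set R | forall j, measurable (B j)]].

Definition real_events {R : realType} {O : Type} (X : O -> R) : set (set O) :=
  [set X @^-1` B | B in [set B : set R | measurable B]].

(* mutual independence of a finite family of event systems (each containing setT) *)
Definition mutually_independent {R : realType} {dO : measure_display}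
  {O : measurableType dO} (P : probability O R) {I : finType}
  (G : I -> set (set O)) : Prop :=
  forall E : I -> set O, (forall i, G i (E i)) ->
    P (\bigcap_(i in [set: I]) E i) = (\prod_(i : I) P (E i))%E.

(* index of the independent primitives: None = beta_0, x_t, w_t, eps_t for t = 0..T *)
Definition model_index (T : nat) : finType :=
  option (('I_T.+1 + 'I_T.+1) + 'I_T.+1)%type.

Definition model_events {R : realType} {O : Type} {d T : nat}
  (beta0 : O -> 'cV[R]_d) (x w : nat -> O -> 'cV[R]_d) (eps : nat -> O -> R)
  (i : model_index T) : set (set O) :=
  match i with
  | None => vec_events beta0
  | Some (inl (inl t)) => vec_events (x t)
  | Some (inl (inr t)) => vec_events (w t)
  | Some (inr t) => real_events (eps t)
  end.

Definition obj_Sigma {R : realType} {d : nat} (T : nat) (sig : R)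
  (x : nat -> 'cV[R]_d) (y : nat -> R) (M : 'M[R]_d) : R :=
  \sum_(t < T) (y t ^+ 2 - qform M (x t) - sig ^+ 2) ^+ 2.

Definition obj_M {R : realType} {d : nat} (T : nat)
  (x : nat -> 'cV[R]_d) (y : nat -> R) (M : 'M[R]_d) : R :=
  \sum_(t < T) (y t * y t.+1 - ((x t.+1)^T *m M *m x t) 0 0) ^+ 2.

Definition is_Sigma_hat {R : realType} {d : nat} (T : nat) (sig : R)
  (x : nat -> 'cV[R]_d) (y : nat -> R) (M : 'M[R]_d) : Prop :=
  symmetric M /\ forall M' : 'M[R]_d, symmetric M' ->
    obj_Sigma T sig x y M <= obj_Sigma T sig x y M'.

Definition is_M_hat {R : realType} {d : nat} (T : nat)
  (x : nat -> 'cV[R]_d) (y : nat -> R) (M : 'M[R]_d) : Prop :=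
  forall M' : 'M[R]_d, obj_M T x y M <= obj_M T x y M'.

(* Main.v *)
Require Import Defs.
From HB Require Import structures.
From mathcomp Require Import all_boot all_order all_algebra.
From mathcomp Require Import all_classical all_reals all_analysis.
From mathcomp Require Import complex.
From mathcomp Require Import ring lra zify.
Set Implicit Arguments. Unset Strict Implicit. Unset Printing Implicit Defensive.
Import Order.TTheory GRing.Theory Num.Theory.
Import measurable_realfun numFieldNormedType.Exports.
Local Open Scope classical_set_scope.
Local Open Scope ring_scope.

(* Both estimates are least squares fits of products of observations to a bilinear form
   of the design. A fit for which [sum_t (x_{t+h}^T D x_t)^2 >= T |D|^2 / 192] for every
   [D] has squared error at most [4 (192 / T)^2 |N|^2], where the noise matrix [N] is the
   sum of [x_{t+h} x_t^T] weighted by the centred products [y_{t+h} y_t].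

   Noise: conditionally on the design the [y_t] are jointly Gaussian, so Isserlis' formula
   expresses [E |N|^2] through their covariances, which decay like [tau gam^|t-s|]; since
   the design is independent of the state, averaging over the design and summing the
   geometric series leaves [T d^2 (sig^4 + tau^2 |Sinf|^2 d^2 / (1 - gam^2))].

   Lower bound: for a fixed [D] the terms with even [t] are independent and nonnegative
   with bounded second moment, hence have an exponentially small lower tail. A union bound
   over a grid of mesh [delta / d^2] suffices, because off the grid the form is controlled
   by the Markov bound for [sum_t |x_t|^4]. *)

(** The sample size [d^4 log] is a product of two factors. The grid over [d * d] matrices has
    log-cardinality of order [d^2 log (d^2 / delta)], and the second moment of [(x^T D x)^2] is
    bounded by [105 d^2] times the square of [|D|^2], itself a lower bound for its mean; this ratio
    sets the rate [n / (840 d^2)] of the lower tail. The factor [1 / delta] in the error comes from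
    applying Markov's inequality to the second moment of the noise. The observations are not
    Gaussian, since [x_t] multiplies [beta_t]; they become Gaussian only once the design is frozen.
    Conditioning is expressed as an iterated integral over two copies of the probability space, one
    carrying the design and the other the state and the observation noise. All failure events are
    encoded by nonnegative variables of small mean that reach 1 when the event occurs. Their sum has
    mean at most [delta], so a single use of Markov's inequality serves both estimates at once. *)

Lemma cauchy_schwarz_sum (R : realFieldType) (I : finType) (a b : I -> R) :
  (\sum_i a i * b i) ^+ 2 <= (\sum_i a i ^+ 2) * (\sum_i b i ^+ 2).
Proof.
have H : 0 <= \sum_i \sum_j (a i * b j - a j * b i) ^+ 2.
  by apply: sumr_ge0 => i _; apply: sumr_ge0 => j _; exact: sqr_ge0.
suff E : \sum_i \sum_j (a i * b j - a j * b i) ^+ 2 =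
   2 * ((\sum_i a i ^+ 2) * (\sum_i b i ^+ 2) - (\sum_i a i * b i) ^+ 2).
  by move: H; rewrite E; lra.
have -> : \sum_i \sum_j (a i * b j - a j * b i) ^+ 2 =
  \sum_i \sum_j (a i ^+ 2 * b j ^+ 2) + \sum_i \sum_j (b i ^+ 2 * a j ^+ 2)
  - 2 * \sum_i \sum_j ((a i * b i) * (a j * b j)).
  rewrite mulr_sumr -big_split -sumrB /=; apply: eq_bigr => i _.
  rewrite mulr_sumr -big_split -sumrB /=; apply: eq_bigr => j _.
  by ring.
have F (f g : I -> R) : \sum_i \sum_j f i * g j = (\sum_i f i) * (\sum_j g j).
  by rewrite mulr_suml; apply: eq_bigr => i _; rewrite mulr_sumr.
by rewrite !F expr2; ring.
Qed.

(** Expand the nonnegative double sum of [s i * s j * (z i - z j) ^+ 2]. The weights need not sum to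
    1, which suits weights of total mass [frob2 M]. *)
Lemma jensen_sqr (R : realFieldType) (I : finType) (s z : I -> R) :
  (forall i, 0 <= s i) ->
  (\sum_i s i * z i) ^+ 2 <= (\sum_i s i) * (\sum_i s i * z i ^+ 2).
Proof.
move=> s0.
have H : 0 <= \sum_i \sum_j s i * s j * (z i - z j) ^+ 2.
  by apply: sumr_ge0 => i _; apply: sumr_ge0 => j _; apply: mulr_ge0; [exact: mulr_ge0|exact: sqr_ge0].
suff E : \sum_i \sum_j s i * s j * (z i - z j) ^+ 2 =
   2 * ((\sum_i s i) * (\sum_i s i * z i ^+ 2) - (\sum_i s i * z i) ^+ 2).
  by move: H; rewrite E; lra.
have -> : \sum_i \sum_j s i * s j * (z i - z j) ^+ 2 =
  \sum_i \sum_j (s i * (s j * z j ^+ 2)) + \sum_i \sum_j ((s i * z i ^+ 2) * s j)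
  - 2 * \sum_i \sum_j ((s i * z i) * (s j * z j)).
  rewrite mulr_sumr -big_split -sumrB /=; apply: eq_bigr => i _.
  rewrite mulr_sumr -big_split -sumrB /=; apply: eq_bigr => j _.
  by ring.
have F (f g : I -> R) : \sum_i \sum_j f i * g j = (\sum_i f i) * (\sum_j g j).
  by rewrite mulr_suml; apply: eq_bigr => i _; rewrite mulr_sumr.
by rewrite !F expr2; ring.
Qed.

(** * Euclidean, Frobenius and operator norms *)

Definition dot (R : realType) n (u v : 'cV[R]_n) : R := (u^T *m v) 0 0.

(** Squaring removes the root: this is a polynomial in the entries, so it can be integrated and
    rescaled algebraically. *)
Definition frob2 (R : realType) m n (M : 'M[R]_(m, n)) : R :=
  \sum_i \sum_j M i j ^+ 2.

Section linear_algebra.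
Variable R : realType.

Lemma dotE n (u v : 'cV[R]_n) : dot u v = \sum_i u i 0 * v i 0.
Proof. by rewrite /dot mxE; apply: eq_bigr => i _; rewrite mxE. Qed.

Lemma dotC n (u v : 'cV[R]_n) : dot u v = dot v u.
Proof. by rewrite !dotE; apply: eq_bigr => i _; rewrite mulrC. Qed.

Lemma dotDl n (u v w : 'cV[R]_n) : dot (u + v) w = dot u w + dot v w.
Proof. by rewrite /dot linearD mulmxDl mxE. Qed.

Lemma dotZl n a (u w : 'cV[R]_n) : dot (a *: u) w = a * dot u w.
Proof. by rewrite /dot linearZ /= -scalemxAl mxE. Qed.

Lemma dotDr n (u v w : 'cV[R]_n) : dot w (u + v) = dot w u + dot w v.
Proof. by rewrite dotC dotDl !(dotC w). Qed.

Lemma dot_mulmxl m n (M : 'M[R]_(m, n)) u v : dot (M *m u) v = dot u (M^T *m v).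
Proof. by rewrite /dot trmx_mul mulmxA. Qed.

Lemma dot_mulmxr m n (M : 'M[R]_(m, n)) u v : dot u (M *m v) = dot (M^T *m u) v.
Proof. by rewrite dot_mulmxl trmxK. Qed.

Lemma qformE n (S : 'M[R]_n) u : qform S u = dot u (S *m u).
Proof. by rewrite /qform /dot mulmxA. Qed.

Lemma dot_ge0 n (u : 'cV[R]_n) : 0 <= dot u u.
Proof. by rewrite dotE; apply: sumr_ge0 => i _; rewrite -expr2 sqr_ge0. Qed.

Lemma dot_sqr n (u : 'cV[R]_n) : dot u u = \sum_i u i 0 ^+ 2.
Proof. by rewrite dotE. Qed.

Lemma vnorm_ge0 n (u : 'cV[R]_n) : 0 <= vnorm u.
Proof. exact: sqrtr_ge0. Qed.

Lemma sqr_vnorm n (u : 'cV[R]_n) : vnorm u ^+ 2 = dot u u.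
Proof. by rewrite /vnorm -dot_sqr sqr_sqrtr ?dot_ge0. Qed.

Lemma dot_cs n (u v : 'cV[R]_n) : dot u v ^+ 2 <= dot u u * dot v v.
Proof. by rewrite !dot_sqr dotE; exact: cauchy_schwarz_sum. Qed.

Lemma dot_eq0 n (u : 'cV[R]_n) : dot u u = 0 -> u = 0.
Proof.
rewrite dot_sqr => /eqP; rewrite psumr_eq0; last by move=> i _; exact: sqr_ge0.
move=> /allP H; apply/colP => i; rewrite mxE.
by have := H i (mem_index_enum _); rewrite /= sqrf_eq0 => /eqP.
Qed.

Lemma vnorm_eq0 n (u : 'cV[R]_n) : vnorm u = 0 -> u = 0.
Proof. by move=> h; apply: dot_eq0; rewrite -sqr_vnorm h expr0n. Qed.

Lemma vnormZ n a (u : 'cV[R]_n) : vnorm (a *: u) = `|a| * vnorm u.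
Proof.
apply/eqP; rewrite -(@eqrXn2 _ 2) ?mulr_ge0 ?vnorm_ge0//; apply/eqP.
by rewrite exprMn !sqr_vnorm real_normK ?num_real// dotZl dotC dotZl; ring.
Qed.

Lemma frob2_ge0 m n (M : 'M[R]_(m, n)) : 0 <= frob2 M.
Proof. by apply: sumr_ge0 => i _; apply: sumr_ge0 => j _; exact: sqr_ge0. Qed.

Lemma frob_ge0 m n (M : 'M[R]_(m, n)) : 0 <= frob M.
Proof. exact: sqrtr_ge0. Qed.

Lemma sqr_frob m n (M : 'M[R]_(m, n)) : frob M ^+ 2 = frob2 M.
Proof. by rewrite /frob sqr_sqrtr// frob2_ge0. Qed.

Lemma frob2_eq0 m n (M : 'M[R]_(m, n)) : frob2 M = 0 -> M = 0.
Proof.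
move/eqP; rewrite psumr_eq0; last first.
  by move=> i _; apply: sumr_ge0 => j _; exact: sqr_ge0.
move=> /allP H; apply/matrixP => i j; rewrite mxE.
have := H i (mem_index_enum _); rewrite /= psumr_eq0; last first.
  by move=> k _; exact: sqr_ge0.
by move=> /allP /(_ j (mem_index_enum _)); rewrite /= sqrf_eq0 => /eqP.
Qed.

Lemma frob2Z m n a (M : 'M[R]_(m, n)) : frob2 (a *: M) = a ^+ 2 * frob2 M.
Proof.
rewrite /frob2 mulr_sumr; apply: eq_bigr => i _.
by rewrite mulr_sumr; apply: eq_bigr => j _; rewrite mxE exprMn.
Qed.

Lemma frob2_rows m n (M : 'M[R]_(m, n)) :
  frob2 M = \sum_i dot (row i M)^T (row i M)^T.
Proof.
by apply: eq_bigr => i _; rewrite dot_sqr; apply: eq_bigr => j _; rewrite !mxE.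
Qed.

Lemma mulmx_row_dot m n (M : 'M[R]_(m, n)) u i : (M *m u) i 0 = dot (row i M)^T u.
Proof. by rewrite dotE !mxE; apply: eq_bigr => j _; rewrite !mxE. Qed.

Lemma dot_mulmx_le m n (M : 'M[R]_(m, n)) u :
  dot (M *m u) (M *m u) <= frob2 M * dot u u.
Proof.
rewrite dot_sqr frob2_rows mulr_suml; apply: ler_sum => i _.
by rewrite mulmx_row_dot dot_cs.
Qed.

(** [sup] is meaningful only on nonempty bounded sets; here the Frobenius norm supplies the bound
    through Cauchy-Schwarz on each row. *)
Lemma opnorm_has_sup m n (M : 'M[R]_(m, n)) :
  has_sup [set vnorm (M *m u) | u in [set u : 'cV[R]_n | vnorm u <= 1]].
Proof.
split.
  exists (vnorm (M *m 0)), 0 => //=.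
  rewrite /vnorm big1 ?sqrtr0// => i _.
  by rewrite mxE expr0n.
exists (Num.sqrt (frob2 M)) => _ [u /= u1 <-].
rewrite -(@ler_pXn2r _ 2) ?nnegrE ?vnorm_ge0 ?sqrtr_ge0// sqr_vnorm.
rewrite sqr_sqrtr ?frob2_ge0// (le_trans (dot_mulmx_le _ _))//.
rewrite -[leRHS]mulr1 ler_wpM2l ?frob2_ge0// -sqr_vnorm.
by rewrite expr_le1 ?vnorm_ge0.
Qed.

Lemma opnorm_ge0 m n (M : 'M[R]_(m, n)) : 0 <= opnorm M.
Proof.
have [[x [u u1 xE]] ub] := opnorm_has_sup M.
apply: le_trans (ub_le_sup ub _); last by exists u; [exact: u1|exact: erefl].
exact: vnorm_ge0.
Qed.

Lemma vnorm_mulmx m n (M : 'M[R]_(m, n)) u : vnorm (M *m u) <= opnorm M * vnorm u.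
Proof.
have [u0|u0] := eqVneq (vnorm u) 0.
  rewrite u0 mulr0 (vnorm_eq0 u0) mulmx0 /vnorm big1 ?sqrtr0// => i _.
  by rewrite mxE expr0n.
have up : 0 < vnorm u by rewrite lt_def u0 vnorm_ge0.
rewrite -ler_pdivrMr// mulrC.
have -> : (vnorm u)^-1 * vnorm (M *m u) = vnorm (M *m ((vnorm u)^-1 *: u)).
  by rewrite -scalemxAr vnormZ ger0_norm// invr_ge0 ltW.
apply: ub_le_sup; first by have [] := opnorm_has_sup M.
exists ((vnorm u)^-1 *: u) => //=.
by rewrite vnormZ ger0_norm ?invr_ge0 ?vnorm_ge0// mulVf.
Qed.

Lemma opnorm_le m n (M : 'M[R]_(m, n)) c : 0 <= c ->
  (forall u, vnorm (M *m u) <= c * vnorm u) -> opnorm M <= c.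
Proof.
move=> c0 H; apply: ge_sup; first by have [] := opnorm_has_sup M.
move=> _ [u /= u1 <-]; rewrite (le_trans (H u))//.
by rewrite -[leRHS]mulr1 ler_wpM2l.
Qed.

Lemma opnormM m n p (A : 'M[R]_(m, n)) (B : 'M[R]_(n, p)) :
  opnorm (A *m B) <= opnorm A * opnorm B.
Proof.
apply: opnorm_le => [|u]; first by rewrite mulr_ge0 ?opnorm_ge0.
rewrite -mulmxA (le_trans (vnorm_mulmx _ _))// -mulrA.
by rewrite ler_wpM2l ?opnorm_ge0 ?vnorm_mulmx.
Qed.

Lemma vnorm_delta n (j : 'I_n) : vnorm (delta_mx j 0 : 'cV[R]_n) = 1.
Proof.
rewrite /vnorm (bigD1 j)//= big1 => [|i /negbTE ij].
  by rewrite mxE !eqxx expr1n addr0 sqrtr1.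
by rewrite mxE ij expr0n.
Qed.

(** Each of the [n] columns is the image of a unit vector. *)
Lemma frob2_le_opnorm m n (M : 'M[R]_(m, n)) :
  frob2 M <= n%:R * opnorm M ^+ 2.
Proof.
rewrite /frob2 exchange_big /=.
have -> : n%:R * opnorm M ^+ 2 = \sum_(j < n) opnorm M ^+ 2.
  by rewrite sumr_const card_ord mulr_natl.
apply: ler_sum => j _.
have -> : \sum_i M i j ^+ 2 = vnorm (M *m delta_mx j 0) ^+ 2.
  rewrite sqr_vnorm dot_sqr; apply: eq_bigr => i _.
  by rewrite -colE mxE.
rewrite ler_pXn2r ?nnegrE ?vnorm_ge0 ?opnorm_ge0//.
by rewrite (le_trans (vnorm_mulmx _ _))// vnorm_delta mulr1.
Qed.

Lemma opnorm_le_frob m n (M : 'M[R]_(m, n)) : opnorm M <= frob M.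
Proof.
apply: opnorm_le => [|u]; first exact: frob_ge0.
rewrite -(@ler_pXn2r _ 2) ?nnegrE ?mulr_ge0 ?vnorm_ge0 ?frob_ge0//.
by rewrite exprMn sqr_frob !sqr_vnorm dot_mulmx_le.
Qed.

Lemma opnorm1 n : (0 < n)%N -> opnorm (1%:M : 'M[R]_n) = 1.
Proof.
move=> n0; apply/eqP; rewrite eq_le; apply/andP; split.
  by apply: opnorm_le => // u; rewrite mul1mx mul1r.
have := vnorm_mulmx (1%:M : 'M[R]_n) (delta_mx (Ordinal n0) 0).
by rewrite mul1mx vnorm_delta mulr1.
Qed.

End linear_algebra.

(** * Spectral radius and growth of matrix powers *)

Section power_growth.
Variable R : realType.
Local Notation normc := Normc.normc.

(** The entrywise l1 norm; its subadditivity and homogeneity are what the recursion on powers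
    uses. *)
Definition sum_normc n (M : 'M[R[i]]_n) : R := \sum_i \sum_j normc (M i j).

Lemma normc_ge0 (z : R[i]) : 0 <= normc z.
Proof. by case: z => a b /=; exact: sqrtr_ge0. Qed.

Lemma normc_real (x : R) : normc (real_complex R x) = `|x|.
Proof. by rewrite /= expr0n /= addr0 sqrtr_sqr. Qed.

Lemma sum_normcD n (M N : 'M[R[i]]_n) :
  sum_normc (M + N) <= sum_normc M + sum_normc N.
Proof.
rewrite -big_split; apply: ler_sum => i _; rewrite -big_split /=.
by apply: ler_sum => j _; rewrite mxE le_normcD.
Qed.

Lemma sum_normcZ n a (M : 'M[R[i]]_n) : sum_normc (a *: M) = normc a * sum_normc M.
Proof.
rewrite mulr_sumr; apply: eq_bigr => i _; rewrite mulr_sumr.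
by apply: eq_bigr => j _; rewrite mxE Normc.normcM.
Qed.

Lemma sum_normc_ge0 n (M : 'M[R[i]]_n) : 0 <= sum_normc M.
Proof. by apply: sumr_ge0 => i _; apply: sumr_ge0 => j _; exact: normc_ge0. Qed.

Lemma frob_le_sum_normc n (M : 'M[R]_n) :
  frob M <= sum_normc (map_mx (real_complex R) M).
Proof.
rewrite -(@ler_pXn2r _ 2) ?nnegrE ?frob_ge0 ?sum_normc_ge0// sqr_frob.
have sqr_le (I : finType) (f : I -> R) : (forall i, 0 <= f i) ->
    \sum_i f i ^+ 2 <= (\sum_i f i) ^+ 2.
  move=> f0; rewrite [in leRHS]expr2 mulr_suml; apply: ler_sum => i _.
  rewrite expr2 ler_wpM2l// (bigD1 i)//= lerDl; exact: sumr_ge0.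
rewrite /sum_normc; under [X in _ <= X ^+ 2]eq_bigr do
  under eq_bigr do rewrite mxE normc_real.
apply: le_trans (sqr_le _ _ _); last by move=> i; apply: sumr_ge0.
apply: ler_sum => i _; apply: le_trans (sqr_le _ _ _) => //.
by apply: ler_sum => j _; rewrite real_normK ?num_real.
Qed.

(* Peeling the factors of an annihilating product off one at a time gives a
   scalar recursion [v (k+1) <= |l| v k + C g^k] for each root [l]. *)
Lemma sum_normc_power_growth n (A : 'M[R[i]]_n.+1) (g : R) (s : seq R[i]) :
  0 < g -> (forall l, l \in s -> normc l < g) ->
  forall B : 'M[R[i]]_n.+1, B * \prod_(l <- s) (A - l%:M) = 0 ->
  exists C, 0 <= C /\ forall k, sum_normc (B * A ^+ k) <= C * g ^+ k.
Proof.
move=> g0; elim: s => [|l s IH] ls B.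
  rewrite big_nil mulr1 => ->; exists 0; split=> // k.
  rewrite mul0r mul0r /sum_normc big1// => i _; rewrite big1// => j _.
  by rewrite mxE Normc.normc0.
rewrite big_cons mulrA => /IH [|C [C0 HC]].
  by move=> z zs; apply: ls; rewrite inE zs orbT.
have lg : normc l < g by apply: ls; rewrite inE eqxx.
(* The second summand makes [C + |l| D <= g D], so the bound [D g^k] reproduces itself; the first
   covers [k = 0]. *)
pose D := sum_normc B + C / (g - normc l).
have gl : 0 < g - normc l by rewrite subr_gt0.
have D0 : 0 <= D by rewrite addr_ge0 ?sum_normc_ge0// divr_ge0// ltW.
exists D; split=> //; elim=> [|k IHk].
  by rewrite !expr0 !mulr1 lerDl divr_ge0// ltW.
have -> : B * A ^+ k.+1 = B * (A - l%:M) * A ^+ k + l *: (B * A ^+ k).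
  by rewrite exprS mulrBr mulrBl mulrA -[B * l%:M]/(B *m l%:M) mul_mx_scalar
             -scalerAl subrK.
rewrite (le_trans (sum_normcD _ _))// sum_normcZ.
apply: (@le_trans _ _ (C * g ^+ k + normc l * (D * g ^+ k))).
  by rewrite lerD// ler_wpM2l ?normc_ge0.
rewrite mulrA -mulrDl exprS mulrA ler_pM2r ?exprn_gt0//.
have : C / (g - normc l) <= D by rewrite lerDr sum_normc_ge0.
rewrite ler_pdivrMr//; lra.
Qed.

Lemma normc_le_spectral_radius n (A : 'M[R]_n) z :
  eigenvalue (map_mx (real_complex R) A) z -> normc z <= spectral_radius A.
Proof.
move=> ez; apply: ub_le_sup; last by exists z.
have p0 : char_poly (map_mx (real_complex R) A) != 0.
  by rewrite monic_neq0 ?char_poly_monic.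
have [r pE] := closed_field_poly_normal (char_poly (map_mx (real_complex R) A)).
(* The eigenvalues are among the finitely many roots of the characteristic polynomial, so the sum of
   all moduli bounds each of them. *)
exists (\sum_(l <- r) normc l) => _ [l /= el <-].
have lr : l \in r.
  move: el; rewrite eigenvalue_root_char pE (eqP (char_poly_monic _)) scale1r.
  by rewrite root_prod_XsubC.
rewrite (big_rem l)//= lerDl sumr_ge0// => i _; exact: normc_ge0.
Qed.

(** Over [R[i]] the characteristic polynomial splits, and Cayley-Hamilton gives the annihilating
    product of factors [A - l] whose roots all have modulus below [g]. *)
Lemma opnorm_power_growth n (A : 'M[R]_n.+1) (g : R) :
  0 < g -> spectral_radius A < g ->
  exists C, forall k, opnorm (A ^+ k) <= C * g ^+ k.
Proof.
move=> g0 rg.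
pose AC := map_mx (real_complex R) A.
have [r pE] := closed_field_poly_normal (char_poly AC).
have pr : \prod_(l <- r) (AC - l%:M) = 0.
  have := Cayley_Hamilton AC.
  rewrite pE (eqP (char_poly_monic _)) scale1r rmorph_prod /= => <-.
  apply: eq_bigr => l _.
  by rewrite rmorphB /= horner_mx_X horner_mx_C.
have [||C [_ HC]] := @sum_normc_power_growth _ AC g r g0 _ 1.
- move=> l lr; apply: le_lt_trans rg; apply: normc_le_spectral_radius.
  rewrite eigenvalue_root_char -/AC pE (eqP (char_poly_monic _)) scale1r.
  by rewrite root_prod_XsubC.
- by rewrite mul1r.
exists C => k; apply: le_trans (HC k); rewrite mul1r.
apply: le_trans (opnorm_le_frob _) _; apply: le_trans (frob_le_sum_normc _) _.
by rewrite /AC -rmorphXn.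
Qed.

Lemma spectral_radius_ge0 n (A : 'M[R]_n.+1) : 0 <= spectral_radius A.
Proof.
pose AC := map_mx (real_complex R) A.
have : size (char_poly AC) != 1%N by rewrite size_char_poly.
move=> /closed_rootP [z]; rewrite -eigenvalue_root_char => ez.
by apply: le_trans (normc_le_spectral_radius ez); exact: normc_ge0.
Qed.

(** This makes the supremum in [tau] a genuine one, so that [tau A g * g ^+ k] really dominates
    every power. *)
Lemma tau_has_ubound n (A : 'M[R]_n) (g : R) : (0 < n)%N ->
  spectral_radius A < g ->
  has_ubound [set opnorm (A ^+ k) / g ^+ k | k in [set: nat]].
Proof.
case: n A => // n A _ rg.
have g0 : 0 < g by apply: le_lt_trans rg; exact: spectral_radius_ge0.
have [C HC] := opnorm_power_growth g0 rg.
by exists C => _ [k _ <-]; rewrite ler_pdivrMr ?exprn_gt0.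
Qed.

Lemma opnorm_power_le_tau n (A : 'M[R]_n) (g : R) k : (0 < n)%N ->
  spectral_radius A < g -> opnorm (A ^+ k) <= tau A g * g ^+ k.
Proof.
case: n A => // n A _ rg.
have g0 : 0 < g by apply: le_lt_trans rg; exact: spectral_radius_ge0.
rewrite -ler_pdivrMr ?exprn_gt0//; apply: ub_le_sup; first exact: tau_has_ubound.
by exists k.
Qed.

Lemma tau_ge1 n (A : 'M[R]_n) (g : R) : (0 < n)%N ->
  spectral_radius A < g -> 1 <= tau A g.
Proof.
move=> n0 rg; have := opnorm_power_le_tau 0 n0 rg.
by rewrite expr0 mulr1; apply: le_trans; rewrite -(opnorm1 R n0).
Qed.

End power_growth.

(** * Random variables with finite moments of every order *)

Lemma exprD_le (R : realFieldType) (a b : R) n : 0 <= a -> 0 <= b ->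
  (a + b) ^+ n <= 2 ^+ n * (a ^+ n + b ^+ n).
Proof.
move=> a0 b0; wlog ab : a b a0 b0 / a <= b => [H|].
  have [/H|/ltW/H] := leP a b; first exact.
  by rewrite addrC (addrC (a ^+ n)); apply.
apply: (@le_trans _ _ ((2 * b) ^+ n)).
  by rewrite lerXn2r ?nnegrE ?addr_ge0 ?mulr_ge0//; lra.
by rewrite exprMn ler_wpM2l ?exprn_ge0// lerDr exprn_ge0.
Qed.

Section moments.
Context {R : realType} {dO : measure_display} {O : measurableType dO}.
Variable P : probability O R.

(** This class is an algebra, so integrability of any polynomial in the data follows from that of
    its variables by closure rules alone. *)
Definition all_moments (f : O -> R) : Prop :=
  measurable_fun setT f /\
  forall n, (\int[P]_om (`|f om| ^+ n)%:E < +oo)%E.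

(** A real-valued expectation keeps computations inside [ring] and [lra]; on [all_moments] the
    integral is finite and [fine] loses nothing. *)
Definition ev (f : O -> R) : R := fine (\int[P]_om (f om)%:E).

Lemma all_moments_measurable f : all_moments f -> measurable_fun setT f.
Proof. by case. Qed.

Lemma measurable_norm_exp (f : O -> R) n : measurable_fun setT f ->
  measurable_fun setT (fun om : O => (`|f om| ^+ n)%:E).
Proof.
move=> mf; apply/measurable_EFinP; apply: measurable_funX.
exact: measurableT_comp.
Qed.

Lemma all_moments_integrable f : all_moments f -> P.-integrable setT (EFin \o f).
Proof.
move=> [mf /(_ 1)]; under eq_integral do rewrite expr1.
by move=> fo; apply/integrableP; split; [exact/measurable_EFinP|].
Qed.

Lemma all_moments_cst c : all_moments (fun=> c).
Proof.
split=> [|n]; first exact: measurable_cst.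
by rewrite integral_cst//= probability_setT mule1 ltry.
Qed.

Lemma all_moments_norm_le (f g : O -> R) : measurable_fun setT f -> all_moments g ->
  (forall om, `|f om| <= `|g om|) -> all_moments f.
Proof.
move=> mf [mg g1] fg; split=> // n; apply: le_lt_trans (g1 n).
apply: ge0_le_integral => //.
- exact: measurable_norm_exp.
- exact: measurable_norm_exp.
- by move=> x _; rewrite lee_fin lerXn2r ?nnegrE.
Qed.

Lemma all_momentsD f g : all_moments f -> all_moments g ->
  all_moments (fun om => f om + g om).
Proof.
move=> [mf f1] [mg g1]; split=> [|n]; first exact: measurable_funD.
apply: (@le_lt_trans _ _ (\int[P]_om
  ((2 ^+ n)%:E * ((`|f om| ^+ n)%:E + (`|g om| ^+ n)%:E)))%E).
  apply: ge0_le_integral => //.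
  - by apply: measurable_norm_exp; exact: measurable_funD.
  - apply: emeasurable_funM => //.
    by apply: emeasurable_funD; exact: measurable_norm_exp.
  move=> x _; rewrite -EFinD -EFinM lee_fin.
  apply: le_trans (exprD_le n (normr_ge0 _) (normr_ge0 _)).
  by rewrite lerXn2r ?nnegrE ?addr_ge0 ?ler_normD.
rewrite ge0_integralZl//; last 2 first.
- by apply: emeasurable_funD; exact: measurable_norm_exp.
- by move=> x _; rewrite -EFinD lee_fin addr_ge0 ?exprn_ge0.
rewrite ge0_integralD//; last 2 first.
- exact: measurable_norm_exp.
- exact: measurable_norm_exp.
by apply: lte_mul_pinfty => //; apply: lte_add_pinfty.
Qed.

Lemma all_momentsM f g : all_moments f -> all_moments g ->
  all_moments (fun om => f om * g om).
Proof.
move=> [mf f1] [mg g1]; split=> [|n]; first exact: measurable_funM.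
apply: (@le_lt_trans _ _ (\int[P]_om
  ((`|f om| ^+ (n * 2))%:E + (`|g om| ^+ (n * 2))%:E))%E).
  apply: ge0_le_integral => //.
  - by apply: measurable_norm_exp; exact: measurable_funM.
  - by apply: emeasurable_funD; exact: measurable_norm_exp.
  move=> x _; rewrite -EFinD lee_fin normrM exprMn !exprM.
  have a0 : 0 <= `|f x| ^+ n by rewrite exprn_ge0.
  have b0 : 0 <= `|g x| ^+ n by rewrite exprn_ge0.
  nra.
rewrite ge0_integralD//; last 2 first.
- exact: measurable_norm_exp.
- exact: measurable_norm_exp.
by apply: lte_add_pinfty.
Qed.

Lemma all_momentsZ c f : all_moments f -> all_moments (fun om => c * f om).
Proof. by apply: all_momentsM; exact: all_moments_cst. Qed.

Lemma all_momentsN f : all_moments f -> all_moments (fun om => - f om).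
Proof.
by move=> /(all_momentsZ (-1)); under eq_fun do rewrite mulN1r.
Qed.

Lemma all_momentsB f g : all_moments f -> all_moments g ->
  all_moments (fun om => f om - g om).
Proof. by move=> mf mg; apply: all_momentsD => //; exact: all_momentsN. Qed.

Lemma all_momentsX f n : all_moments f -> all_moments (fun om => f om ^+ n).
Proof.
move=> mf; elim: n => [|n IH].
  by under eq_fun do rewrite expr0; exact: all_moments_cst.
by under eq_fun do rewrite exprS; exact: all_momentsM.
Qed.

Lemma all_moments_sum (I : Type) (r : seq I) (Q : pred I) (f : I -> O -> R) :
  (forall i, Q i -> all_moments (f i)) ->
  all_moments (fun om => \sum_(i <- r | Q i) f i om).
Proof.
move=> mf; elim: r => [|i r IH].
  by under eq_fun do rewrite big_nil; exact: all_moments_cst.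
under eq_fun do rewrite big_cons.
by case Qi : (Q i) => //; apply: all_momentsD => //; exact: mf.
Qed.

Lemma ev_EFin f : all_moments f -> (\int[P]_om (f om)%:E)%E = (ev f)%:E.
Proof.
move=> mf; rewrite /ev fineK//; apply: integrable_fin_num => //.
exact: all_moments_integrable.
Qed.

Lemma eq_ev f g : f =1 g -> ev f = ev g.
Proof. by move=> fg; congr ev; exact: funext. Qed.

Lemma ev_cst c : ev (fun=> c) = c.
Proof. by rewrite /ev integral_cst//= probability_setT mule1. Qed.

Lemma evD f g : all_moments f -> all_moments g ->
  ev (fun om => f om + g om) = ev f + ev g.
Proof.
move=> mf mg; rewrite /ev -[in RHS]fineD; last 2 first.
- by rewrite ev_EFin.
- by rewrite ev_EFin.
congr fine; rewrite -integralD//; last 2 first.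
- exact: all_moments_integrable.
- exact: all_moments_integrable.
Qed.

Lemma evZ c f : all_moments f -> ev (fun om => c * f om) = c * ev f.
Proof.
move=> mf; rewrite /ev; under eq_integral do rewrite EFinM.
rewrite integralZl//; last exact: all_moments_integrable.
by rewrite ev_EFin.
Qed.

Lemma evB f g : all_moments f -> all_moments g ->
  ev (fun om => f om - g om) = ev f - ev g.
Proof.
move=> mf mg; rewrite evD//; last exact: all_momentsN.
congr (_ + _); rewrite -mulN1r -evZ//; apply: eq_ev => om.
by rewrite mulN1r.
Qed.

Lemma ev_sum (I : Type) (r : seq I) (Q : pred I) (f : I -> O -> R) :
  (forall i, all_moments (f i)) ->
  ev (fun om => \sum_(i <- r | Q i) f i om) = \sum_(i <- r | Q i) ev (f i).
Proof.
move=> mf; elim: r => [|i r IH].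
  by rewrite big_nil -[RHS](ev_cst 0); apply: eq_ev => om; rewrite big_nil.
rewrite big_cons -IH; under eq_ev do rewrite big_cons.
by case Qi : (Q i) => //; rewrite evD//; exact: all_moments_sum.
Qed.

Lemma ev_ge0 f : (forall om, 0 <= f om) -> 0 <= ev f.
Proof. by move=> f0; apply: fine_ge0; apply: integral_ge0 => x _; rewrite lee_fin. Qed.

Lemma ler_ev f g : all_moments f -> all_moments g ->
  (forall om, f om <= g om) -> ev f <= ev g.
Proof.
move=> mf mg fg; rewrite -subr_ge0 -evB//; apply: ev_ge0 => om.
by rewrite subr_ge0.
Qed.

End moments.

Ltac moments :=
  repeat first [ assumption | exact: all_moments_cst | apply: all_momentsB
    | apply: all_momentsD | apply: all_momentsN
    | apply: all_momentsX | apply: all_momentsM ].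

(* Polarization turns [E G^4 = 3 (E G^2)^2] on a linear space of variables into
   Wick's formula for products of four of them. *)
Section isserlis.
Context {R : realType} {dO : measure_display} {O : measurableType dO}.
Variable P : probability O R.
Variable V : (O -> R) -> Prop.
Hypothesis VM : forall f, V f -> all_moments P f.
Hypothesis VD : forall f g, V f -> V g -> V (fun om => f om + g om).
Hypothesis VZ : forall c f, V f -> V (fun om => c * f om).
Hypothesis V4 : forall f, V f ->
  ev P (fun om => f om ^+ 4) = 3 * ev P (fun om => f om ^+ 2) ^+ 2.
Local Notation ev := (ev P).

Let signs : seq R := [:: 1; -1].

(** The signed average keeps only monomials odd in each of [b], [c], [d]; in degree four that is
    [a * b * c * d], with coefficient [4! = 24] for each of the 8 sign patterns, whence 192. *)
Let quartic_polarization (a b c d : R) : a * b * c * d = 192%:R^-1 *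
  \sum_(s <- signs) \sum_(t <- signs) \sum_(r <- signs)
    s * t * r * (a + s * b + t * c + r * d) ^+ 4.
Proof. by rewrite !(big_cons, big_nil); field. Qed.

Lemma isserlis f g h k : V f -> V g -> V h -> V k ->
  ev (fun om => f om * g om * h om * k om) =
  ev (fun om => f om * g om) * ev (fun om => h om * k om) +
  ev (fun om => f om * h om) * ev (fun om => g om * k om) +
  ev (fun om => f om * k om) * ev (fun om => g om * h om).
Proof.
move=> Vf Vg Vh Vk.
have [mf mg mh mk] := And4 (VM Vf) (VM Vg) (VM Vh) (VM Vk).
under eq_ev do rewrite quartic_polarization.
have VG s t r : V (fun om => f om + s * g om + t * h om + r * k om).
  by do 3?apply: VD => //; exact: VZ.
have MG s t r n : all_moments P
    (fun om => (f om + s * g om + t * h om + r * k om) ^+ n).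
  by apply: all_momentsX; exact: VM.
(* By [V4] each fourth moment is three times the square of this quadratic in the signs. The
   coefficient of [s * t * r] in that square collects exactly the three pairings. *)
have Q (s t r : R) : ev (fun om => (f om + s * g om + t * h om + r * k om) ^+ 2) =
    ev (fun om => f om * f om) + s ^+ 2 * ev (fun om => g om * g om) +
    t ^+ 2 * ev (fun om => h om * h om) + r ^+ 2 * ev (fun om => k om * k om) +
    (2 * s * ev (fun om => f om * g om) + 2 * t * ev (fun om => f om * h om) +
     2 * r * ev (fun om => f om * k om) + 2 * s * t * ev (fun om => g om * h om) +
     2 * s * r * ev (fun om => g om * k om) + 2 * t * r * ev (fun om => h om * k om)).
  rewrite -!evZ; do ?[exact: all_momentsM].
  rewrite -!evD; do ?[by do ?apply: all_momentsD; do ?apply: all_momentsZ;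
    apply: all_momentsM].
  by apply: eq_ev => om; ring.
have W (s t r : R) : ev (fun om => s * t * r *
    (f om + s * g om + t * h om + r * k om) ^+ 4) =
    s * t * r * (3 * ev (fun om => (f om + s * g om + t * h om + r * k om) ^+ 2) ^+ 2).
  by rewrite evZ// V4.
rewrite evZ; last first.
  by do 3!(apply: all_moments_sum => ? _); exact: all_momentsZ.
rewrite ev_sum; last by move=> s; do 2!(apply: all_moments_sum => ? _); exact: all_momentsZ.
under eq_bigr => s _.
  rewrite ev_sum; last by move=> t; apply: all_moments_sum => ? _; exact: all_momentsZ.
  under eq_bigr => t _.
    rewrite ev_sum; last by move=> r; exact: all_momentsZ.
    under eq_bigr => r _ do rewrite W Q.
    over.
  over.
rewrite !(big_cons, big_nil).
by field.
Qed.

End isserlis.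

(** * Independence as integration over separate copies *)

Section decoupling.
Context {R : realType} {dO : measure_display} {O : measurableType dO}.
Variable P : probability O R.
Variables G1 G2 : set (set O).
Hypotheses (G1m : G1 `<=` measurable) (G2m : G2 `<=` measurable).
Hypotheses (G1I : setI_closed G1) (G2I : setI_closed G2).
Hypotheses (G1T : G1 setT) (G2T : G2 setT).
Hypothesis G12 : forall A B, G1 A -> G2 B -> P (A `&` B) = (P A * P B)%E.

(** In [B], both sides are finite measures agreeing on a pi-system that contains the whole space,
    hence on the generated sigma-algebra. Using this once per argument extends independence to both
    generated sigma-algebras. *)
Lemma indep_half (G : set (set O)) A : G `<=` measurable -> setI_closed G -> G setT ->
  measurable A -> (forall B, G B -> P (B `&` A) = (P B * P A)%E) ->
  forall B, <<s G >> B -> P (B `&` A) = (P B * P A)%E.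
Proof.
move=> Gm GI GT mA H B sB.
have fA : 0 <= fine (P A) by exact: fine_ge0.
have fAE : (fine (P A))%:E = P A by rewrite fineK// fin_num_measure.
have -> : (P B * P A = mscale (NngNum fA) P B)%E by rewrite /mscale /= fAE muleC.
apply: (@g_sigma_algebra_measure_unique _ _ _ G Gm (fun=> setT) _ _
  (mrestr P mA) (mscale (NngNum fA) P)) => //.
- by rewrite bigcup_const//; exists 0%N.
- move=> C GC; rewrite [LHS](H C GC) muleC.
  by rewrite -[in LHS]fAE.
- move=> _; change (P (setT `&` A) < +oo)%E.
  by rewrite setTI ltey_eq fin_num_measure.
Qed.

Lemma sigma_indep A B : <<s G1 >> A -> <<s G2 >> B -> P (A `&` B) = (P A * P B)%E.
Proof.
move=> sA sB.
have mB : measurable B.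
  by move: sB; exact: (smallest_sub (@sigma_algebra_measurable _ O) G2m).
apply: (indep_half G1m) => // A' GA'.
rewrite setIC muleC; apply: (indep_half G2m) => //; first exact: G1m.
by move=> B' GB'; rewrite setIC muleC G12.
Qed.

Let T1 := g_sigma_algebraType G1.
Let T2 := g_sigma_algebraType G2.

Lemma g_sigma_id_measurable (G : set (set O)) : G `<=` measurable ->
  measurable_fun setT (id : O -> g_sigma_algebraType G).
Proof.
move=> Gm _ B mB; rewrite setTI preimage_id.
exact: (smallest_sub (@sigma_algebra_measurable _ O) Gm).
Qed.

Let diag : O -> T1 * T2 := fun om => (om, om).

Let measurable_diag : measurable_fun setT diag.
Proof.
by apply/measurable_fun_pairP; split; exact: g_sigma_id_measurable.
Qed.

(* Under independence the two arguments of a function of [(om, om)] may be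
   averaged over separate copies of the probability space. *)
Lemma decouple_ge0 (F : T1 * T2 -> \bar R) : measurable_fun setT F ->
  (forall z, (0 <= F z)%E) ->
  (\int[P]_om F (om, om) = \int[P]_o1 \int[P]_o2 F (o1, o2))%E.
Proof.
move=> mF F0.
(* The identity, read as a measurable map onto a coarser sigma-algebra, has the restriction of [P]
   as its distribution. *)
pose X1 : {mfun O >-> T1} := HB.pack (id : O -> T1)
  (isMeasurableFun.Build _ _ O T1 _ (g_sigma_id_measurable G1m)).
pose X2 : {mfun O >-> T2} := HB.pack (id : O -> T2)
  (isMeasurableFun.Build _ _ O T2 _ (g_sigma_id_measurable G2m)).
pose m1 := distribution P X1.
pose m2 := distribution P X2.
transitivity (\int[pushforward P diag]_z F z)%E.
  by rewrite (ge0_integral_pushforward measurable_diag).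
transitivity (\int[(m1 \x m2)%E]_z F z)%E.
  (* The law of the diagonal map is the product of the two restrictions because they agree on
     rectangles, which is independence. *)
  apply: eq_measure_integral => X mX _; apply/esym.
  apply: product_measure_unique => // A B mA mB.
  by rewrite /pushforward/= -sigma_indep//.
rewrite fubini_tonelli1// ge0_integral_pushforward//; last 2 first.
- exact: measurable_fun_fubini_tonelli_F.
- by move=> x _; apply: integral_ge0.
apply: eq_integral => x _ /=.
rewrite /fubini_F ge0_integral_pushforward//.
by apply: measurableT_comp => //; exact: pair1_measurable.
Qed.

End decoupling.

(* The pi-system generating the joint sigma-algebra of the primitives indexed
   by [J]. *)
Definition joint_events {O : Type} {I : finType} (G : I -> set (set O))
  (J : pred I) : set (set O) :=
  [set A | exists E : I -> set O, [/\ forall i, G i (E i),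
     forall i, ~~ J i -> E i = setT & A = \bigcap_(i in [set: I]) E i]].

(** * Independent families and sums of independent variables *)

Section independent_family.
Context {R : realType} {dO : measure_display} {O : measurableType dO}.
Variable P : probability O R.
Variables (I : finType) (G : I -> set (set O)).
Hypothesis Gm : forall i, G i `<=` measurable.
Hypothesis GI : forall i, setI_closed (G i).
Hypothesis GT : forall i, G i setT.
Hypothesis Gind : mutually_independent P G.
Implicit Types (J K : pred I) (f g : O -> R).

Definition sigma_on J := g_sigma_algebraType (joint_events G J).

(** This expresses that [f] is a function of the primitives in [J] without exhibiting that
    function. *)
Definition measurable_on J f : Prop :=
  measurable_fun (setT : set (sigma_on J)) (f : sigma_on J -> R).

Lemma joint_events_measurable J : joint_events G J `<=` measurable.
Proof.
move=> _ [E [GE _ ->]]; apply: fin_bigcap_measurable => [|i _].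
  exact: finite_finset.
exact: Gm.
Qed.

Lemma joint_events_setI J : setI_closed (joint_events G J).
Proof.
move=> _ _ [E [GE EJ ->]] [F [GF FJ ->]].
exists (fun i => E i `&` F i); split=> [i|i Ji|]; first exact: GI.
  by rewrite EJ// FJ// setIT.
by rewrite bigcapI.
Qed.

Lemma joint_events_setT J : joint_events G J setT.
Proof.
exists (fun=> setT); split=> [i||] //.
by apply/esym; rewrite bigcapT.
Qed.

Lemma joint_events_in J i A : J i -> G i A -> joint_events G J A.
Proof.
move=> Ji GA; exists (fun k => if k == i then A else setT); split=> [k|k|].
- by case: eqP => // ->.
- by case: eqP => // -> /negP.
- apply/seteqP; split=> [x Ax k _|x /(_ i)]; last by rewrite eqxx; apply.
  by case: ifP.
Qed.

Lemma joint_events_mono J K : (forall i, J i -> K i) ->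
  joint_events G J `<=` joint_events G K.
Proof.
move=> JK A [E [GE EJ ->]]; exists E; split=> // i Ki; apply: EJ.
by apply: contra Ki; exact: JK.
Qed.

(** At every index one of the two events is the whole space, so the product formula for the
    intersected family splits factor by factor. *)
Lemma joint_events_indep J K A B : (forall i, J i -> ~~ K i) ->
  joint_events G J A -> joint_events G K B -> P (A `&` B) = (P A * P B)%E.
Proof.
move=> JK [E [GE EJ ->]] [F [GF FK ->]].
rewrite -bigcapI (Gind GE) (Gind GF) (Gind (fun i => GI (GE i) (GF i))).
rewrite -big_split /=; apply: eq_bigr => i _.
have [Ji|Ji] := boolP (J i).
  by rewrite (FK _ (JK _ Ji)) setIT probability_setT mule1.
by rewrite (EJ _ Ji) setTI probability_setT mul1e.
Qed.

Lemma measurable_on_measurable J f : measurable_on J f -> measurable_fun setT f.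
Proof.
move=> mf _ B mB; have := mf measurableT B mB.
exact: (smallest_sub (@sigma_algebra_measurable _ O) (@joint_events_measurable J)).
Qed.

Lemma measurable_on_mono J K f : (forall i, J i -> K i) ->
  measurable_on J f -> measurable_on K f.
Proof.
move=> JK mf _ B mB; have := mf measurableT B mB.
apply: sub_smallest2r; first exact: smallest_sigma_algebra.
exact: joint_events_mono.
Qed.

Lemma measurable_on_event J i f : J i ->
  (forall B, measurable B -> G i (f @^-1` B)) -> measurable_on J f.
Proof.
move=> Ji Gf _ B mB; rewrite setTI; apply: sub_gen_smallest.
by apply: (joint_events_in Ji); exact: Gf.
Qed.

Lemma decouple_on J K (F : sigma_on J * sigma_on K -> \bar R) :
  (forall i, J i -> ~~ K i) -> measurable_fun setT F ->
  (forall z, (0 <= F z)%E) ->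
  (\int[P]_om F (om, om) = \int[P]_o1 \int[P]_o2 F (o1, o2))%E.
Proof.
move=> JK mF F0; apply: (@decouple_ge0 _ _ O P (joint_events G J)
  (joint_events G K) (@joint_events_measurable J) (@joint_events_measurable K)
  (@joint_events_setI J) (@joint_events_setI K) (@joint_events_setT J)
  (@joint_events_setT K) (fun A B => joint_events_indep JK) F) => //.
Qed.

Lemma indep_integralM J K f g : (forall i, J i -> ~~ K i) ->
  measurable_on J f -> measurable_on K g ->
  (forall om, 0 <= f om) -> (forall om, 0 <= g om) ->
  (\int[P]_om (f om * g om)%:E = \int[P]_om (f om)%:E * \int[P]_om (g om)%:E)%E.
Proof.
move=> JK mf mg f0 g0.
have mf' := measurable_on_measurable mf; have mg' := measurable_on_measurable mg.
rewrite (@decouple_on J K (fun z => (f z.1 * g z.2)%:E))//; last 2 first.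
- apply/measurable_EFinP; apply: measurable_funM.
    exact: (measurableT_comp mf).
  exact: (measurableT_comp mg).
- by move=> z; rewrite lee_fin mulr_ge0.
have -> : (\int[P]_o1 \int[P]_o2 (f o1 * g o2)%:E =
    \int[P]_o1 ((f o1)%:E * \int[P]_o2 (g o2)%:E))%E.
  apply: eq_integral => x _; under eq_integral do rewrite EFinM.
  rewrite ge0_integralZl ?lee_fin//; first exact/measurable_EFinP.
  by move=> y _; rewrite lee_fin.
rewrite ge0_integralZr//; first exact/measurable_EFinP.
  by move=> x _; rewrite lee_fin.
by apply: integral_ge0 => x _; rewrite lee_fin.
Qed.

(** Decoupling covers nonnegative integrands only; each variable is therefore written as
    [|h| - (|h| - h)], a difference of nonnegative variables with all moments, and the product is
    expanded. *)
Lemma indep_evM J K f g : (forall i, J i -> ~~ K i) ->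
  measurable_on J f -> measurable_on K g -> all_moments P f -> all_moments P g ->
  ev P (fun om => f om * g om) = ev P f * ev P g.
Proof.
move=> JK mf mg Mf Mg.
have ge0_case u v : measurable_on J u -> measurable_on K v ->
    all_moments P u -> all_moments P v ->
    (forall om, 0 <= u om) -> (forall om, 0 <= v om) ->
    ev P (fun om => u om * v om) = ev P u * ev P v.
  move=> mu mv Mu Mv u0 v0; rewrite /ev (indep_integralM JK)//.
  by rewrite !ev_EFin.
have ge0_split L h : measurable_on L h -> all_moments P h -> exists p n : O -> R,
    [/\ measurable_on L p, measurable_on L n, all_moments P p, all_moments P n &
     [/\ forall om, 0 <= p om, forall om, 0 <= n om &
      forall om, h om = p om - n om]].
  move=> mh Mh; exists (fun om => `|h om|), (fun om => `|h om| - h om).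
  have mN : measurable_on L (fun om => `|h om|) by exact: (measurableT_comp _ mh).
  have MN : all_moments P (fun om => `|h om|).
    apply: (all_moments_norm_le _ Mh) => [|om]; last by rewrite normr_id.
    exact: (measurableT_comp _ (all_moments_measurable Mh)).
  split=> //; first exact: measurable_funB.
  - exact: all_momentsB.
  - split=> om //; first by rewrite subr_ge0 ler_norm.
    by rewrite opprB addrC subrK.
have [p [n [mp mn Mp Mn [p0 n0 fE]]]] := ge0_split _ _ mf Mf.
have [q [m [mq mm Mq Mm [q0 m0 gE]]]] := ge0_split _ _ mg Mg.
have -> : f = (fun om => p om - n om) by exact/funext.
have -> : g = (fun om => q om - m om) by exact/funext.
transitivity (ev P (fun om => (p om * q om + n om * m om)
                              - (p om * m om + n om * q om))).
  by apply: eq_ev => om; ring.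
rewrite (evB Mp Mn) (evB Mq Mm) evB; do ?[by moments].
by rewrite !evD; do ?[by moments]; rewrite !ge0_case//; ring.
Qed.

(* Mean zero with the second-to-fourth moment relation of a centred Gaussian:
   all that the second-moment computations need, and stable under sums of
   independent variables without convolving densities. *)
Definition gaussian4 J f := [/\ measurable_on J f, all_moments P f, ev P f = 0 &
  ev P (fun om => f om ^+ 4) = 3 * ev P (fun om => f om ^+ 2) ^+ 2].

(** Terms with an odd power vanish by independence and zero means, and
    [3 a^2 + 6 a b + 3 b^2 = 3 (a + b)^2] for the variances [a] and [b]. *)
Lemma gaussian4D J K f g : (forall i, J i -> ~~ K i) ->
  gaussian4 J f -> gaussian4 K g ->
  gaussian4 (fun i => J i || K i) (fun om => f om + g om).
Proof.
move=> JK [mf Mf f1 f4] [mg Mg g1 g4]; split.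
- apply: measurable_funD.
    by apply: measurable_on_mono mf => i Ji; rewrite /= Ji.
  by apply: measurable_on_mono mg => i Ji; rewrite /= Ji orbT.
- exact: all_momentsD.
- by rewrite evD// f1 g1 addr0.
have X n L h : measurable_on L h -> measurable_on L (fun om => h om ^+ n).
  by move=> mh; exact: measurable_funX.
have -> : ev P (fun om => (f om + g om) ^+ 2) =
    ev P (fun om => f om ^+ 2) + ev P (fun om => g om ^+ 2).
  have -> : ev P (fun om => (f om + g om) ^+ 2) =
      ev P (fun om => f om ^+ 2 + 2 * (f om * g om) + g om ^+ 2).
    by apply: eq_ev => om; ring.
  rewrite !evD; do ?[by moments]; rewrite evZ; last by moments.
  by rewrite (indep_evM JK)// f1 mul0r mulr0 addr0.
have -> : ev P (fun om => (f om + g om) ^+ 4) =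
    ev P (fun om => f om ^+ 4 + 4 * (f om ^+ 3 * g om)
      + 6 * (f om ^+ 2 * g om ^+ 2) + 4 * (f om * g om ^+ 3) + g om ^+ 4).
  by apply: eq_ev => om; ring.
rewrite !evD; do ?[by moments]; rewrite !evZ; do ?[by moments].
have indepX m n := indep_evM JK (X m _ _ mf) (X n _ _ mg)
  (all_momentsX m Mf) (all_momentsX n Mg).
have -> : ev P (fun om => f om ^+ 3 * g om) = 0.
  by rewrite [LHS](indepX 3 1) -[RHS](mulr0 (ev P (fun om => f om ^+ 3))) -g1.
have -> : ev P (fun om => f om * g om ^+ 3) = 0.
  by rewrite [LHS](indepX 1 3) -[RHS](mul0r (ev P (fun om => g om ^+ 3))) -f1.
by rewrite (indepX 2 2) f4 g4; ring.
Qed.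

Lemma gaussian4_cst0 J : gaussian4 J (fun=> 0).
Proof.
split.
- exact: measurable_cst.
- exact: all_moments_cst.
- exact: ev_cst.
- by under eq_ev do rewrite expr0n; rewrite ev_cst;
     under eq_ev do rewrite expr0n; rewrite ev_cst expr0n mulr0.
Qed.

Lemma gaussian4_sum (h : I -> O -> R) :
  (forall i, gaussian4 (pred1 i) (h i)) ->
  gaussian4 predT (fun om => \sum_i h i om).
Proof.
move=> hi.
have H (r : seq I) : uniq r -> gaussian4 [pred i | i \in r]
    (fun om => \sum_(i <- r) h i om).
  elim: r => [_|i r IH /= /andP[ir ur]].
    by under [X in gaussian4 _ X]eq_fun do rewrite big_nil; exact: gaussian4_cst0.
  under [X in gaussian4 _ X]eq_fun do rewrite big_cons.
  have D : forall k, pred1 i k -> ~~ [pred i | i \in r] k.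
    by move=> k /= /eqP ->.
  have [m M e1 e4] := gaussian4D D (hi i) (IH ur).
  split=> //; exact: measurable_on_mono m.
have [m M e1 e4] := H _ (index_enum_uniq I).
by split=> //; apply: measurable_on_mono m.
Qed.

End independent_family.

(** * Moments of the normal density *)

Section normal_moments.
Variables (R : realType) (s : R).
Hypothesis s0 : 0 < s.
Notation mu := (@lebesgue_measure R).
Local Notation phi := (normal_pdf 0 s : R -> R).

Let sN0 : s != 0. Proof. by rewrite gt_eqF. Qed.

Lemma is_derive_normal_pdf (x : R) : is_derive x 1 phi (- (x / s ^+ 2) * phi x).
Proof.
have E : phi = (fun x => normal_peak s * expR (- (2 * s ^+ 2)^-1 * x ^+ 2)).
  apply/funext => y; rewrite normal_pdfE// /normal_fun subr0.
  by congr (_ * expR _); field.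
rewrite E.
apply: is_derive_eq.
rewrite /GRing.scale /=.
by field.
Qed.


Let continuous_phi : continuous phi.
Proof. exact: continuous_normal_pdf. Qed.

Let continuous_Xphi n : continuous (fun x : R => x ^+ n * phi x).
Proof.
by move=> x; apply: cvgM; [exact: exprn_continuous|exact: continuous_phi].
Qed.

Let I_ n := fun N : nat => \int[mu]_(x in `[- N%:R, N%:R]) (x ^+ n * phi x).

Let integrable_Xphi n (a b : R) :
  mu.-integrable `[a, b] (EFin \o (fun x : R => x ^+ n * phi x)).
Proof.
apply: continuous_compact_integrable; first exact: segment_compact.
exact/continuous_subspaceT/continuous_Xphi.
Qed.

(** Integration by parts on [[-N, N]] from [phi' = - (x / s^2) phi]. The primitive [F] is odd, so
    the two boundary terms add up. *)
Lemma truncated_moment_rec k N : (0 < N)%N ->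
  I_ k.*2.+2 N = k.*2.+1%:R * s ^+ 2 * I_ k.*2 N
    - 2 * s ^+ 2 * (N%:R ^+ k.*2.+1 * phi N%:R).
Proof.
move=> N0.
pose F (x : R) := - s ^+ 2 * (x ^+ k.*2.+1 * phi x).
pose f (x : R) := x ^+ k.*2.+2 * phi x - k.*2.+1%:R * s ^+ 2 * (x ^+ k.*2 * phi x).
have dF (x : R) : is_derive x 1 F (f x).
  have dp := is_derive_normal_pdf x.
  have FE : F = - s ^+ 2 \*: ((@id R) ^+ k.*2.+1 * phi).
    by apply/funext => y; rewrite /F /GRing.scale /= !fctE.
  rewrite FE; apply: (is_derive_eq (is_deriveZ _ (is_deriveM (is_deriveX _ (is_derive_id _ _)) dp))).
  rewrite /GRing.scale /= fctE /f /= !exprS.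
  by field.
have cF : continuous F.
  by move=> x; apply/differentiable_continuous/derivable1_diffP; case: (dF x).
have cf : continuous f.
  move=> x; apply: cvgB; first exact: continuous_Xphi.
  by apply: cvgM; [exact: cvg_cst|exact: continuous_Xphi].
have NN : (- N%:R < N%:R :> R)%R by rewrite gtrN// ltr0n.
have := @continuous_FTC2 R f F _ _ NN (continuous_subspaceT cf).
have -> : (\int[mu]_(x in `[(- N%:R)%R, N%:R]) (f x)%:E =
    (I_ k.*2.+2 N - k.*2.+1%:R * s ^+ 2 * I_ k.*2 N)%:E)%E.
  rewrite /I_ -(@RintegralZl _ _ _ mu _ _ (k.*2.+1%:R * s ^+ 2)
    (measurable_itv _) (integrable_Xphi k.*2 (- N%:R) N%:R)).
  rewrite -RintegralB//; last first.
    exact: (@integrableZl _ _ _ mu _ (measurable_itv _) (k.*2.+1%:R * s ^+ 2) _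
      (integrable_Xphi k.*2 (- N%:R) N%:R)).
  rewrite /Rintegral fineK//.
  apply: integrable_fin_num => //.
  apply: continuous_compact_integrable; first exact: segment_compact.
  exact/continuous_subspaceT.
have phiN (x : R) : phi (- x) = phi x.
  by rewrite normal_pdfE// /normal_fun !subr0 sqrrN.
move=> H; suff : (I_ k.*2.+2 N - k.*2.+1%:R * s ^+ 2 * I_ k.*2 N)%:E =
    ((F N%:R)%:E - (F (- N%:R))%:E)%E.
  rewrite -EFinB => -[/eqP]; rewrite subr_eq => /eqP ->.
  rewrite /F phiN exprNn -signr_odd /= odd_double /=; ring.
apply: H.
- split.
  + by move=> x _; case: (dF x).
  + exact/cvg_at_right_filter/cF.
  + exact/cvg_at_left_filter/cF.
- by move=> x _; rewrite derive1E; case: (dF x).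
Qed.


(** Even powers are nonnegative, so monotone convergence along the growing intervals applies before
    integrability on the line is known. *)
Lemma cvg_truncated_moment k :
  (I_ k.*2 N)%:E @[N --> \oo] --> (\int[mu]_x (x ^+ k.*2 * phi x)%:E)%E.
Proof.
have -> : (fun N => (I_ k.*2 N)%:E) =
    (fun N : nat => \int[mu]_(x in `[(- N%:R)%R, N%:R]) (x ^+ k.*2 * phi x)%:E)%E.
  apply/funext => N; rewrite /I_ /Rintegral fineK//.
  exact/integrable_fin_num/integrable_Xphi.
have -> : [set: R] = \bigcup_N `[(- N%:R)%R, N%:R]%classic.
  apply/seteqP; split=> // x _; exists (Num.truncn `|x|).+1 => //=.
  by rewrite in_itv /= -ler_norml ltW// truncnS_gt.
apply: ge0_nondecreasing_set_cvg_integral.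
- apply/nondecreasing_seqP => N; rewrite subsetEset => x /=.
  rewrite !in_itv /= -!ler_norml => /le_trans; apply.
  by rewrite ler_nat.
- by move=> i; exact: measurable_itv.
- move=> i; apply/measurable_EFinP; apply: measurable_funM => //.
  by apply: measurable_funTS; exact: measurable_normal_pdf.
- move=> i x _; rewrite lee_fin mulr_ge0 ?normal_pdf_ge0//.
  by rewrite exprn_even_ge0// odd_double.
Qed.

Lemma cvg_boundary_term n : (N%:R ^+ n * phi N%:R) @[N --> \oo] --> (0 : R).
Proof.
(* [b] comes from the Taylor term of order [n + 1] of the exponential, giving decay at least
   [1 / N]; the factor 2 in [c] converts [1 / N] into [harmonic N = 1 / (N + 1)]. *)
pose b := n.+1`!%:R * (2 * s ^+ 2) ^+ n.+1 : R.
pose c := normal_peak s * (b * 2).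
apply: (@squeeze_cvgr _ _ _ _ (fun=> 0) (fun N : nat => c * harmonic N)); last 2 first.
- exact: cvg_cst.
- rewrite -(mulr0 c); apply: cvgM; [exact: cvg_cst|exact: cvg_harmonic].
near=> N.
rewrite mulr_ge0 ?exprn_ge0 ?normal_pdf_ge0//= normal_pdfE// /c /normal_fun subr0.
rewrite mulrCA -!mulrA ler_wpM2l ?normal_peak_ge0//.
have N1 : 1 <= N%:R :> R by rewrite ler1n; near: N; exists 1%N.
have N0 : 0 < N%:R :> R by exact: lt_le_trans N1.
set x : R := N%:R in N1 N0 *.
rewrite -[s ^+ 2 *+ 2]mulr_natl mulNr expRN.
have q0 : 0 < 2 * s ^+ 2 by rewrite mulr_gt0// exprn_gt0.
set q := 2 * s ^+ 2 in b c q0 *.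
have y0 : 0 <= x ^+ 2 / q by rewrite divr_ge0 ?sqr_ge0// ltW.
have b0 : 0 < b by rewrite mulr_gt0 ?ltr0n ?fact_gt0// exprn_gt0.
have xb : x ^+ n.*2.+2 / b <= expR (x ^+ 2 / q).
  apply: le_trans (expR_ge1Dxn n y0); rewrite addrC ler_wpDr//.
  by rewrite /b expr_div_n -exprM mul2n doubleS invfM mulrA mulrAC.
have x2 : 0 < x ^+ n.*2.+2 by rewrite exprn_gt0.
have eb : (expR (x ^+ 2 / q))^-1 <= b / x ^+ n.*2.+2.
  rewrite -[leRHS]invrK lef_pV2 ?posrE ?expR_gt0//; first by rewrite invf_div.
  by rewrite invr_gt0 divr_gt0.
apply: (@le_trans _ _ (x ^+ n * (b / x ^+ n.*2.+2))).
  by rewrite ler_wpM2l// exprn_ge0// ltW.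
rewrite [leRHS]mulrA -/b mulrCA ler_wpM2l ?(ltW b0)//.
rewrite ler_pdivrMr// mulrAC ler_pdivlMr ?ltr0n// -addn1 natrD -/x.
apply: (@le_trans _ _ (x ^+ n * (2 * x))).
  by rewrite ler_wpM2l ?exprn_ge0// ?(ltW N0)//; lra.
rewrite mulrCA ler_wpM2l// -exprSr ler_weXn2l//.
by rewrite -addnn ltnS leqW// leq_addr.
Unshelve. all: by end_near. Qed.

Lemma normal_even_moment_rec k (c : R) :
  (\int[mu]_x (x ^+ k.*2 * phi x)%:E = c%:E)%E ->
  (\int[mu]_x (x ^+ k.*2.+2 * phi x)%:E = (k.*2.+1%:R * s ^+ 2 * c)%:E)%E.
Proof.
move=> kc; have := @cvg_truncated_moment k; rewrite kc => /fine_cvgP[_ Ik].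
have := @cvg_truncated_moment k.+1; rewrite doubleS => Ik2.
apply: (cvg_unique _ Ik2) => //.
apply/fine_cvgP; split; first exact: nearW.
have : (k.*2.+1%:R * s ^+ 2 * I_ k.*2 N - 2 * s ^+ 2 * (N%:R ^+ k.*2.+1 * phi N%:R))
    @[N --> \oo] --> k.*2.+1%:R * s ^+ 2 * c - 2 * s ^+ 2 * 0.
  apply: cvgB; first by apply: cvgM => //; exact: cvg_cst.
  by apply: cvgM; [exact: cvg_cst|exact: cvg_boundary_term].
rewrite mulr0 subr0; apply: cvg_trans; apply: near_eq_cvg.
near=> N; rewrite /= truncated_moment_rec//.
near: N; by exists 1%N.
Unshelve. all: by end_near. Qed.

Lemma normal_even_moment k :
  (\int[mu]_x (x ^+ k.*2 * phi x)%:E = (\prod_(i < k) (i.*2.+1%:R * s ^+ 2))%:E)%E.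
Proof.
elim: k => [|k IH].
  under eq_integral do rewrite expr0 mul1r.
  by rewrite big_ord0; exact: integral_normal_pdf.
rewrite doubleS (normal_even_moment_rec IH) big_ord_recr /=.
by congr (_%:E); rewrite mulrC.
Qed.

(** Change of variables is available for the Radon-Nikodym derivative, which equals the density
    almost everywhere since both have the same integral over every measurable set. *)
Lemma integral_normal_prob (f : R -> \bar R) : measurable_fun setT f ->
  (forall x, 0 <= f x)%E ->
  (\int[normal_prob 0 s]_x f x = \int[mu]_x (f x * (phi x)%:E))%E.
Proof.
move=> mf f0.
have dom := @normal_prob_dominates R 0 s.
rewrite -(Radon_Nikodym_SigmaFinite.change_of_variables dom f0 measurableT mf).
apply: ae_eq_integral => //.
- apply: emeasurable_funM => //.
  exact: (measurable_int _ (Radon_Nikodym_SigmaFinite.f_integrable dom)).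
- apply: emeasurable_funM => //.
  by apply/measurable_EFinP; exact: measurable_normal_pdf.
apply: ae_eqe_mul2l; apply: integral_ae_eq => //.
- exact: Radon_Nikodym_SigmaFinite.f_integrable.
- by apply/measurable_EFinP; exact: measurable_normal_pdf.
by move=> E _ mE; rewrite -Radon_Nikodym_SigmaFinite.f_integral.
Qed.

End normal_moments.

(** * Moments of scalar Gaussian variables, degenerate case included *)

Section real_gaussian_moments.
Context {R : realType} {dO : measure_display} {O : measurableType dO}.
Variable P : probability O R.
Variables (X : O -> R) (v : R).
Hypotheses (v0 : 0 <= v) (gX : real_gaussian P X 0 v).
Notation mu := (@lebesgue_measure R).

Lemma real_gaussian_integral (f : R -> \bar R) : measurable_fun setT f ->
  (forall x, 0 <= f x)%E ->
  (\int[P]_om f (X om) = if v == 0%R then f 0%R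
    else \int[mu]_x (f x * (normal_pdf 0 (Num.sqrt v) x)%:E))%E.
Proof.
move=> mf f0; have [mX lX] := gX.
pose Y : O -> measurableTypeR R := X.
have mY : measurable_fun setT Y by exact: mX.
have mf' : measurable_fun (setT : set (measurableTypeR R)) f by exact: mf.
transitivity (\int[pushforward P Y]_x f x)%E.
  by rewrite ge0_integral_pushforward.
case: eqP => [vE|/eqP vN0].
  transitivity (\int[dirac (0%R : measurableTypeR R)]_x f x)%E.
    apply: eq_measure_integral => A mA _.
    by rewrite /pushforward [LHS]lX// /gaussian_law vE eqxx.
  by rewrite integral_dirac// diracT mul1e.
rewrite -(integral_normal_prob _ mf f0).
apply: eq_measure_integral => A mA _.
by rewrite /pushforward [LHS]lX// /gaussian_law (negbTE vN0).
Qed.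

(** The product is [(2k - 1)!! v^k], the source of the later constants 3 and 105 = 3 * 5 * 7. *)
Lemma real_gaussian_even_moment k :
  (\int[P]_om (X om ^+ k.*2)%:E = (\prod_(i < k) (i.*2.+1%:R * v))%:E)%E.
Proof.
rewrite (real_gaussian_integral (f := fun x => (x ^+ k.*2)%:E)); last 2 first.
- by apply/measurable_EFinP; exact: measurable_funX.
- by move=> x; rewrite lee_fin exprn_even_ge0// odd_double.
case: eqP => [->|/eqP vN0].
  case: k => [|k]; first by rewrite expr0 big_ord0.
  by rewrite doubleS expr0n /= big_ord_recr /= mulr0 mulr0.
have s0 : 0 < Num.sqrt v by rewrite sqrtr_gt0 lt_def vN0.
under eq_integral do rewrite -EFinM.
rewrite normal_even_moment//; congr (_%:E); apply: eq_bigr => i _.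
by rewrite sqr_sqrtr.
Qed.

Lemma real_gaussian_all_moments : all_moments P X.
Proof.
have [mX _] := gX; split=> // n.
apply: (@le_lt_trans _ _ (\int[P]_om (1%:E + (X om ^+ n.*2)%:E))%E).
  apply: ge0_le_integral => //.
  - exact: measurable_norm_exp.
  - apply: emeasurable_funD => //; apply/measurable_EFinP.
    exact: measurable_funX.
  move=> x _; rewrite -EFinD lee_fin -muln2 exprM -normrX.
  rewrite -[_ ^+ 2]real_normK ?num_real//.
  have := normr_ge0 (X x ^+ n); nra.
rewrite ge0_integralD//; last 2 first.
- by move=> x _; rewrite lee_fin exprn_even_ge0// odd_double.
- by apply/measurable_EFinP; exact: measurable_funX.
rewrite real_gaussian_even_moment integral_cst//= probability_setT mule1.
by rewrite -EFinD ltry.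
Qed.

Lemma real_gaussian_symmetric (f : R -> \bar R) : measurable_fun setT f ->
  (forall x, 0 <= f x)%E ->
  (\int[P]_om f (- X om)%R = \int[P]_om f (X om))%E.
Proof.
move=> mf f0.
rewrite (real_gaussian_integral (f := fun x => f (- x)))//; last first.
  by apply: measurableT_comp => //; exact: measurable_funN.
rewrite real_gaussian_integral// oppr0; case: eqP => // /eqP vN0.
have s0 : 0 < Num.sqrt v by rewrite sqrtr_gt0 lt_def vN0.
have pN x : normal_pdf 0 (Num.sqrt v) (- x) = normal_pdf 0 (Num.sqrt v) x.
  by rewrite normal_pdfE ?gt_eqF// /normal_fun !subr0 sqrrN.
pose g (x : R) := (f x * (normal_pdf 0 (Num.sqrt v) x)%:E)%E.
have mg : measurable_fun setT g.
  apply: emeasurable_funM => //.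
  by apply/measurable_EFinP; exact: measurable_normal_pdf.
transitivity (\int[mu]_x g (- x)%R)%E.
  by apply: eq_integral => x _; rewrite /g pN.
transitivity (\int[pushforward mu (-%R : measurableTypeR R -> measurableTypeR R)]_x g x)%E.
  rewrite ge0_integral_pushforward//.
  by move=> x _; apply: mule_ge0; [exact: f0|rewrite lee_fin normal_pdf_ge0].
by apply: eq_measure_integral => A mA _; exact: lebesgue_measureN.
Qed.

(** The transfer formula concerns nonnegative functions, so symmetry is applied to [|x| + x]: it
    gives [E|X| - E X = E|X| + E X]. *)
Lemma real_gaussian_mean : ev P X = 0.
Proof.
have MX := real_gaussian_all_moments.
have mN : measurable_fun setT (fun x : R => (`|x| + x)%:E).
  by apply/measurable_EFinP; apply: measurable_funD => //; exact: normr_measurable.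
have MN : all_moments P (fun om => `|X om|).
  apply: (all_moments_norm_le _ MX) => [|om]; last by rewrite normr_id.
  exact: (measurableT_comp _ (all_moments_measurable MX)).
have := @real_gaussian_symmetric _ mN.
have N0 (x : R) : 0 <= `|x| + x by rewrite -lerBlDr sub0r -normrN ler_norm.
move=> /(_ (fun x => N0 x)).
under eq_integral do rewrite normrN.
rewrite !ev_EFin; do ?[exact: all_momentsD|exact: all_momentsB].
rewrite evB// evD// => -[]; lra.
Qed.

Lemma real_gaussian_ev2 : ev P (fun om => X om ^+ 2) = v.
Proof.
rewrite /ev (@real_gaussian_even_moment 1) /= big_ord_recr big_ord0 /=.
by rewrite !mul1r.
Qed.

Lemma real_gaussian_ev4 : ev P (fun om => X om ^+ 4) = 3 * v ^+ 2.
Proof.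
rewrite /ev (@real_gaussian_even_moment 2) /= !big_ord_recr big_ord0 /=.
by rewrite -!muln2 /=; ring.
Qed.

Lemma real_gaussian_ev8 : ev P (fun om => X om ^+ 8) = 105 * v ^+ 4.
Proof.
rewrite /ev (@real_gaussian_even_moment 4) /= !big_ord_recr big_ord0 /=.
by rewrite -!muln2 /=; ring.
Qed.

End real_gaussian_moments.

(** * Gaussian vectors and their quadratic forms *)

Section vec_gaussian_moments.
Context {R : realType} {dO : measure_display} {O : measurableType dO}.
Variable P : probability O R.
Variables (d : nat) (X : O -> 'cV[R]_d).
Local Notation ev := (ev P).

Lemma psd1 : psd (1%:M : 'M[R]_d).
Proof. by split=> [|u]; [exact: trmx1|rewrite qformE mul1mx dot_ge0]. Qed.

Section general_covariance.
Variable S : 'M[R]_d.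
Hypotheses (S0 : psd S) (gX : vec_gaussian P X S).

Let gu u : real_gaussian P (fun om => dot u (X om)) 0 (qform S u).
Proof. by have [_] := gX; exact. Qed.

Let qu u : 0 <= qform S u. Proof. by have [_] := S0; exact. Qed.

Lemma vec_gaussian_all_moments u : all_moments P (fun om => dot u (X om)).
Proof. exact: real_gaussian_all_moments (qu u) (gu u). Qed.

Lemma vec_gaussian_mean u : ev (fun om => dot u (X om)) = 0.
Proof. exact: real_gaussian_mean (qu u) (gu u). Qed.

Lemma vec_gaussian_ev2 u : ev (fun om => dot u (X om) ^+ 2) = qform S u.
Proof. exact: real_gaussian_ev2 (qu u) (gu u). Qed.

Lemma vec_gaussian_ev4 u : ev (fun om => dot u (X om) ^+ 4) = 3 * qform S u ^+ 2.
Proof. exact: real_gaussian_ev4 (qu u) (gu u). Qed.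

Lemma vec_gaussian_ev8 u : ev (fun om => dot u (X om) ^+ 8) = 105 * qform S u ^+ 4.
Proof. exact: real_gaussian_ev8 (qu u) (gu u). Qed.

Lemma vec_gaussian_cov u v :
  ev (fun om => dot u (X om) * dot v (X om)) = dot u (S *m v).
Proof.
have [Sym _] := S0.
have Mu := vec_gaussian_all_moments u; have Mv := vec_gaussian_all_moments v.
have := vec_gaussian_ev2 (u + v).
under eq_ev do rewrite dotDl.
have -> : ev (fun om => (dot u (X om) + dot v (X om)) ^+ 2) =
    ev (fun om => dot u (X om) ^+ 2 + 2 * (dot u (X om) * dot v (X om))
      + dot v (X om) ^+ 2).
  by apply: eq_ev => om; ring.
rewrite evD ?evD ?evZ; do ?[by moments].
rewrite !vec_gaussian_ev2 !qformE mulmxDr !dotDl !dotDr.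
have -> : dot v (S *m u) = dot u (S *m v).
  by rewrite dot_mulmxr Sym dotC.
lra.
Qed.

Lemma vec_gaussian_isserlis u v r q :
  ev (fun om => dot u (X om) * dot v (X om) * dot r (X om) * dot q (X om)) =
  dot u (S *m v) * dot r (S *m q) + dot u (S *m r) * dot v (S *m q)
  + dot u (S *m q) * dot v (S *m r).
Proof.
pose V f := exists u, f = (fun om => dot u (X om)).
have Vd a : V (fun om => dot a (X om)) by exists a.
rewrite (@isserlis _ _ _ P V) ?vec_gaussian_cov//.
- by move=> _ [a ->]; exact: vec_gaussian_all_moments.
- move=> _ _ [a ->] [b ->]; exists (a + b); apply/funext => om.
  by rewrite dotDl.
- move=> c _ [a ->]; exists (c *: a); apply/funext => om.
  by rewrite dotZl.
- move=> _ [a ->].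
  by rewrite vec_gaussian_ev4 vec_gaussian_ev2.
Qed.

End general_covariance.

Section standard.
Hypothesis gX : vec_gaussian P X 1%:M.

Lemma dot_delta (i : 'I_d) (v : 'cV[R]_d) : dot (delta_mx i 0) v = v i 0.
Proof.
rewrite dotE (bigD1 i)//= big1 ?addr0 => [|k /negbTE ki].
  by rewrite mxE !eqxx mul1r.
by rewrite mxE ki mul0r.
Qed.

Lemma std_all_moments u : all_moments P (fun om => dot u (X om)).
Proof. exact: vec_gaussian_all_moments psd1 gX u. Qed.

Lemma std_coord_all_moments i : all_moments P (fun om => X om i 0).
Proof.
by have := std_all_moments (delta_mx i 0); under eq_fun do rewrite dot_delta.
Qed.

Lemma std_dot_all_moments (M : 'M[R]_d) :
  all_moments P (fun om => dot (M *m X om) (M *m X om)).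
Proof.
under eq_fun do rewrite dot_sqr; apply: all_moments_sum => i _.
apply: all_momentsX; under eq_fun do rewrite mulmx_row_dot.
exact: std_all_moments.
Qed.

Lemma std_ev4 u : ev (fun om => dot u (X om) ^+ 4) = 3 * dot u u ^+ 2.
Proof. by rewrite (vec_gaussian_ev4 psd1 gX) qformE mul1mx. Qed.

Lemma std_ev8 u : ev (fun om => dot u (X om) ^+ 8) = 105 * dot u u ^+ 4.
Proof. by rewrite (vec_gaussian_ev8 psd1 gX) qformE mul1mx. Qed.

(* Splitting the rows into length and direction makes the weights [s i] sum to
   [frob2 M], as Jensen's inequality requires. *)
Let row_split (M : 'M[R]_d) : exists (s : 'I_d -> R) (u : 'I_d -> 'cV[R]_d),
  [/\ forall i, 0 <= s i, \sum_i s i = frob2 M, forall i, dot (u i) (u i) <= 1 &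
   forall v, dot (M *m v) (M *m v) = \sum_i s i * dot (u i) v ^+ 2].
Proof.
pose r i := (row i M)^T.
exists (fun i => dot (r i) (r i)), (fun i => (vnorm (r i))^-1 *: r i).
split=> [i|||v].
- exact: dot_ge0.
- by rewrite frob2_rows.
- move=> i; rewrite dotZl dotC dotZl -sqr_vnorm.
  have [->|n0] := eqVneq (vnorm (r i)) 0; first by rewrite invr0 !mul0r.
  by rewrite expr2 mulKf// mulVf.
- rewrite dot_sqr; apply: eq_bigr => i _; rewrite mulmx_row_dot dotZl -/(r i).
  have [n0|n0] := eqVneq (vnorm (r i)) 0.
    by rewrite (vnorm_eq0 n0) [in LHS]/dot trmx0 mul0mx mxE expr0n /= dotC /dot
      trmx0 !mul0mx mxE mul0r.
  by rewrite exprMn mulrA -sqr_vnorm -exprMn divff// expr1n mul1r.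
Qed.

(** Two applications of Jensen's inequality, for the exponents 2 and 4, reduce the eighth moment of
    [|M X|] to that of one-dimensional projections. *)
Lemma std_norm8 (M : 'M[R]_d) :
  ev (fun om => dot (M *m X om) (M *m X om) ^+ 4) <= 105 * frob2 M ^+ 4.
Proof.
have [s [u [s0 sM u1 E]]] := row_split M.
apply: (@le_trans _ _ (ev (fun om =>
    frob2 M ^+ 3 * \sum_i s i * dot (u i) (X om) ^+ 8))).
  apply: ler_ev.
  - by apply: all_momentsX; exact: std_dot_all_moments.
  - apply: all_momentsZ; apply: all_moments_sum => i _; apply: all_momentsZ.
    by apply: all_momentsX; exact: std_all_moments.
  move=> om; rewrite E (_ : 4%N = (2 * 2)%N)// exprM.
  have J n : (\sum_i s i * dot (u i) (X om) ^+ n) ^+ 2 <=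
      frob2 M * \sum_i s i * dot (u i) (X om) ^+ (n * 2).
    rewrite -sM; apply: le_trans (jensen_sqr _ s0) _.
    by under [X in _ * X <= _]eq_bigr do rewrite -exprM.
  have /= J1 := J 2; have J2 := J 4.
  apply: (@le_trans _ _ ((frob2 M * \sum_i s i * dot (u i) (X om) ^+ 4) ^+ 2)).
    by rewrite lerXn2r ?nnegrE ?sqr_ge0// (le_trans (sqr_ge0 _) J1).
  by rewrite exprMn [_ ^+ 3]exprSr -mulrA ler_wpM2l ?sqr_ge0.
rewrite evZ; last first.
  apply: all_moments_sum => i _; apply: all_momentsZ.
  by apply: all_momentsX; exact: std_all_moments.
rewrite ev_sum; last first.
  by move=> i; apply: all_momentsZ; apply: all_momentsX; exact: std_all_moments.
have -> : 105 * frob2 M ^+ 4 = frob2 M ^+ 3 * \sum_i s i * 105.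
  by rewrite -mulr_suml sM; ring.
rewrite ler_wpM2l ?exprn_ge0 ?frob2_ge0//; apply: ler_sum => i _.
rewrite evZ ?std_ev8; last by apply: all_momentsX; exact: std_all_moments.
rewrite ler_wpM2l// -[leRHS]mulr1 ler_wpM2l//.
by rewrite exprn_ile1 ?dot_ge0.
Qed.

Lemma std_norm4 (M : 'M[R]_d) :
  ev (fun om => dot (M *m X om) (M *m X om) ^+ 2) <= 3 * frob2 M ^+ 2.
Proof.
have [s [u [s0 sM u1 E]]] := row_split M.
apply: (@le_trans _ _ (ev (fun om =>
    frob2 M * \sum_i s i * dot (u i) (X om) ^+ 4))).
  apply: ler_ev.
  - by apply: all_momentsX; exact: std_dot_all_moments.
  - apply: all_momentsZ; apply: all_moments_sum => i _; apply: all_momentsZ.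
    by apply: all_momentsX; exact: std_all_moments.
  move=> om; rewrite E.
  have J1 := jensen_sqr (fun i => dot (u i) (X om) ^+ 2) s0.
  rewrite sM in J1; apply: le_trans J1 _.
  by under [in X in X <= _]eq_bigr do rewrite -exprM.
rewrite evZ; last first.
  apply: all_moments_sum => i _; apply: all_momentsZ.
  by apply: all_momentsX; exact: std_all_moments.
rewrite ev_sum; last first.
  by move=> i; apply: all_momentsZ; apply: all_momentsX; exact: std_all_moments.
have -> : 3 * frob2 M ^+ 2 = frob2 M * \sum_i s i * 3.
  by rewrite -mulr_suml sM; ring.
rewrite ler_wpM2l ?frob2_ge0//; apply: ler_sum => i _.
rewrite evZ ?std_ev4; last by apply: all_momentsX; exact: std_all_moments.
rewrite ler_wpM2l// -[leRHS]mulr1 ler_wpM2l//.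
by rewrite exprn_ile1 ?dot_ge0.
Qed.

Lemma frob2_1 : frob2 (1%:M : 'M[R]_d) = d%:R.
Proof.
rewrite /frob2 -[d in RHS]card_ord -sum1_card natr_sum; apply: eq_bigr => i _.
rewrite (bigD1 i)//= big1 ?addr0 => [|j /negbTE ji]; rewrite mxE.
  by rewrite eqxx expr1n.
by rewrite eq_sym ji expr0n.
Qed.

Lemma std_dotX_all_moments : all_moments P (fun om => dot (X om) (X om)).
Proof.
by have := std_dot_all_moments 1%:M; under eq_fun do rewrite mul1mx.
Qed.

Lemma std_norm8_1 : ev (fun om => dot (X om) (X om) ^+ 4) <= 105 * d%:R ^+ 4.
Proof.
by have := std_norm8 1%:M; under eq_ev do rewrite mul1mx; rewrite frob2_1.
Qed.

Lemma std_norm4_1 : ev (fun om => dot (X om) (X om) ^+ 2) <= 3 * d%:R ^+ 2.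
Proof.
by have := std_norm4 1%:M; under eq_ev do rewrite mul1mx; rewrite frob2_1.
Qed.

Lemma std_qform_all_moments (M : 'M[R]_d) : all_moments P (fun om => qform M (X om)).
Proof.
under eq_fun do rewrite qformE dotE.
apply: all_moments_sum => i _; apply: all_momentsM; first exact: std_coord_all_moments.
by under eq_fun do rewrite mulmx_row_dot; exact: std_all_moments.
Qed.

(** Cauchy-Schwarz separates [|X|] from [|M X|]. The factor [d^2] arises from the moments of [|X|]
    and ends up in the rate of the lower tail. *)
Lemma std_qform4 (M : 'M[R]_d) :
  ev (fun om => qform M (X om) ^+ 4) <= 105 * d%:R ^+ 2 * frob2 M ^+ 2.
Proof.
have MX := std_qform_all_moments M.
have [M0|F0] := eqVneq (frob2 M) 0.
  rewrite (frob2_eq0 M0); under eq_ev do rewrite qformE mul0mx dotC /dot trmx0 mul0mx mxE expr0n.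
  by rewrite ev_cst mulr_ge0 ?sqr_ge0// mulr_ge0 ?sqr_ge0.
have F1 : 0 < frob2 M by rewrite lt_def F0 frob2_ge0.
have d1 : 0 < d%:R :> R.
  rewrite ltr0n lt0n; apply: contraNneq F0 => d0; rewrite /frob2 big1// => i _.
  by have := ltn_ord i; rewrite [X in (_ < X)%N]d0.
(* With this weight the two terms of the arithmetic-geometric inequality have the same bound. *)
pose e := d%:R / frob2 M.
have e0 : 0 < e by rewrite divr_gt0.
have A1 : all_moments P (fun om => dot (X om) (X om) ^+ 4).
  by apply: all_momentsX; exact: std_dotX_all_moments.
have A2 : all_moments P (fun om => dot (M *m X om) (M *m X om) ^+ 4).
  by apply: all_momentsX; exact: std_dot_all_moments.
apply: (@le_trans _ _ (ev (fun om => 2^-1 * (e ^- 2 * dot (X om) (X om) ^+ 4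
    + e ^+ 2 * dot (M *m X om) (M *m X om) ^+ 4)))).
  apply: ler_ev; [exact: all_momentsX| |].
    by apply: all_momentsZ; apply: all_momentsD; exact: all_momentsZ.
  move=> om; rewrite qformE.
  have := dot_cs (X om) (M *m X om).
  set a := dot _ _; set b := dot _ _; set g := dot _ _ => ab.
  have b0 : 0 <= b by exact: dot_ge0.
  have g0 : 0 <= g by exact: dot_ge0.
  have : (a ^+ 2) ^+ 2 <= (b * g) ^+ 2.
    by rewrite lerXn2r ?nnegrE ?sqr_ge0// mulr_ge0.
  rewrite -exprM => /le_trans; apply.
  have := sqr_ge0 (e^-1 * b ^+ 2 - e * g ^+ 2).
  have -> : (e^-1 * b ^+ 2 - e * g ^+ 2) ^+ 2 =
      e ^- 2 * b ^+ 4 + e ^+ 2 * g ^+ 4 - 2 * (b * g) ^+ 2.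
    by field; rewrite gt_eqF.
  by lra.
rewrite evZ; last by apply: all_momentsD; exact: all_momentsZ.
rewrite evD; do ?[exact: all_momentsZ]; rewrite !evZ//.
have H1 : e ^- 2 * ev (fun om => dot (X om) (X om) ^+ 4) <=
    e ^- 2 * (105 * d%:R ^+ 4).
  by rewrite ler_wpM2l ?std_norm8_1// invr_ge0 exprn_ge0// ltW.
have H2 : e ^+ 2 * ev (fun om => dot (M *m X om) (M *m X om) ^+ 4) <=
    e ^+ 2 * (105 * frob2 M ^+ 4).
  by rewrite ler_wpM2l ?std_norm8// exprn_ge0// ltW.
have E1 : e ^- 2 * (105 * d%:R ^+ 4) = 105 * d%:R ^+ 2 * frob2 M ^+ 2.
  by rewrite /e; field; rewrite !gt_eqF.
have E2 : e ^+ 2 * (105 * frob2 M ^+ 4) = 105 * d%:R ^+ 2 * frob2 M ^+ 2.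
  by rewrite /e; field; rewrite !gt_eqF.
by rewrite E1 in H1; rewrite E2 in H2; lra.
Qed.

(** Isserlis gives [(tr M)^2 + 2 |M|^2] for symmetric [M]. An antisymmetric part would be invisible
    to the form, which is why the fit of [Sinf] ranges over symmetric matrices. *)
Lemma std_qform2 (M : 'M[R]_d) : Defs.symmetric M ->
  frob2 M <= ev (fun om => qform M (X om) ^+ 2).
Proof.
move=> Msym.
have qE om : qform M (X om) ^+ 2 = \sum_i \sum_j \sum_k \sum_l
    M i j * M k l * (dot (delta_mx i 0) (X om) * dot (delta_mx j 0) (X om) *
      dot (delta_mx k 0) (X om) * dot (delta_mx l 0) (X om)).
  have -> : qform M (X om) = \sum_i \sum_j M i j * (X om i 0 * X om j 0).
    rewrite qformE dotE; apply: eq_bigr => i _; rewrite mxE mulr_sumr.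
    by apply: eq_bigr => j _; ring.
  rewrite expr2 mulr_suml; apply: eq_bigr => i _.
  rewrite mulr_suml; apply: eq_bigr => j _.
  rewrite mulr_sumr; apply: eq_bigr => k _.
  rewrite mulr_sumr; apply: eq_bigr => l _.
  by rewrite !dot_delta; ring.
under eq_ev do rewrite qE.
have Mm i j k l : all_moments P (fun om =>
    M i j * M k l * (dot (delta_mx i 0) (X om) * dot (delta_mx j 0) (X om) *
      dot (delta_mx k 0) (X om) * dot (delta_mx l 0) (X om))).
  by apply: all_momentsZ; do 3?apply: all_momentsM; exact: std_all_moments.
have dd (i j : 'I_d) : dot (delta_mx i 0) (1%:M *m delta_mx j 0) = (i == j)%:R :> R.
  by rewrite mul1mx dot_delta mxE eqxx andbT.
have -> : ev (fun om => \sum_i \sum_j \sum_k \sum_l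
    M i j * M k l * (dot (delta_mx i 0) (X om) * dot (delta_mx j 0) (X om) *
      dot (delta_mx k 0) (X om) * dot (delta_mx l 0) (X om))) =
    \sum_i \sum_j \sum_k \sum_l M i j * M k l *
     ((i == j)%:R * (k == l)%:R + (i == k)%:R * (j == l)%:R + (i == l)%:R * (j == k)%:R).
  rewrite ev_sum; last by move=> i; do 3!(apply: all_moments_sum => ? _).
  apply: eq_bigr => i _.
  rewrite ev_sum; last by move=> j; do 2!(apply: all_moments_sum => ? _).
  apply: eq_bigr => j _.
  rewrite ev_sum; last by move=> k; apply: all_moments_sum => ? _.
  apply: eq_bigr => k _.
  rewrite ev_sum//; apply: eq_bigr => l _.
  rewrite evZ; last by do 3?apply: all_momentsM; exact: std_all_moments.
  by rewrite (vec_gaussian_isserlis psd1 gX) !dd.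
have pick (F : 'I_d -> R) i : \sum_j F j * (i == j)%:R = F i.
  rewrite (bigD1 i)//= big1 ?addr0 ?eqxx ?mulr1// => j /negbTE ji.
  by rewrite eq_sym ji mulr0.
have inner i j : \sum_k \sum_l M i j * M k l *
     ((i == j)%:R * (k == l)%:R + (i == k)%:R * (j == l)%:R + (i == l)%:R * (j == k)%:R)
   = M i j * (i == j)%:R * \sum_k M k k + M i j ^+ 2 + M i j * M j i.
  under eq_bigr => k _.
    have -> : \sum_l M i j * M k l * ((i == j)%:R * (k == l)%:R +
        (i == k)%:R * (j == l)%:R + (i == l)%:R * (j == k)%:R) =
      \sum_l (M i j * M k l * (i == j)%:R) * (k == l)%:R +
      \sum_l (M i j * M k l * (i == k)%:R) * (j == l)%:R +
      \sum_l (M i j * M k l * (j == k)%:R) * (i == l)%:R.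
      by rewrite -!big_split; apply: eq_bigr => l _ /=; ring.
    rewrite !pick; over.
  rewrite !big_split /= !pick mulr_sumr; congr (_ + _ + _).
  by apply: eq_bigr => k _; ring.
under eq_bigr => i _ do under eq_bigr => j _ do rewrite inner.
have sym i j : M j i = M i j by rewrite -[in LHS]Msym mxE.
have -> : \sum_i \sum_j (M i j * (i == j)%:R * \sum_k M k k + M i j ^+ 2 + M i j * M j i)
   = (\sum_k M k k) ^+ 2 + 2 * frob2 M.
  rewrite /frob2 mulr_sumr expr2 [in RHS]mulr_suml -big_split /=.
  apply: eq_bigr => i _; rewrite !big_split /= -mulr_suml pick -addrA.
  congr (_ + _); rewrite mulr_sumr -big_split /=; apply: eq_bigr => j _.
  by rewrite sym; ring.
by have := frob2_ge0 M; have := sqr_ge0 (\sum_k M k k); lra.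
Qed.

End standard.
End vec_gaussian_moments.

(** * The pi-systems generated by the primitives *)

Section event_systems.
Context {R : realType} {dO : measure_display} {O : measurableType dO} {n : nat}.

Lemma vec_events_measurable (X : O -> 'cV[R]_n) :
  (forall j, measurable_fun setT (fun om => X om j 0)) ->
  vec_events X `<=` measurable.
Proof.
move=> mX _ [B mB <-]; apply: fin_bigcap_measurable => [|j _].
  exact: finite_finset.
by rewrite -[_ @^-1` _]setTI; apply: mX => //; exact: mB.
Qed.

Lemma vec_events_setI (X : O -> 'cV[R]_n) : setI_closed (vec_events X).
Proof.
move=> _ _ [B mB <-] [C mC <-]; exists (fun j => B j `&` C j).
  by move=> j; exact: measurableI.
by rewrite -bigcapI.
Qed.

Lemma vec_events_coord (X : O -> 'cV[R]_n) j (B : set R) : measurable B ->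
  vec_events X ((fun om => X om j 0) @^-1` B).
Proof.
move=> mB; exists (fun k => if k == j then B else setT).
  by move=> k; case: ifP.
apply/seteqP; split=> [om /(_ j)|om Bom k _ /=]; first by rewrite eqxx; exact.
by case: eqP => [->|].
Qed.

Lemma vec_events_setT (X : O -> 'cV[R]_n) : vec_events X setT.
Proof. by exists (fun=> setT) => //; apply: bigcapT. Qed.

Lemma real_events_measurable (X : O -> R) : measurable_fun setT X ->
  real_events X `<=` measurable.
Proof.
by move=> mX _ [B mB <-]; rewrite -[_ @^-1` _]setTI; exact: mX.
Qed.

Lemma real_events_setI (X : O -> R) : setI_closed (real_events X).
Proof.
by move=> _ _ [B mB <-] [C mC <-]; exists (B `&` C) => //; exact: measurableI.
Qed.

Lemma real_events_setT (X : O -> R) : real_events X setT.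
Proof. by exists setT; [exact: measurableT|rewrite preimage_setT]. Qed.

End event_systems.

(** * Auxiliary facts on measurability, outer products and sums *)

Lemma measurable_dot {R : realType} {d'} {T' : measurableType d'} n
    (f g : T' -> 'cV[R]_n) :
  (forall j, measurable_fun setT (fun z => f z j 0)) ->
  (forall j, measurable_fun setT (fun z => g z j 0)) ->
  measurable_fun setT (fun z => dot (f z) (g z)).
Proof.
move=> mf mg; under eq_fun do rewrite dotE.
by apply: measurable_sum => j; apply: measurable_funM; [exact: mf|exact: mg].
Qed.

Lemma measurable_mulmx {R : realType} {d'} {T' : measurableType d'} m n
    (M : 'M[R]_(m, n)) (f : T' -> 'cV[R]_n) :
  (forall j, measurable_fun setT (fun z => f z j 0)) ->
  forall i, measurable_fun setT (fun z => (M *m f z) i 0).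
Proof.
move=> mf i; under eq_fun do rewrite mxE.
by apply: measurable_sum => j; apply: measurable_funM.
Qed.

(** In this Gram form the matrix noise is a double sum of scalars, which can be averaged term by
    term. *)
Lemma frob2_sum_outer (R : realType) (n : nat) (I : finType) (c : I -> R)
    (u v : I -> 'cV[R]_n) :
  frob2 (\sum_i c i *: (u i *m (v i)^T)) =
  \sum_i \sum_j c i * c j * (dot (u i) (u j) * dot (v i) (v j)).
Proof.
have E k l : (\sum_i c i *: (u i *m (v i)^T)) k l = \sum_i c i * (u i k 0 * v i l 0).
  rewrite summxE; apply: eq_bigr => i _; rewrite !mxE big_ord1 mxE; ring.
rewrite /frob2; under eq_bigr => k _ do under eq_bigr => l _ do rewrite E.
have -> : \sum_(k < n) \sum_(l < n) (\sum_i c i * (u i k 0 * v i l 0)) ^+ 2 =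
   \sum_(k < n) \sum_(l < n) \sum_i \sum_j
     (c i * c j * ((u i k 0 * u j k 0) * (v i l 0 * v j l 0))).
  apply: eq_bigr => k _; apply: eq_bigr => l _.
  rewrite expr2 mulr_suml; apply: eq_bigr => i _.
  by rewrite mulr_sumr; apply: eq_bigr => j _; ring.
under eq_bigr => k _ do rewrite exchange_big.
rewrite exchange_big; apply: eq_bigr => i _ /=.
under eq_bigr => k _ do rewrite exchange_big.
rewrite exchange_big; apply: eq_bigr => j _ /=.
rewrite !dotE mulr_suml mulr_sumr; apply: eq_bigr => k _.
by rewrite mulr_sumr mulr_sumr.
Qed.

(** The distance [|t - s|]: with truncated subtraction one of the two differences is zero. *)
Definition gap (t s : nat) : nat := (t - s + (s - t))%N.

(** Every positive gap is attained at most twice, once on each side of [t]. *)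
Lemma sum_gap_le (R : realFieldType) (f : nat -> R) (T t : nat) :
  (forall k, 0 <= f k) -> (t < T)%N ->
  \sum_(s < T) f (gap t s) <= f 0%N + 2 * \sum_(k < T) f k.+1.
Proof.
move=> f0 tT.
have sum_prefix m : (m <= T)%N -> \sum_(k < m) f k.+1 <= \sum_(k < T) f k.+1.
  move=> mT; rewrite -!(big_mkord xpredT (fun k => f k.+1)).
  by rewrite (big_cat_nat _ mT)//= lerDl sumr_ge0.
rewrite -(big_mkord xpredT (fun s => f (gap t s))).
rewrite (big_cat_nat _ (ltnW tT))//= [X in _ + X]big_ltn//=.
have -> : \sum_(0 <= s < t) f (gap t s) = \sum_(k < t) f k.+1.
  rewrite big_nat_rev /= big_mkord; apply: eq_bigr => s _; congr f.
  by rewrite /gap; have := ltn_ord s; lia.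
have -> : \sum_(t.+1 <= s < T) f (gap t s) = \sum_(k < T - t.+1) f k.+1.
  rewrite -{1}[t.+1]add0n big_addn big_mkord; apply: eq_bigr => s _; congr f.
  by rewrite /gap; lia.
have -> : gap t t = 0%N by rewrite /gap; lia.
have := sum_prefix t (ltnW tT); have := sum_prefix (T - t.+1)%N (leq_subr _ _).
lra.
Qed.

Lemma geometric_sum_le (R : realFieldType) (r : R) n : 0 <= r -> r < 1 ->
  \sum_(k < n) r ^+ k <= (1 - r)^-1.
Proof.
move=> r0 r1; have p : 0 < 1 - r by rewrite subr_gt0.
rewrite -[leRHS]mul1r ler_pdivlMr// mulrC -opprB mulNr -subrX1 opprB gerBl.
exact: exprn_ge0.
Qed.

(** It follows from [expR y >= 1 + y] and [(1 - y + y^2) (1 + y) = 1 + y^3 >= 1]. *)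
Lemma expRN_le (R : realType) (y : R) : 0 <= y -> expR (- y) <= 1 - y + y ^+ 2.
Proof.
move=> y0; have e0 := expR_gt0 y; rewrite expRN -[leLHS]mul1r ler_pdivrMr//.
apply: (@le_trans _ _ ((1 - y + y ^+ 2) * (1 + y))).
  have : 0 <= y ^+ 3 by rewrite exprn_ge0.
  by nra.
rewrite ler_wpM2l ?expR_ge1Dx//.
by nra.
Qed.

Lemma sum_even_le (R : numDomainType) (f : nat -> R) n T :
  (n.*2 <= T)%N -> (forall t, 0 <= f t) ->
  \sum_(k < n) f k.*2 <= \sum_(t < T) f t.
Proof.
move=> nT f0; apply: (@le_trans _ _ (\sum_(t < n.*2) f t)).
  elim: n {nT} => [|n IH]; first by rewrite !big_ord0.
  rewrite doubleS !big_ord_recr /= -addrA lerD//.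
  by rewrite lerDl.
rewrite -!(big_mkord xpredT f) (big_cat_nat _ nT)//= lerDl sumr_ge0//.
Qed.

(** * The state-space model: covariances conditionally on the design *)

Section model.
Context {R : realType} {dO : measure_display} {O : measurableType dO}.
Variables (d T : nat) (A Sw Sinf : 'M[R]_d) (sig : R).
Variable P : probability O R.
Variables (beta x w : nat -> O -> 'cV[R]_d) (eps : nat -> O -> R).
Hypotheses (Sw_psd : psd Sw) (Sinf_psd : psd Sinf).
Hypothesis SinfE : Sinf = A *m Sinf *m A^T + Sw.
Hypothesis betaS : forall t, (t <= T)%N ->
  forall om, beta t.+1 om = A *m beta t om + w t om.
Hypothesis x_gauss : forall t, (t <= T)%N -> vec_gaussian P (x t) 1%:M.
Hypothesis w_gauss : forall t, (t <= T)%N -> vec_gaussian P (w t) Sw.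
Hypothesis eps_gauss : forall t, (t <= T)%N -> real_gaussian P (eps t) 0 (sig ^+ 2).
Hypothesis beta0_gauss : vec_gaussian P (beta 0%N) Sinf.
Let G := @model_events R O d T (beta 0%N) x w eps.
Hypothesis G_indep : mutually_independent P G.
Local Notation ev := (ev P).
Local Notation all_moments := (all_moments P).

Definition ix t : model_index T := Some (inl (inl (inord t))).
Definition iw t : model_index T := Some (inl (inr (inord t))).
Definition ie t : model_index T := Some (inr (inord t)).

Lemma model_events_measurable i : G i `<=` measurable.
Proof.
case: i => [[[t|t]|t]|] /=.
- by apply: vec_events_measurable; case: (x_gauss (leq_ord t)).
- by apply: vec_events_measurable; case: (w_gauss (leq_ord t)).
- by apply: real_events_measurable; case: (eps_gauss (leq_ord t)).
- by apply: vec_events_measurable; case: beta0_gauss.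
Qed.

Lemma model_events_setI i : setI_closed (G i).
Proof.
by case: i => [[[t|t]|t]|] /=;
  [exact: vec_events_setI|exact: vec_events_setI|exact: real_events_setI
  |exact: vec_events_setI].
Qed.

Lemma model_events_setT i : G i setT.
Proof.
by case: i => [[[t|t]|t]|] /=;
  [exact: vec_events_setT|exact: vec_events_setT|exact: real_events_setT
  |exact: vec_events_setT].
Qed.

Local Notation Gm := model_events_measurable.
Local Notation GI := model_events_setI.
Local Notation GT := model_events_setT.
Local Notation measurable_on := (measurable_on G).

Lemma x_measurable_on (J : pred (model_index T)) t j : (t <= T)%N -> J (ix t) ->
  measurable_on J (fun om => x t om j 0).
Proof.
move=> tT Jt; apply: (measurable_on_event GT Jt) => B mB.
by rewrite /G /= inordK//; exact: vec_events_coord.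
Qed.

Lemma w_measurable_on (J : pred (model_index T)) t j : (t <= T)%N -> J (iw t) ->
  measurable_on J (fun om => w t om j 0).
Proof.
move=> tT Jt; apply: (measurable_on_event GT Jt) => B mB.
by rewrite /G /= inordK//; exact: vec_events_coord.
Qed.

Lemma eps_measurable_on (J : pred (model_index T)) t : (t <= T)%N -> J (ie t) ->
  measurable_on J (eps t).
Proof.
move=> tT Jt; apply: (measurable_on_event GT Jt) => B mB.
by rewrite /G /= inordK//; exists B.
Qed.

Lemma beta0_measurable_on (J : pred (model_index T)) j : J None ->
  measurable_on J (fun om => beta 0%N om j 0).
Proof.
by move=> J0; apply: (measurable_on_event GT J0) => B mB; exact: vec_events_coord.
Qed.

(** The primitives that determine the state at time [t]: the initial state and the earlier
    innovations. *)
Definition before t : pred (model_index T) := fun i =>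
  match i with
  | None => true
  | Some (inl (inl _)) => false
  | Some (inl (inr s)) => (s < t)%N
  | Some (inr _) => false
  end.

Lemma beta_measurable_on (J : pred (model_index T)) t j : (t <= T.+1)%N ->
  (forall i, before t i -> J i) ->
  measurable_on J (fun om => beta t om j 0).
Proof.
elim: t J j => [|t IH] J j tT HJ.
  by apply: beta0_measurable_on; exact: HJ.
rewrite /measurable_on; under eq_fun do rewrite betaS// mxE.
apply: measurable_funD; last first.
  by apply: w_measurable_on => //; apply: HJ; rewrite /= inordK.
under eq_fun do rewrite mxE.
apply: measurable_sum => k; apply: measurable_funM => //.
apply: IH => [|i Hi]; first exact: ltnW.
by apply: HJ; move: i Hi => [[[s|s]|s]|] //= /ltnW.
Qed.

(** Separating these primitives from the covariates is what turns conditioning on the design into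
    decoupling. *)
Definition dynamic : pred (model_index T) := fun i =>
  match i with Some (inl (inl _)) => false | _ => true end.

Definition design : pred (model_index T) := fun i => ~~ dynamic i.

(** Indexing the summands by the primitives presents every linear form as a sum of independent
    terms, as [gaussian4_sum] requires. The covariates contribute 0, since they act only as frozen
    coefficients. *)
Definition linear_part (u : 'cV[R]_d) (v : nat -> 'cV[R]_d) (c : nat -> R)
    (i : model_index T) (om : O) : R :=
  match i with
  | None => dot u (beta 0%N om)
  | Some (inl (inl _)) => 0
  | Some (inl (inr t)) => dot (v t) (w t om)
  | Some (inr t) => c t * eps t om
  end.

Definition linear_form (f : O -> R) : Prop := exists u v c,
  f = (fun om => \sum_i linear_part u v c i om).

Lemma linear_formD f g : linear_form f -> linear_form g ->
  linear_form (fun om => f om + g om).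
Proof.
move=> [u [v [c ->]]] [u' [v' [c' ->]]].
exists (u + u'), (fun t => v t + v' t), (fun t => c t + c' t).
apply/funext => om; rewrite -big_split; apply: eq_bigr => i _.
by case: i => [[[t|t]|t]|] /=; rewrite ?addr0 ?dotDl ?mulrDl.
Qed.

Lemma linear_formZ a f : linear_form f -> linear_form (fun om => a * f om).
Proof.
move=> [u [v [c ->]]]; exists (a *: u), (fun t => a *: v t), (fun t => a * c t).
apply/funext => om; rewrite mulr_sumr; apply: eq_bigr => i _.
by case: i => [[[t|t]|t]|] /=; rewrite ?mulr0 ?dotZl ?mulrA.
Qed.

Lemma dot0l (v : 'cV[R]_d) : dot 0 v = 0.
Proof. by rewrite dotE big1// => i _; rewrite mxE mul0r. Qed.

Lemma linear_form_eps t : (t <= T)%N -> linear_form (eps t).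
Proof.
move=> tT; exists 0, (fun=> 0), (fun s => (s == t)%:R); apply/funext => om.
rewrite (bigD1 (ie t))//= inordK// eqxx mul1r big1 ?addr0//.
move=> [[[s|s]|s]|] //= st; rewrite ?dot0l//.
have -> : (s == t :> nat) = false; last by rewrite mul0r.
apply: contraNF st => /eqP st; apply/eqP; congr (Some (inr _)).
by apply: val_inj; rewrite /= inordK.
Qed.

Lemma linear_form_w t u : (t <= T)%N -> linear_form (fun om => dot u (w t om)).
Proof.
move=> tT; exists 0, (fun s => if s == t then u else 0), (fun=> 0).
apply/funext => om.
rewrite (bigD1 (iw t))//= inordK// eqxx big1 ?addr0//.
move=> [[[s|s]|s]|] //= st; rewrite ?dot0l ?mul0r//.
have -> : (s == t :> nat) = false; last by rewrite dot0l.
apply: contraNF st => /eqP st; apply/eqP; congr (Some (inl (inr _))).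
by apply: val_inj; rewrite /= inordK.
Qed.

Lemma linear_form_beta t u : (t <= T.+1)%N -> linear_form (fun om => dot u (beta t om)).
Proof.
elim: t u => [|t IH] u tT.
  exists u, (fun=> 0), (fun=> 0); apply/funext => om.
  rewrite (bigD1 None)//= big1 ?addr0//.
  by move=> [[[s|s]|s]|] //=; rewrite ?dot0l ?mul0r.
have -> : (fun om => dot u (beta t.+1 om)) =
    (fun om => dot (A^T *m u) (beta t om) + dot u (w t om)).
  by apply/funext => om; rewrite betaS// dotDr -dot_mulmxr.
by apply: linear_formD; [exact: IH (ltnW tT)|exact: linear_form_w].
Qed.

Lemma linear_part_gaussian4 u v c i :
  gaussian4 P G (pred1 i) (linear_part u v c i).
Proof.
case: i => [[[t|t]|t]|] /=.
- exact: gaussian4_cst0.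
- have gw := w_gauss (leq_ord t); split.
  + apply: measurable_dot => j; first exact: measurable_cst.
    apply: (w_measurable_on _ (leq_ord t)).
    by apply/eqP; congr (Some (inl (inr _))); apply: val_inj; rewrite /= inordK.
  + exact: vec_gaussian_all_moments Sw_psd gw _.
  + exact: vec_gaussian_mean Sw_psd gw _.
  + by rewrite (vec_gaussian_ev4 Sw_psd gw) (vec_gaussian_ev2 Sw_psd gw).
- have ge := eps_gauss (leq_ord t); have s2 := sqr_ge0 sig.
  have Me := real_gaussian_all_moments s2 ge; split.
  + apply: measurable_funM; first exact: measurable_cst.
    apply: (eps_measurable_on (leq_ord t)).
    by apply/eqP; congr (Some (inr _)); apply: val_inj; rewrite /= inordK.
  + exact: all_momentsZ.
  + by rewrite evZ// (real_gaussian_mean s2 ge) mulr0.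
  + under eq_ev do rewrite exprMn; under [in RHS]eq_ev do rewrite exprMn.
    rewrite !evZ; do ?[exact: all_momentsX].
    by rewrite (real_gaussian_ev4 s2 ge) (real_gaussian_ev2 s2 ge); ring.
- split.
  + apply: measurable_dot => j; first exact: measurable_cst.
    exact: beta0_measurable_on.
  + exact: vec_gaussian_all_moments Sinf_psd beta0_gauss _.
  + exact: vec_gaussian_mean Sinf_psd beta0_gauss _.
  + by rewrite (vec_gaussian_ev4 Sinf_psd beta0_gauss)
       (vec_gaussian_ev2 Sinf_psd beta0_gauss).
Qed.

Lemma linear_form_gaussian4 f : linear_form f -> gaussian4 P G predT f.
Proof.
move=> [u [v [c ->]]]; apply: (gaussian4_sum Gm GI GT G_indep) => i.
exact: linear_part_gaussian4.
Qed.

Lemma linear_form_all_moments f : linear_form f -> all_moments f.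
Proof. by move=> /linear_form_gaussian4[]. Qed.

Lemma linear_form_isserlis f g h k :
  linear_form f -> linear_form g -> linear_form h -> linear_form k ->
  ev (fun om => f om * g om * h om * k om) =
  ev (fun om => f om * g om) * ev (fun om => h om * k om) +
  ev (fun om => f om * h om) * ev (fun om => g om * k om) +
  ev (fun om => f om * k om) * ev (fun om => g om * h om).
Proof.
apply: isserlis.
- exact: linear_form_all_moments.
- exact: linear_formD.
- exact: linear_formZ.
- by move=> F /linear_form_gaussian4[].
Qed.


Lemma w_beta_uncorrelated s t u v : (s <= t)%N -> (t <= T)%N ->
  ev (fun om => dot u (w t om) * dot v (beta s om)) = 0.
Proof.
move=> st tT; have gw := w_gauss tT.
rewrite (@indep_evM _ _ _ P _ G Gm GI GT G_indep (pred1 (iw t)) (before s)).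
- by rewrite (vec_gaussian_mean Sw_psd gw) mul0r.
- by move=> i /eqP ->; rewrite /= inordK// -leqNgt.
- apply: measurable_dot => j; first exact: measurable_cst.
  by apply: w_measurable_on => //; exact: eqxx.
- apply: measurable_dot => j; first exact: measurable_cst.
  by apply: beta_measurable_on => //; exact: leq_trans st (leqW _).
- exact: vec_gaussian_all_moments Sw_psd gw _.
- by apply: linear_form_all_moments; apply: linear_form_beta; exact: leq_trans st (leqW _).
Qed.

Lemma eps_beta_uncorrelated s t v : (s <= T)%N -> (t <= T)%N ->
  ev (fun om => eps t om * dot v (beta s om)) = 0.
Proof.
move=> sT tT; have ge := eps_gauss tT; have s2 := sqr_ge0 sig.
rewrite (@indep_evM _ _ _ P _ G Gm GI GT G_indep (pred1 (ie t)) (before s)).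
- by rewrite (real_gaussian_mean s2 ge) mul0r.
- by move=> i /eqP ->.
- by apply: eps_measurable_on => //; exact: eqxx.
- apply: measurable_dot => j; first exact: measurable_cst.
  by apply: beta_measurable_on => //; exact: leqW.
- exact: real_gaussian_all_moments s2 ge.
- by apply: linear_form_all_moments; apply: linear_form_beta; exact: leqW.
Qed.

Lemma eps_cov s t : (s <= T)%N -> (t <= T)%N ->
  ev (fun om => eps t om * eps s om) = sig ^+ 2 *+ (t == s).
Proof.
move=> sT tT; have ge := eps_gauss tT; have s2 := sqr_ge0 sig.
have [<-|ts] := eqVneq t s; first exact: real_gaussian_ev2 s2 ge.
rewrite (@indep_evM _ _ _ P _ G Gm GI GT G_indep (pred1 (ie t)) (pred1 (ie s))).
- by rewrite (real_gaussian_mean s2 ge) mul0r.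
- move=> i /eqP ->; apply: contra ts => /eqP[/(congr1 (@nat_of_ord _))].
  by rewrite !inordK// => ->.
- by apply: eps_measurable_on => //; exact: eqxx.
- by apply: eps_measurable_on => //; exact: eqxx.
- exact: real_gaussian_all_moments s2 ge.
- exact: real_gaussian_all_moments s2 (eps_gauss sT).
Qed.

(** The Lyapunov equation [SinfE] keeps the covariance at [Sinf] from one time to the next, and each
    unit of lag multiplies by [A] because the new innovation is uncorrelated with the past. *)
Lemma beta_cov s t u v : (s <= t)%N -> (t <= T)%N ->
  ev (fun om => dot u (beta t om) * dot v (beta s om)) =
  dot u (A ^+ (t - s) *m (Sinf *m v)).
Proof.
have Mb k r : (k <= T)%N -> all_moments (fun om => dot r (beta k om)).
  by move=> kT; apply: linear_form_all_moments; apply: linear_form_beta; exact: leqW.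
have Mw k r : (k <= T)%N -> all_moments (fun om => dot r (w k om)).
  by move=> kT; exact: vec_gaussian_all_moments Sw_psd (w_gauss kT) r.
elim: t s u v => [|t IH] s u v st tT.
  move: st; rewrite leqn0 => /eqP ->; rewrite subnn expr0 mul1mx.
  exact: vec_gaussian_cov Sinf_psd beta0_gauss u v.
have bE r om : dot r (beta t.+1 om) = dot (A^T *m r) (beta t om) + dot r (w t om).
  by rewrite betaS ?(ltnW tT)// dotDr -dot_mulmxr.
have tT' := ltnW tT.
move: st; rewrite leq_eqVlt => /orP[/eqP ->|].
  rewrite subnn expr0 mul1mx.
  have -> : ev (fun om => dot u (beta t.+1 om) * dot v (beta t.+1 om)) =
    ev (fun om => dot (A^T *m u) (beta t om) * dot (A^T *m v) (beta t om)
      + dot v (w t om) * dot (A^T *m u) (beta t om)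
      + dot u (w t om) * dot (A^T *m v) (beta t om)
      + dot u (w t om) * dot v (w t om)).
    by apply: eq_ev => om; rewrite !bE; ring.
  have MM r q : all_moments (fun om => dot r (w t om) * dot q (beta t om)).
    by apply: all_momentsM; [exact: Mw|exact: Mb].
  have MB r q : all_moments (fun om => dot r (beta t om) * dot q (beta t om)).
    by apply: all_momentsM; exact: Mb.
  have MW r q : all_moments (fun om => dot r (w t om) * dot q (w t om)).
    by apply: all_momentsM; exact: Mw.
  rewrite evD; [|by do 2?apply: all_momentsD|exact: MW].
  rewrite evD; [|by apply: all_momentsD|exact: MM].
  rewrite evD// !w_beta_uncorrelated// IH// subnn expr0 mul1mx !addr0.
  rewrite (vec_gaussian_cov Sw_psd (w_gauss tT')) dot_mulmxl trmxK -dotDr.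
  by congr dot; rewrite {2}SinfE mulmxDl !mulmxA.
rewrite ltnS => st.
have -> : ev (fun om => dot u (beta t.+1 om) * dot v (beta s om)) =
  ev (fun om => dot (A^T *m u) (beta t om) * dot v (beta s om)
    + dot u (w t om) * dot v (beta s om)).
  by apply: eq_ev => om; rewrite bE; ring.
have sT := leq_trans st tT'.
rewrite evD; [|by apply: all_momentsM; exact: Mb|by apply: all_momentsM; [exact: Mw|exact: Mb]].
rewrite w_beta_uncorrelated// addr0 IH// dot_mulmxl trmxK subSn// exprS.
by rewrite -mulmxE !mulmxA.
Qed.

(** [a] is a frozen value of the design: for fixed [a] the observations are linear forms in the
    remaining primitives, so Isserlis' formula applies to them. *)
Definition obs (a : nat -> 'cV[R]_d) t om := dot (a t) (beta t om) + eps t om.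

(** [beta_cov] treats the later time first, so the two vectors exchange roles when [t < s]. *)
Definition autocov (u v : 'cV[R]_d) t s : R :=
  if (s <= t)%N then dot u (A ^+ (t - s) *m (Sinf *m v))
  else dot v (A ^+ (s - t) *m (Sinf *m u)).

Definition obs_cov (a : nat -> 'cV[R]_d) t s : R :=
  autocov (a t) (a s) t s + sig ^+ 2 *+ (t == s).

Lemma linear_form_obs a t : (t <= T)%N -> linear_form (obs a t).
Proof.
move=> tT; apply: linear_formD; last exact: linear_form_eps.
by apply: linear_form_beta; exact: leqW.
Qed.

Lemma ev_obs a t s : (t <= T)%N -> (s <= T)%N ->
  ev (fun om => obs a t om * obs a s om) = obs_cov a t s.
Proof.
wlog st : t s / (s <= t)%N => [H tT sT|tT sT].
  have [/H|/ltnW ts] := leqP s t; first exact.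
  rewrite -[LHS](_ : ev (fun om => obs a s om * obs a t om) = _); last first.
    by apply: eq_ev => om; rewrite mulrC.
  rewrite H// /obs_cov eq_sym; congr (_ + _); rewrite /autocov ts.
  case: ifP => // st; have -> : s = t by apply/eqP; rewrite eqn_leq ts st.
  rewrite subnn expr0 !mul1mx.
  by have [Sym _] := Sinf_psd; rewrite dot_mulmxr Sym dotC.
have Mb k r : (k <= T)%N -> all_moments (fun om => dot r (beta k om)).
  by move=> kT; apply: linear_form_all_moments; apply: linear_form_beta; exact: leqW.
have Me k : (k <= T)%N -> all_moments (eps k).
  by move=> kT; exact: real_gaussian_all_moments (sqr_ge0 sig) (eps_gauss kT).
have -> : ev (fun om => obs a t om * obs a s om) =
  ev (fun om => dot (a t) (beta t om) * dot (a s) (beta s om)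
    + eps s om * dot (a t) (beta t om)
    + eps t om * dot (a s) (beta s om) + eps t om * eps s om).
  by apply: eq_ev => om; rewrite /obs; ring.
have Mt := Mb t (a t) tT; have Ms := Mb s (a s) sT.
have Met := Me t tT; have Mes := Me s sT.
rewrite !evD; do ?[by moments].
by rewrite beta_cov// !eps_beta_uncorrelated// eps_cov// !addr0 /obs_cov /autocov st.
Qed.

(** One argument serves both fits: lag [h = 0] for [Sinf] and lag [h = 1] for [A *m Sinf]. *)
Definition centered h a t om : R := obs a (t + h) om * obs a t om - obs_cov a (t + h) t.

Definition noise h a om : 'M[R]_d :=
  \sum_(t < T) centered h a t om *: (a (t + h)%N *m (a t)^T).

Lemma centered_all_moments h a t : (t + h <= T)%N -> all_moments (centered h a t).
Proof.
move=> thT; have tT := leq_trans (leq_addr h t) thT.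
have := linear_form_all_moments (linear_form_obs a thT).
have := linear_form_all_moments (linear_form_obs a tT).
by move=> M1 M2; rewrite /centered; moments.
Qed.

(** Of the three Isserlis pairings, centring cancels the one that stays inside each product. *)
Lemma ev_centered h a t s : (t + h <= T)%N -> (s + h <= T)%N ->
  ev (fun om => centered h a t om * centered h a s om) =
  obs_cov a (t + h) (s + h) * obs_cov a t s + obs_cov a (t + h) s * obs_cov a t (s + h).
Proof.
move=> thT shT.
have tT := leq_trans (leq_addr h t) thT; have sT := leq_trans (leq_addr h s) shT.
have L1 := linear_form_obs a thT; have L2 := linear_form_obs a tT.
have L3 := linear_form_obs a shT; have L4 := linear_form_obs a sT.
have [M1 M2 M3 M4] := And4 (linear_form_all_moments L1) (linear_form_all_moments L2)
  (linear_form_all_moments L3) (linear_form_all_moments L4).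
have -> : ev (fun om => centered h a t om * centered h a s om) =
  ev (fun om => obs a (t + h) om * obs a t om * obs a (s + h) om * obs a s om
   + obs_cov a (t + h) t * obs_cov a (s + h) s
   - (obs_cov a (s + h) s * (obs a (t + h) om * obs a t om)
     + obs_cov a (t + h) t * (obs a (s + h) om * obs a s om))).
  by apply: eq_ev => om; rewrite /centered; ring.
rewrite evB; do ?[by moments].
rewrite evD; do ?[by moments].
rewrite evD; do ?[by moments].
rewrite !evZ; do ?[by moments].
rewrite ev_cst linear_form_isserlis// !ev_obs//.
ring.
Qed.

Lemma frob2_noise h a om : frob2 (noise h a om) =
  \sum_(t < T) \sum_(s < T) centered h a t om * centered h a s om *
    (dot (a (t + h)%N) (a (s + h)%N) * dot (a t) (a s)).
Proof. exact: frob2_sum_outer. Qed.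

Lemma ev_frob2_noise h a : (h <= 1)%N -> ev (fun om => frob2 (noise h a om)) =
  \sum_(t < T) \sum_(s < T)
    (obs_cov a (t + h) (s + h) * obs_cov a t s + obs_cov a (t + h) s * obs_cov a t (s + h))
    * (dot (a (t + h)%N) (a (s + h)%N) * dot (a t) (a s)).
Proof.
move=> h1; under eq_ev do rewrite frob2_noise.
have Mc (t : 'I_T) : all_moments (centered h a t).
  by apply: centered_all_moments; rewrite (leq_trans (leq_add (leqnn _) h1))// addn1.
have M (t s : 'I_T) : all_moments (fun om => centered h a t om * centered h a s om *
    (dot (a (t + h)%N) (a (s + h)%N) * dot (a t) (a s))).
  by have Mt := Mc t; have Ms := Mc s; moments.
rewrite ev_sum; last by move=> t; apply: all_moments_sum => s _.
apply: eq_bigr => t _; rewrite ev_sum//; apply: eq_bigr => s _.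
under eq_ev do rewrite mulrC.
rewrite evZ; last by have Mt := Mc t; have Ms := Mc s; moments.
rewrite ev_centered; first by rewrite mulrC.
- by rewrite (leq_trans (leq_add (leqnn _) h1))// addn1.
- by rewrite (leq_trans (leq_add (leqnn _) h1))// addn1.
Qed.

Lemma frob2_noise_all_moments h a : (h <= 1)%N ->
  all_moments (fun om => frob2 (noise h a om)).
Proof.
move=> h1; under eq_fun do rewrite frob2_noise.
have Mc (t : 'I_T) : all_moments (centered h a t).
  by apply: centered_all_moments; rewrite (leq_trans (leq_add (leqnn _) h1))// addn1.
apply: all_moments_sum => t _; apply: all_moments_sum => s _.
by have Mt := Mc t; have Ms := Mc s; moments.
Qed.

Lemma x_all_moments t u : (t <= T)%N -> all_moments (fun om => dot u (x t om)).
Proof. by move=> tT; exact: std_all_moments (x_gauss tT) u. Qed.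

Lemma x_bilinear_all_moments p q (B : 'M[R]_d) : (p <= T)%N -> (q <= T)%N ->
  all_moments (fun om => dot (x p om) (B *m x q om)).
Proof.
move=> pT qT; under eq_fun do rewrite dotE.
apply: all_moments_sum => i _; apply: all_momentsM.
  exact: std_coord_all_moments (x_gauss pT) i.
by under eq_fun do rewrite mulmx_row_dot; exact: x_all_moments.
Qed.

Lemma x_dot_all_moments p q : (p <= T)%N -> (q <= T)%N ->
  all_moments (fun om => dot (x p om) (x q om)).
Proof.
move=> pT qT; have := x_bilinear_all_moments 1%:M pT qT.
by under eq_fun do rewrite mul1mx.
Qed.

(** Decoupling freezes [x q]; then [x p] is tested against the fixed vector [B *m x q], and the
    one-vector moment applies. *)
Lemma x_bilinear_ev p q (B : 'M[R]_d) k c : (p <= T)%N -> (q <= T)%N -> p != q ->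
  (forall u, ev (fun om => dot u (x p om) ^+ k.*2) = c * dot u u ^+ k) ->
  ev (fun om => dot (x p om) (B *m x q om) ^+ k.*2) =
  c * ev (fun om => dot (B *m x q om) (B *m x q om) ^+ k).
Proof.
move=> pT qT pq H.
have MB : all_moments (fun om => dot (B *m x q om) (B *m x q om) ^+ k).
  by apply: all_momentsX; exact: std_dot_all_moments (x_gauss qT) B.
apply: EFin_inj; rewrite -evZ// -!ev_EFin; last 2 first.
- exact: all_momentsZ.
- by apply: all_momentsX; exact: x_bilinear_all_moments.
pose F (z : sigma_on G (pred1 (ix q)) * sigma_on G (pred1 (ix p))) :=
  (dot (x p z.2) (B *m x q z.1) ^+ k.*2)%:E.
rewrite [LHS](@decouple_on _ _ _ _ _ _ Gm GI GT G_indep _ _ F).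
- apply: eq_integral => om _; rewrite /F /=.
  under eq_integral do rewrite dotC.
  by rewrite ev_EFin ?H//; apply: all_momentsX; exact: x_all_moments.
- move=> i /eqP ->; apply: contra pq => /eqP[/(congr1 (@nat_of_ord _))].
  by rewrite !inordK// => ->.
- apply/measurable_EFinP; apply: measurable_funX; apply: measurable_dot => j.
    have mp : measurable_on (pred1 (ix p)) (fun om => x p om j 0).
      by apply: x_measurable_on => //; exact: eqxx.
    exact: (measurableT_comp mp measurable_snd).
  apply: measurable_mulmx => i.
  have mq : measurable_on (pred1 (ix q)) (fun om => x q om i 0).
    by apply: x_measurable_on => //; exact: eqxx.
  exact: (measurableT_comp mq measurable_fst).
- by move=> z; rewrite lee_fin exprn_even_ge0// odd_double.
Qed.

Lemma x_bilinear4 p q (B : 'M[R]_d) : (p <= T)%N -> (q <= T)%N -> p != q ->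
  ev (fun om => dot (x p om) (B *m x q om) ^+ 4) <= 9 * frob2 B ^+ 2.
Proof.
move=> pT qT pq; rewrite (@x_bilinear_ev p q B 2 3)//; last first.
  by move=> u; exact: std_ev4 (x_gauss pT) u.
rewrite (_ : 9 = 3 * 3)//; last by ring.
by rewrite -mulrA ler_wpM2l//; exact: std_norm4 (x_gauss qT) B.
Qed.

Lemma x_bilinear2 p q (B : 'M[R]_d) : (p <= T)%N -> (q <= T)%N -> p != q ->
  ev (fun om => dot (x p om) (B *m x q om) ^+ 2) = frob2 B.
Proof.
move=> pT qT pq.
have ev2 t u : (t <= T)%N -> ev (fun om => dot u (x t om) ^+ 2) = dot u u.
  by move=> tT; rewrite (vec_gaussian_ev2 (psd1 _) (x_gauss tT)) qformE mul1mx.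
rewrite (@x_bilinear_ev p q B 1 1)//; last by move=> u; rewrite ev2// mul1r.
rewrite mul1r; under eq_ev do rewrite expr1 dot_sqr.
rewrite ev_sum => [|i]; last first.
  apply: all_momentsX; under eq_fun do rewrite mulmx_row_dot.
  exact: x_all_moments.
rewrite frob2_rows; apply: eq_bigr => i _.
by under eq_ev do rewrite mulmx_row_dot; rewrite ev2.
Qed.

(** * Lower tail of the design form at a fixed matrix *)

Hypothesis d_gt0 : (0 < d)%N.

(** At lag 1 consecutive terms share a covariate; even times use disjoint pairs and are therefore
    independent. *)
Definition even_sample h (M : 'M[R]_d) k om : R :=
  dot (x (k.*2 + h)%N om) (M *m x k.*2 om) ^+ 2.

Definition pairs_before n : pred (model_index T) := fun i =>
  match i with Some (inl (inl s)) => (s < n.*2)%N | _ => false end.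

Definition pair_at n : pred (model_index T) := fun i =>
  match i with Some (inl (inl s)) => (n.*2 <= s < n.+1.*2)%N | _ => false end.

Lemma even_sample_measurable_on (J : pred (model_index T)) h M k :
  (h <= 1)%N -> (k.+1.*2 <= T)%N ->
  (forall i, pair_at k i -> J i) -> measurable_on J (even_sample h M k).
Proof.
move=> h1 kT HJ.
have k2 : (k.*2 + h <= T)%N by move: kT; rewrite doubleS; lia.
have k1 : (k.*2 <= T)%N by move: kT; rewrite doubleS; lia.
apply: measurable_funX; apply: measurable_dot => j; last apply: measurable_mulmx => i.
  apply: x_measurable_on => //; apply: HJ; rewrite /= inordK// doubleS; lia.
by apply: x_measurable_on => //; apply: HJ; rewrite /= inordK// doubleS; lia.
Qed.

Lemma even_sample_ge0 h M k om : 0 <= even_sample h M k om.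
Proof. exact: sqr_ge0. Qed.

Lemma laplace_even_samples h M n (r : R) : (h <= 1)%N -> (n.*2 <= T)%N ->
  (\int[P]_om (expR (- r * \sum_(k < n) even_sample h M k om))%:E =
   \prod_(k < n) \int[P]_om (expR (- r * even_sample h M k om))%:E)%E.
Proof.
move=> h1; elim: n => [_|n IH nT].
  under eq_integral do rewrite big_ord0 mulr0 expR0.
  by rewrite big_ord0 integral_cst//= probability_setT mule1.
rewrite big_ord_recr /= -IH; last by move: nT; rewrite doubleS; lia.
under eq_integral do rewrite big_ord_recr /= mulrDr expRD.
apply: (@indep_integralM _ _ _ P _ G Gm GI GT G_indep (pairs_before n) (pair_at n)).
- by move=> [[[s|s]|s]|] //=; rewrite ltnNge => /negbTE ->.
- apply: measurableT_comp => //; apply: measurable_funM => //.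
  apply: measurable_sum => k; apply: even_sample_measurable_on => //.
    by apply: leq_trans nT; rewrite leq_double ltnS ltnW.
  move=> [[[s|s]|s]|] //= /andP[_ /leq_trans]; apply.
  by rewrite leq_double.
- apply: measurableT_comp => //; apply: measurable_funM => //.
  exact: even_sample_measurable_on.
- by move=> om; exact: expR_ge0.
- by move=> om; exact: expR_ge0.
Qed.

Lemma even_sample_all_moments h M k : (h <= 1)%N -> (k.+1.*2 <= T)%N ->
  all_moments (even_sample h M k).
Proof.
move=> h1 kT; apply: all_momentsX; apply: x_bilinear_all_moments.
  by move: kT; rewrite doubleS; lia.
by move: kT; rewrite doubleS; lia.
Qed.

(** At lag 1 the two covariates are independent and the mean is exactly [frob2 M]; at lag 0 the
    bound rests on symmetry. *)
Lemma even_sample_mean h M k : (h <= 1)%N -> (h = 0%N -> Defs.symmetric M) ->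
  (k.+1.*2 <= T)%N -> frob2 M <= ev (even_sample h M k).
Proof.
move=> h1 hM kT; have kT' : (k.*2 <= T)%N by move: kT; rewrite doubleS; lia.
case: h h1 hM => [_ /(_ erefl) Msym|[_ _|//]].
  rewrite /even_sample addn0; under eq_ev do rewrite -qformE.
  exact: std_qform2 (x_gauss kT') M Msym.
rewrite /even_sample x_bilinear2//; first by move: kT; rewrite doubleS; lia.
by rewrite addn1 gtn_eqF.
Qed.

Lemma even_sample_ev2 h M k : (h <= 1)%N -> (k.+1.*2 <= T)%N ->
  ev (fun om => even_sample h M k om ^+ 2) <= 105 * d%:R ^+ 2 * frob2 M ^+ 2.
Proof.
move=> h1 kT; have kT' : (k.*2 <= T)%N by move: kT; rewrite doubleS; lia.
have E h' : ev (fun om => even_sample h' M k om ^+ 2) =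
    ev (fun om => dot (x (k.*2 + h')%N om) (M *m x k.*2 om) ^+ 4).
  by apply: eq_ev => om; rewrite /even_sample -exprM.
rewrite {}E; case: h h1 => [_|[_|//]].
  rewrite addn0; under eq_ev do rewrite -qformE.
  exact: std_qform4 (x_gauss kT') M.
have d1 : 1 <= d%:R :> R by rewrite ler1n.
apply: (@le_trans _ _ (9 * frob2 M ^+ 2)).
  apply: x_bilinear4 => //; first by move: kT; rewrite doubleS; lia.
  by rewrite addn1 gtn_eqF.
rewrite ler_wpM2r ?sqr_ge0//.
have : 1 <= d%:R ^+ 2 :> R by rewrite exprn_ege1.
lra.
Qed.

(* Only [e^-y <= 1 - y + y^2] and two moments enter, so the lower tail is
   exponentially small although the samples are heavy-tailed. *)
Lemma even_samples_lower_tail h M n : (h <= 1)%N -> (h = 0%N -> Defs.symmetric M) ->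
  (n.*2 <= T)%N -> 0 < frob2 M ->
  (\int[P]_om (expR ((210 * d%:R ^+ 2 * frob2 M)^-1 *
      (n%:R * frob2 M / 4 - \sum_(k < n) even_sample h M k om)))%:E <=
   (expR (- (n%:R / (840 * d%:R ^+ 2))))%:E)%E.
Proof.
move=> h1 hM nT F0.
have d0 : 0 < d%:R :> R by rewrite ltr0n.
(* This [r] minimizes [- r m + r^2 v] for [m = frob2 M] and [v = 105 d^2 m^2], with value
   [- 1 / (420 d^2)]. The threshold at a quarter of the mean gives back half of it, leaving 840. *)
set r := (210 * d%:R ^+ 2 * frob2 M)^-1.
have r0 : 0 < r by rewrite invr_gt0 !mulr_gt0// exprn_gt0.
have single k : (k < n)%N ->
   (\int[P]_om (expR (- r * even_sample h M k om))%:E <=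
    (expR (- (420 * d%:R ^+ 2)^-1))%:E)%E.
  move=> kn; have kT : (k.+1.*2 <= T)%N by apply: leq_trans nT; rewrite leq_double.
  have Mk := even_sample_all_moments M h1 kT.
  have mk := all_moments_measurable Mk.
  apply: (@le_trans _ _ (\int[P]_om (1 - r * even_sample h M k om
      + r ^+ 2 * even_sample h M k om ^+ 2)%:E)%E).
    apply: ge0_le_integral => //.
    - apply/measurable_EFinP; apply: measurableT_comp => //.
      exact: measurable_funM.
    - by apply/measurable_EFinP; apply: (all_moments_measurable (P := P)); moments.
    - move=> om _; rewrite lee_fin mulNr -exprMn expRN_le//.
      by rewrite mulr_ge0 ?even_sample_ge0// ltW.
  rewrite ev_EFin; last by moments.
  rewrite lee_fin evD; do ?[by moments].
  rewrite evB; do ?[by moments].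
  rewrite !evZ; do ?[by moments].
  rewrite ev_cst; apply: le_trans (expR_ge1Dx _).
  have H1 := ler_wpM2l (ltW r0) (even_sample_mean h1 hM kT).
  have H2 := ler_wpM2l (sqr_ge0 r) (even_sample_ev2 M h1 kT).
  have E1 : r * frob2 M = (210 * d%:R ^+ 2)^-1.
    by rewrite /r; field; rewrite !gt_eqF.
  have E2 : r ^+ 2 * (105 * d%:R ^+ 2 * frob2 M ^+ 2) = (420 * d%:R ^+ 2)^-1.
    by rewrite /r; field; rewrite !gt_eqF.
  have E3 : (210 * d%:R ^+ 2)^-1 = 2 * (420 * d%:R ^+ 2)^-1 :> R.
    by field; rewrite !gt_eqF.
  by rewrite E1 in H1; rewrite E2 in H2; lra.
under eq_integral do rewrite mulrBr expRD -mulNr EFinM.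
rewrite ge0_integralZl//; last first.
  apply/measurable_EFinP; apply: measurableT_comp => //.
  apply: measurable_funM => //; apply: measurable_sum => k.
  apply: (all_moments_measurable (P := P)); apply: even_sample_all_moments => //.
  by apply: leq_trans nT; rewrite leq_double.
rewrite laplace_even_samples//.
apply: (@le_trans _ _ ((expR (r * (n%:R * frob2 M / 4)))%:E *
    \prod_(k < n) (expR (- (420 * d%:R ^+ 2)^-1))%:E)%E).
  rewrite lee_wpmul2l ?lee_fin ?expR_ge0//.
  (* Monotonicity of products needs nonnegative factors, so the induction carries both facts and
     only the second is kept. *)
  apply: (@proj2 (0 <= \prod_(k < n) \int[P]_om (expR (- r * even_sample h M k om))%:E)%E).
  apply: (big_ind2 (fun a b : \bar R => (0 <= a)%E /\ (a <= b)%E)) => //.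
    move=> a1 b1 a2 b2 [a10 ab1] [a20 ab2].
    by split; [exact: mule_ge0|exact: lee_pmul].
  move=> k _; split; last exact: single.
  by apply: integral_ge0 => om _; rewrite lee_fin expR_ge0.
rewrite prodEFin -EFinM lee_fin prodr_const card_ord -expRM_natl -expRD ler_expR.
rewrite /r le_eqVlt; apply/orP; left; apply/eqP.
by field; rewrite !gt_eqF.
Qed.

(** * Averaging the conditional noise over the design *)

Variables (tau0 gam : R).
Hypotheses (gam0 : 0 < gam) (gam1 : gam < 1).
Hypothesis (tau1 : 1 <= tau0).
Hypothesis opnorm_pow : forall k, opnorm (A ^+ k) <= tau0 * gam ^+ k.

Let bnd k := tau0 * gam ^+ k * opnorm Sinf.

Let bnd_ge0 k : 0 <= bnd k.
Proof.
rewrite !mulr_ge0 ?opnorm_ge0 ?exprn_ge0//; first exact: le_trans tau1.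
exact: ltW.
Qed.

Let bnd0_le k : bnd k <= bnd 0.
Proof.
rewrite ler_wpM2r ?opnorm_ge0// ler_wpM2l ?(le_trans _ tau1)//.
by rewrite expr0 exprn_ile1// ltW.
Qed.

Let opnorm_bnd k : opnorm (A ^+ k *m Sinf) <= bnd k.
Proof.
by apply: le_trans (opnormM _ _) _; rewrite ler_wpM2r ?opnorm_ge0.
Qed.

Lemma autocov_cases u v t s :
  autocov u v t s = dot u ((A ^+ gap t s *m Sinf) *m v) \/
  autocov u v t s = dot v ((A ^+ gap t s *m Sinf) *m u).
Proof.
rewrite /autocov /gap; case: leqP => [st|/ltnW ts]; rewrite -!mulmxA.
  by left; rewrite (eqP st) addn0.
by right; rewrite (eqP ts) add0n.
Qed.

Lemma autocov_sqr_le u v t s :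
  autocov u v t s ^+ 2 <= bnd 0 ^+ 2 * (dot u u * dot v v).
Proof.
have H r q k : dot r ((A ^+ k *m Sinf) *m q) ^+ 2 <= bnd 0 ^+ 2 * (dot r r * dot q q).
  apply: le_trans (dot_cs _ _) _; rewrite mulrCA ler_wpM2l ?dot_ge0//.
  rewrite -!sqr_vnorm -exprMn lerXn2r ?nnegrE ?vnorm_ge0//.
    by rewrite mulr_ge0 ?vnorm_ge0.
  apply: le_trans (vnorm_mulmx _ _) _; rewrite ler_wpM2r ?vnorm_ge0//.
  exact: le_trans (opnorm_bnd _) (bnd0_le _).
have [->|->] := autocov_cases u v t s; first exact: H.
by rewrite [dot u u * _]mulrC; exact: H.
Qed.

(** [2 a b <= a^2 + b^2] bounds the conditional second moment by terms of this shape, a squared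
    covariance times a squared inner product of covariates. *)
Let q_ p q c e := fun om => obs_cov (x^~ om) p q ^+ 2 * dot (x c om) (x e om) ^+ 2.

Lemma autocov_all_moments p q : (p <= T)%N -> (q <= T)%N ->
  all_moments (fun om => autocov (x p om) (x q om) p q).
Proof.
move=> pT qT; rewrite /autocov; case: (q <= p)%N.
  by under eq_fun do rewrite mulmxA; exact: x_bilinear_all_moments.
by under eq_fun do rewrite mulmxA; exact: x_bilinear_all_moments.
Qed.

Lemma q_all_moments p q c e : (p <= T)%N -> (q <= T)%N -> (c <= T)%N -> (e <= T)%N ->
  all_moments (q_ p q c e).
Proof.
move=> pT qT cT eT; apply: all_momentsM; apply: all_momentsX.
  by apply: all_momentsD; [exact: autocov_all_moments|exact: all_moments_cst].
exact: x_dot_all_moments.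
Qed.

(** Between independent covariates both factors are genuine bilinear forms, whose fourth moments
    involve only the Frobenius norm; this gives [d^2] and the decay in the gap. The weight [b]
    balances the two fourth moments. *)
Lemma ev_q_far p q c e : (p <= T)%N -> (q <= T)%N -> (c <= T)%N -> (e <= T)%N ->
  p != q -> c != e -> ev (q_ p q c e) <= 9 * d%:R ^+ 2 * bnd (gap p q) ^+ 2.
Proof.
move=> pT qT cT eT pq ce; rewrite /q_ /obs_cov (negbTE pq).
under eq_ev do rewrite mulr0n addr0.
set b := bnd _; set B := A ^+ gap p q *m Sinf.
have BF : frob2 B <= d%:R * b ^+ 2.
  apply: le_trans (frob2_le_opnorm _) _; rewrite ler_wpM2l//.
  by rewrite lerXn2r ?nnegrE ?opnorm_ge0 ?bnd_ge0 ?opnorm_bnd.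
have Ma := autocov_all_moments pT qT; have Md := x_dot_all_moments cT eT.
have A4 : ev (fun om => autocov (x p om) (x q om) p q ^+ 4) <= 9 * d%:R ^+ 2 * b ^+ 4.
  apply: (@le_trans _ _ (9 * frob2 B ^+ 2)); last first.
    rewrite -mulrA ler_wpM2l//.
    rewrite (_ : d%:R ^+ 2 * b ^+ 4 = (d%:R * b ^+ 2) ^+ 2); last by ring.
    rewrite lerXn2r// nnegrE; first exact: frob2_ge0.
    exact: le_trans (frob2_ge0 _) BF.
  have [pq'|qp'] := leqP q p.
    have E om : autocov (x p om) (x q om) p q = dot (x p om) (B *m x q om).
      by rewrite /autocov pq' mulmxA /B /gap (eqP pq') addn0.
    by under eq_ev do rewrite E; exact: x_bilinear4.
  have E om : autocov (x p om) (x q om) p q = dot (x q om) (B *m x p om).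
    by rewrite /autocov leqNgt qp' /= mulmxA /B /gap (eqP (ltnW qp')) add0n.
  by under eq_ev do rewrite E; apply: x_bilinear4; rewrite // eq_sym.
have D4 : ev (fun om => dot (x c om) (x e om) ^+ 4) <= 9 * d%:R ^+ 2.
  have := x_bilinear4 1%:M cT eT ce; rewrite frob2_1.
  by under eq_ev do rewrite mul1mx.
have [b0|b0] := eqVneq b 0.
  have B0 : B = 0.
    apply: frob2_eq0; apply/eqP; rewrite eq_le frob2_ge0 andbT.
    by move: BF; rewrite b0 expr0n mulr0.
  have Z om : autocov (x p om) (x q om) p q = 0.
    have [->|->] := autocov_cases (x p om) (x q om) p q.
      by rewrite -/B B0 mul0mx dotC dot0l.
    by rewrite -/B B0 mul0mx dotC dot0l.
  under eq_ev do rewrite Z expr0n mul0r.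
  rewrite ev_cst; apply: mulr_ge0; last exact: sqr_ge0.
  by apply: mulr_ge0 => //; exact: sqr_ge0.
have bp : 0 < b by rewrite lt_def b0 bnd_ge0.
apply: (@le_trans _ _ (ev (fun om => 2^-1 * (b ^- 2 * autocov (x p om) (x q om) p q ^+ 4
    + b ^+ 2 * dot (x c om) (x e om) ^+ 4)))).
  apply: ler_ev; [by moments|by moments|move=> om].
  set r := autocov _ _ _ _; set g := dot _ _.
  have := sqr_ge0 (b^-1 * r ^+ 2 - b * g ^+ 2).
  have -> : (b^-1 * r ^+ 2 - b * g ^+ 2) ^+ 2 =
      b ^- 2 * r ^+ 4 + b ^+ 2 * g ^+ 4 - 2 * (r ^+ 2 * g ^+ 2).
    by field.
  lra.
rewrite evZ; last by moments.
rewrite evD; do ?[by moments].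
rewrite !evZ; do ?[by moments].
have H1 : b ^- 2 * ev (fun om => autocov (x p om) (x q om) p q ^+ 4) <=
    b ^- 2 * (9 * d%:R ^+ 2 * b ^+ 4).
  by rewrite ler_wpM2l// invr_ge0 exprn_ge0// ltW.
have H2 : b ^+ 2 * ev (fun om => dot (x c om) (x e om) ^+ 4) <=
    b ^+ 2 * (9 * d%:R ^+ 2).
  by rewrite ler_wpM2l// exprn_ge0// ltW.
have E1 : b ^- 2 * (9 * d%:R ^+ 2 * b ^+ 4) = 9 * d%:R ^+ 2 * b ^+ 2.
  by field.
by rewrite E1 in H1; lra.
Qed.

(** Covariates may coincide here, so only norms are used, at the price of [d^4]. This is affordable
    because it is applied only when [s] is within one of [t]. *)
Lemma ev_q_near p q c e : (p <= T)%N -> (q <= T)%N -> (c <= T)%N -> (e <= T)%N ->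
  ev (q_ p q c e) <= 210 * d%:R ^+ 4 * bnd 0 ^+ 2 + 6 * sig ^+ 4 * d%:R ^+ 2.
Proof.
move=> pT qT cT eT.
pose n t om := dot (x t om) (x t om).
have Mn t : (t <= T)%N -> all_moments (n t).
  by move=> tT; exact: x_dot_all_moments.
have n4 t : (t <= T)%N -> ev (fun om => n t om ^+ 4) <= 105 * d%:R ^+ 4.
  by move=> tT; exact: std_norm8_1 (x_gauss tT).
have n2 t : (t <= T)%N -> ev (fun om => n t om ^+ 2) <= 3 * d%:R ^+ 2.
  by move=> tT; exact: std_norm4_1 (x_gauss tT).
have [Mp Mq Mc Me] := And4 (Mn p pT) (Mn q qT) (Mn c cT) (Mn e eT).
apply: (@le_trans _ _ (ev (fun om =>
   (bnd 0 ^+ 2 / 2) * (n p om ^+ 4 + n q om ^+ 4 + n c om ^+ 4 + n e om ^+ 4)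
   + sig ^+ 4 * (n c om ^+ 2 + n e om ^+ 2)))).
  apply: ler_ev; [exact: q_all_moments|by moments|move=> om].
  have K2 : obs_cov (x^~ om) p q ^+ 2 <=
      2 * (bnd 0 ^+ 2 * (n p om * n q om)) + 2 * sig ^+ 4.
    have := autocov_sqr_le (x p om) (x q om) p q.
    rewrite /obs_cov -/(n p om) -/(n q om); set r := autocov _ _ _ _ => rle.
    have s4 : (sig ^+ 2 *+ (p == q)) ^+ 2 <= sig ^+ 4.
      case: (p == q); first by rewrite mulr1n -exprM.
      by rewrite mulr0n expr0n exprn_even_ge0.
    have := sqr_ge0 (r - sig ^+ 2 *+ (p == q)).
    by set z := sig ^+ 2 *+ _ in s4 *; nra.
  have D2 := dot_cs (x c om) (x e om).
  have pos t : 0 <= n t om by exact: dot_ge0.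
  have [pp pq pc pe] := And4 (pos p) (pos q) (pos c) (pos e).
  rewrite /q_ -/(n c om) -/(n e om) in D2 *.
  apply: (@le_trans _ _ ((2 * (bnd 0 ^+ 2 * (n p om * n q om)) + 2 * sig ^+ 4)
      * (n c om * n e om))).
    by apply: ler_pM => //; exact: sqr_ge0.
  have s40 : 0 <= sig ^+ 4 by rewrite exprn_even_ge0.
  have b20 : 0 <= bnd 0 ^+ 2 by exact: sqr_ge0.
  move: (n p om) (n q om) (n c om) (n e om) pp pq pc pe => a b g f a0 b0 g0 f0.
  have H1 : 4 * (a * b * (g * f)) <= a ^+ 4 + b ^+ 4 + g ^+ 4 + f ^+ 4.
    have := sqr_ge0 (a * b - g * f); have := sqr_ge0 (a ^+ 2 - b ^+ 2).
    by have := sqr_ge0 (g ^+ 2 - f ^+ 2); nra.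
  have H2 : 2 * (g * f) <= g ^+ 2 + f ^+ 2 by have := sqr_ge0 (g - f); nra.
  have := ler_wpM2l b20 H1; have := ler_wpM2l s40 H2; lra.
rewrite evD; do ?[by moments].
rewrite !evZ; do ?[by moments].
rewrite !evD; do ?[by moments].
have s40 : 0 <= sig ^+ 4 by rewrite exprn_even_ge0.
have b20 : 0 <= bnd 0 ^+ 2 / 2 by rewrite divr_ge0 ?sqr_ge0.
have H1 : ev (fun om => n p om ^+ 4) + ev (fun om => n q om ^+ 4) +
    ev (fun om => n c om ^+ 4) + ev (fun om => n e om ^+ 4) <= 420 * d%:R ^+ 4.
  by have := n4 p pT; have := n4 q qT; have := n4 c cT; have := n4 e eT; lra.
have H2 : ev (fun om => n c om ^+ 2) + ev (fun om => n e om ^+ 2) <= 6 * d%:R ^+ 2.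
  by have := n2 c cT; have := n2 e eT; lra.
by have := ler_wpM2l b20 H1; have := ler_wpM2l s40 H2; lra.
Qed.

(** The exponent is [k.-1] because the lag can shorten a gap by one. The observation noise enters
    only when two times coincide, hence for [k <= 1]. *)
Let weight k : R := 210 * d%:R ^+ 4 * bnd 0 ^+ 2 * (gam ^+ 2) ^+ k.-1
  + 6 * sig ^+ 4 * d%:R ^+ 2 * (k <= 1)%N%:R.

Lemma ev_q_le t s p q c e :
  (p <= T)%N -> (q <= T)%N -> (c <= T)%N -> (e <= T)%N ->
  (gap t s <= (gap p q).+1)%N -> ((1 < gap t s)%N -> c != e) ->
  ev (q_ p q c e) <= weight (gap t s).
Proof.
move=> pT qT cT eT gpq ce; rewrite /weight; have [g1|g1] := leqP (gap t s) 1.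
  have -> : (gap t s).-1 = 0%N by case: (gap t s) g1 => [|[]].
  by rewrite expr0 !mulr1; exact: ev_q_near.
have pq : p != q.
  by apply: contraTneq g1 => pq; rewrite -leqNgt (leq_trans gpq)// pq /gap subnn.
apply: le_trans (ev_q_far pT qT cT eT pq (ce g1)) _.
have d1 : 1 <= d%:R :> R by rewrite ler1n.
have H : bnd (gap p q) ^+ 2 <= bnd 0 ^+ 2 * (gam ^+ 2) ^+ (gap t s).-1.
  have -> : bnd (gap p q) ^+ 2 = bnd 0 ^+ 2 * (gam ^+ 2) ^+ gap p q.
    by rewrite /bnd -exprM mulnC exprM; ring.
  rewrite ler_wpM2l ?sqr_ge0//.
  have g2 : gam ^+ 2 <= 1 by rewrite exprn_ile1// ltW.
  by rewrite ler_wiXn2l ?sqr_ge0// -ltnS (ltn_predK g1).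
rewrite mulr0 addr0.
have -> : 9 * d%:R ^+ 2 * bnd (gap p q) ^+ 2 = 9 * (d%:R ^+ 2 * bnd (gap p q) ^+ 2).
  by ring.
have -> : 210 * d%:R ^+ 4 * bnd 0 ^+ 2 * (gam ^+ 2) ^+ (gap t s).-1 =
    210 * (d%:R ^+ 4 * (bnd 0 ^+ 2 * (gam ^+ 2) ^+ (gap t s).-1)) by ring.
apply: (@le_trans _ _ (9 * (d%:R ^+ 2 *
  (bnd 0 ^+ 2 * (gam ^+ 2) ^+ (gap t s).-1)))).
  by rewrite ler_wpM2l// ler_wpM2l ?sqr_ge0.
set r := bnd 0 ^+ 2 * _ in H *.
have r0 : 0 <= r by exact: le_trans (sqr_ge0 _) H.
have d24 : d%:R ^+ 2 * r <= d%:R ^+ 4 * r.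
  by rewrite ler_wpM2r// ler_weXn2l.
have : 0 <= d%:R ^+ 4 * r by rewrite mulr_ge0// exprn_ge0.
by lra.
Qed.

(** 630 and 18 are three times 210 and 6: one diagonal term and two one-sided sums, each at most the
    geometric sum with ratio [gam^2]. *)
Lemma sum_weight_le (t : 'I_T) : \sum_(s < T) weight (gap t s) <=
  630 * d%:R ^+ 4 * bnd 0 ^+ 2 / (1 - gam ^+ 2) + 18 * sig ^+ 4 * d%:R ^+ 2.
Proof.
have gg0 : 0 <= gam ^+ 2 by exact: sqr_ge0.
have gg1 : gam ^+ 2 < 1 by rewrite expr_lt1// ltW.
have p : 0 < 1 - gam ^+ 2 by rewrite subr_gt0.
have w0 k : 0 <= weight k.
  apply: addr_ge0; (apply: mulr_ge0; [|first [exact: exprn_ge0|exact: ler0n]]).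
    apply: mulr_ge0; last exact: sqr_ge0.
    by apply: mulr_ge0 => //; exact: exprn_ge0.
  apply: mulr_ge0; last exact: sqr_ge0.
  by apply: mulr_ge0 => //; exact: exprn_even_ge0.
apply: le_trans (sum_gap_le w0 (ltn_ord t)) _.
have -> : \sum_(k < T) weight k.+1 =
    210 * d%:R ^+ 4 * bnd 0 ^+ 2 * (\sum_(k < T) (gam ^+ 2) ^+ k)
    + 6 * sig ^+ 4 * d%:R ^+ 2.
  rewrite /weight big_split /= -!mulr_sumr; congr (_ + _).
  case: (T) t => [[]//|n _]; rewrite big_ord_recl big1 ?addr0 ?mulr1//.
have := geometric_sum_le T gg0 gg1.
set S := \sum_(k < T) _ => Sle.
have C0 : 0 <= 210 * d%:R ^+ 4 * bnd 0 ^+ 2.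
  by apply: mulr_ge0; [apply: mulr_ge0 => //; exact: exprn_ge0|exact: sqr_ge0].
have H1 := ler_wpM2l C0 Sle.
have H2 : 210 * d%:R ^+ 4 * bnd 0 ^+ 2 <= 210 * d%:R ^+ 4 * bnd 0 ^+ 2 / (1 - gam ^+ 2).
  rewrite -[leLHS]mulr1 ler_wpM2l// invf_ge1// gerBl//.
have -> : 630 * d%:R ^+ 4 * bnd 0 ^+ 2 / (1 - gam ^+ 2) =
   3 * (210 * d%:R ^+ 4 * bnd 0 ^+ 2 / (1 - gam ^+ 2)) by ring.
rewrite /weight /= expr0 !mulr1.
have -> : 18 * sig ^+ 4 * d%:R ^+ 2 = 3 * (6 * sig ^+ 4 * d%:R ^+ 2) by ring.
move: H1 H2.
set a := 210 * d%:R ^+ 4 * bnd 0 ^+ 2; set b := _ * d%:R ^+ 2.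
by set c := a / _; lra.
Qed.

Let dominant h om : R := \sum_(t < T) \sum_(s < T) 2^-1 *
  (q_ (t + h) (s + h) (t + h) (s + h) om + q_ t s t s om
   + q_ (t + h) s (t + h) (s + h) om + q_ t (s + h) t s om).

Lemma ev_frob2_noise_le_dominant h om : (h <= 1)%N ->
  ev (fun o => frob2 (noise h (x^~ om) o)) <= dominant h om.
Proof.
move=> h1; rewrite ev_frob2_noise//; apply: ler_sum => t _; apply: ler_sum => s _.
rewrite /q_.
set a := obs_cov _ (t + h) (s + h); set b := obs_cov _ t s.
set a' := obs_cov _ (t + h) s; set b' := obs_cov _ t (s + h).
set g := dot (x (t + h)%N om) _; set f := dot (x t om) _.
have := sqr_ge0 (a * g - b * f); have := sqr_ge0 (a' * g - b' * f).
by nra.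
Qed.

Let add_le t h : (h <= 1)%N -> (t < T)%N -> (t + h <= T)%N.
Proof. by move=> h1 tT; rewrite (leq_trans (leq_add (leqnn _) h1))// addn1. Qed.

Lemma dominant_all_moments h : (h <= 1)%N -> all_moments (dominant h).
Proof.
move=> h1; apply: all_moments_sum => t _; apply: all_moments_sum => s _.
have th := add_le h1 (ltn_ord t); have sh := add_le h1 (ltn_ord s).
have tT := ltnW (ltn_ord t); have sT := ltnW (ltn_ord s).
by apply: all_momentsZ; do 3?apply: all_momentsD; exact: q_all_moments.
Qed.

Lemma conditional_noise_all_moments h : (h <= 1)%N ->
  all_moments (fun om => \sum_(t < T) \sum_(s < T)
    (obs_cov (x^~ om) (t + h) (s + h) * obs_cov (x^~ om) t s +
     obs_cov (x^~ om) (t + h) s * obs_cov (x^~ om) t (s + h))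
    * (dot (x (t + h)%N om) (x (s + h)%N om) * dot (x t om) (x s om))).
Proof.
move=> h1; apply: all_moments_sum => t _; apply: all_moments_sum => s _.
have th := add_le h1 (ltn_ord t); have sh := add_le h1 (ltn_ord s).
have tT := ltnW (ltn_ord t); have sT := ltnW (ltn_ord s).
have Mo p q : (p <= T)%N -> (q <= T)%N -> all_moments (fun om => obs_cov (x^~ om) p q).
  move=> pT qT; apply: all_momentsD; last exact: all_moments_cst.
  exact: autocov_all_moments.
apply: all_momentsM.
  by apply: all_momentsD; apply: all_momentsM; exact: Mo.
by apply: all_momentsM; exact: x_dot_all_moments.
Qed.

Lemma ev_dominant_le h : (h <= 1)%N ->
  ev (dominant h) <= 1260 * T%:R * d%:R ^+ 2 *
    (sig ^+ 4 + tau0 ^+ 2 / (1 - gam ^+ 2) * opnorm Sinf ^+ 2 * d%:R ^+ 2).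
Proof.
move=> h1.
have gg1 : gam ^+ 2 < 1 by rewrite expr_lt1// ltW.
have p : 0 < 1 - gam ^+ 2 by rewrite subr_gt0.
(* Each summand is half of four terms, every one bounded by the weight of the gap between [t] and
   [s]. *)
apply: (@le_trans _ _ (\sum_(t < T) \sum_(s < T) 2 * weight (gap t s))).
  rewrite ev_sum => [|t]; last first.
    apply: all_moments_sum => s _.
    have th := add_le h1 (ltn_ord t); have sh := add_le h1 (ltn_ord s).
    have tT := ltnW (ltn_ord t); have sT := ltnW (ltn_ord s).
    by apply: all_momentsZ; do 3?apply: all_momentsD; exact: q_all_moments.
  apply: ler_sum => t _; have th := add_le h1 (ltn_ord t); have tT := ltnW (ltn_ord t).
  rewrite ev_sum => [|s]; last first.
    have sh := add_le h1 (ltn_ord s); have sT := ltnW (ltn_ord s).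
    by apply: all_momentsZ; do 3?apply: all_momentsD; exact: q_all_moments.
  apply: ler_sum => s _; have sh := add_le h1 (ltn_ord s); have sT := ltnW (ltn_ord s).
  have M1 := q_all_moments th sh th sh; have M2 := q_all_moments tT sT tT sT.
  have M3 := q_all_moments th sT th sh; have M4 := q_all_moments tT sh tT sT.
  rewrite evZ; last by do 3?apply: all_momentsD.
  rewrite evD ?evD//; do ?[by do 2?apply: all_momentsD].
  have E (p' q' c e : nat) : (p' <= T)%N -> (q' <= T)%N -> (c <= T)%N -> (e <= T)%N ->
    (gap t s <= (gap p' q').+1)%N -> ((1 < gap t s)%N -> c != e) ->
    ev (q_ p' q' c e) <= weight (gap t s) by exact: ev_q_le.
  have ts : (1 < gap t s)%N -> (t != s :> nat).
    by apply: contraTneq => ->; rewrite /gap subnn.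
  have ths : (1 < gap t s)%N -> (t + h)%N != (s + h)%N.
    by move=> /ts; rewrite eqn_add2r.
  have G1 : (gap t s <= (gap (t + h) (s + h)).+1)%N by rewrite /gap; lia.
  have G2 : (gap t s <= (gap t s).+1)%N by exact: leqnSn.
  have G3 : (gap t s <= (gap (t + h) s).+1)%N by rewrite /gap; lia.
  have G4 : (gap t s <= (gap t (s + h)).+1)%N by rewrite /gap; lia.
  have := E _ _ _ _ th sh th sh G1 ths; have := E _ _ _ _ tT sT tT sT G2 ts.
  have := E _ _ _ _ th sT th sh G3 ths; have := E _ _ _ _ tT sh tT sT G4 ts.
  by lra.
apply: (@le_trans _ _ (\sum_(t < T) 2 * (630 * d%:R ^+ 4 * bnd 0 ^+ 2 / (1 - gam ^+ 2)
    + 18 * sig ^+ 4 * d%:R ^+ 2))).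
  by apply: ler_sum => t _; rewrite -mulr_sumr ler_wpM2l// sum_weight_le.
rewrite sumr_const card_ord -[_ *+ T]mulr_natl /bnd expr0 mulr1.
have E1 : T%:R * (2 * (630 * d%:R ^+ 4 * (tau0 * opnorm Sinf) ^+ 2 / (1 - gam ^+ 2))) =
  1260 * T%:R * d%:R ^+ 2 * (tau0 ^+ 2 / (1 - gam ^+ 2) * opnorm Sinf ^+ 2 * d%:R ^+ 2).
  by ring.
rewrite !mulrDr E1 addrC lerD2r.
have : 0 <= T%:R * (d%:R ^+ 2 * sig ^+ 4).
  apply: mulr_ge0 => //; apply: mulr_ge0; first exact: sqr_ge0.
  exact: exprn_even_ge0.
by lra.
Qed.

(** The separate maps [f] and [g] cover both the product space used in decoupling and the diagonal,
    where the design and the state share the same outcome. *)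
Lemma measurable_frob2_noise d' (T' : measurableType d') (f g : T' -> O) h :
  (h <= 1)%N ->
  (forall t j, (t <= T)%N -> measurable_fun setT (fun z => x t (f z) j 0)) ->
  (forall t j, (t <= T)%N -> measurable_fun setT (fun z => beta t (g z) j 0)) ->
  (forall t, (t <= T)%N -> measurable_fun setT (fun z => eps t (g z))) ->
  measurable_fun setT (fun z => frob2 (noise h (x^~ (f z)) (g z))).
Proof.
move=> h1 mx mb me; under eq_fun do rewrite frob2_noise.
have md t s : (t <= T)%N -> (s <= T)%N ->
    measurable_fun setT (fun z => dot (x t (f z)) (x s (f z))).
  by move=> tT sT; apply: measurable_dot => j; exact: mx.
have mo t : (t <= T)%N -> measurable_fun setT (fun z => obs (x^~ (f z)) t (g z)).
  move=> tT; apply: measurable_funD; last exact: me.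
  by apply: measurable_dot => j; [exact: mx|exact: mb].
have mc t s : (t <= T)%N -> (s <= T)%N ->
    measurable_fun setT (fun z => obs_cov (x^~ (f z)) t s).
  move=> tT sT; apply: measurable_funD => //; rewrite /autocov.
  case: (s <= t)%N; apply: measurable_dot => j; do ?[exact: mx].
    by under eq_fun do rewrite mulmxA; apply: measurable_mulmx => i; exact: mx.
  by under eq_fun do rewrite mulmxA; apply: measurable_mulmx => i; exact: mx.
have mz t : (t < T)%N -> measurable_fun setT (fun z => centered h (x^~ (f z)) t (g z)).
  move=> tT; have th := add_le h1 tT; apply: measurable_funB; last exact: mc (ltnW _).
  by apply: measurable_funM; apply: mo => //; exact: ltnW.
apply: measurable_sum => t; apply: measurable_sum => s.
have th := add_le h1 (ltn_ord t); have sh := add_le h1 (ltn_ord s).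
have tT := ltnW (ltn_ord t); have sT := ltnW (ltn_ord s).
apply: measurable_funM; apply: measurable_funM; do ?[exact: mz|exact: md].
Qed.

(** The tower property: the inner integral freezes the design and is given by Isserlis, and the
    outer one averages [dominant] over the design. *)
Lemma noise_second_moment h : (h <= 1)%N ->
  (\int[P]_om (frob2 (noise h (x^~ om) om))%:E <=
   (1260 * T%:R * d%:R ^+ 2 *
    (sig ^+ 4 + tau0 ^+ 2 / (1 - gam ^+ 2) * opnorm Sinf ^+ 2 * d%:R ^+ 2))%:E)%E.
Proof.
move=> h1.
pose F (z : sigma_on G design * sigma_on G dynamic) :=
  (frob2 (noise h (x^~ z.1) z.2))%:E.
rewrite (@decouple_on _ _ _ _ _ _ Gm GI GT G_indep _ _ F).
- apply: (@le_trans _ _ (\int[P]_om (dominant h om)%:E)%E); last first.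
    rewrite ev_EFin; last exact: dominant_all_moments.
    by rewrite lee_fin ev_dominant_le.
  have E om : (\int[P]_o2 F (om, o2) =
      (ev (fun o => frob2 (noise h (x^~ om) o)))%:E)%E.
    by rewrite /F /= ev_EFin//; exact: frob2_noise_all_moments.
  under eq_integral do rewrite E.
  apply: ge0_le_integral => //.
  + by move=> om _; rewrite lee_fin ev_ge0// => o; exact: frob2_ge0.
  + apply/measurable_EFinP.
    by under eq_fun do rewrite ev_frob2_noise//;
       exact: all_moments_measurable (conditional_noise_all_moments h1).
  + by apply/measurable_EFinP; case: (dominant_all_moments h1).
  + by move=> om _; rewrite lee_fin ev_frob2_noise_le_dominant.
- by move=> i; rewrite /design.
- apply/measurable_EFinP; apply: measurable_frob2_noise => //.
  + move=> t j tT; have mx : measurable_on design (fun om => x t om j 0).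
      exact: x_measurable_on.
    exact: (measurableT_comp mx measurable_fst).
  + move=> t j tT; have mb : measurable_on dynamic (fun om => beta t om j 0).
      apply: beta_measurable_on; first exact: leqW.
      by move=> [[[s|s]|s]|].
    exact: (measurableT_comp mb measurable_snd).
  + move=> t tT; have me : measurable_on dynamic (eps t) by exact: eps_measurable_on.
    exact: (measurableT_comp me measurable_snd).
- by move=> z; rewrite lee_fin frob2_ge0.
Qed.

End model.

(** * Deterministic analysis of the least squares fits *)

Section least_squares.
Variables (R : realType) (d : nat).
Implicit Types (M N : 'M[R]_d) (a : nat -> 'cV[R]_d).

Lemma dotZr c (u v : 'cV[R]_d) : dot u (c *: v) = c * dot u v.
Proof. by rewrite dotC dotZl dotC. Qed.

Lemma dot_outer_sum (I : finType) (z : I -> R) (u v : I -> 'cV[R]_d) M :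
  \sum_i z i * dot (u i) (M *m v i) =
  \sum_k \sum_l (\sum_i z i *: (u i *m (v i)^T)) k l * M k l.
Proof.
have -> : \sum_i z i * dot (u i) (M *m v i) =
    \sum_i \sum_k \sum_l z i * (u i k 0 * v i l 0) * M k l.
  apply: eq_bigr => i _; rewrite dotE mulr_sumr; apply: eq_bigr => k _.
  by rewrite mxE !mulr_sumr; apply: eq_bigr => l _; ring.
rewrite exchange_big; apply: eq_bigr => k _ /=.
rewrite exchange_big; apply: eq_bigr => l _ /=.
rewrite summxE mulr_suml; apply: eq_bigr => i _.
by rewrite !mxE big_ord1 !mxE.
Qed.

Lemma mx_inner_cs M N : (\sum_k \sum_l M k l * N k l) ^+ 2 <= frob2 M * frob2 N.
Proof.
rewrite /frob2 !pair_big /=.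
exact: (cauchy_schwarz_sum (fun p : 'I_d * 'I_d => M p.1 p.2) (fun p => N p.1 p.2)).
Qed.

(** With [D = M - N] and [Z] the weighted outer sum, optimality gives [Q <= 2 <Z, D> <= 2 |Z| |D|]
    for the quadratic form [Q] of [D]; combine this with [Q >= c |D|^2]. *)
Lemma least_squares_error (I : finType) (u v : I -> 'cV[R]_d) (r : I -> R) M N c :
  0 <= c ->
  \sum_i (r i - dot (u i) (M *m v i)) ^+ 2 <= \sum_i (r i - dot (u i) (N *m v i)) ^+ 2 ->
  c * frob2 (M - N) <= \sum_i dot (u i) ((M - N) *m v i) ^+ 2 ->
  c ^+ 2 * frob2 (M - N) <=
  4 * frob2 (\sum_i (r i - dot (u i) (N *m v i)) *: (u i *m (v i)^T)).
Proof.
move=> c0 opt low; set D := M - N in low *.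
set Z := \sum_i _ *: _.
pose z i := r i - dot (u i) (N *m v i).
pose q i := dot (u i) (D *m v i).
have qE i : r i - dot (u i) (M *m v i) = z i - q i.
  have -> : M = N + D by rewrite /D addrC subrK.
  by rewrite mulmxDl dotDr /z /q; ring.
have sE : \sum_i (z i - q i) ^+ 2 =
    \sum_i z i ^+ 2 - 2 * (\sum_i z i * q i) + \sum_i q i ^+ 2.
  by rewrite mulr_sumr -sumrB -big_split; apply: eq_bigr => i _ /=; ring.
have {}opt : \sum_i (z i - q i) ^+ 2 <= \sum_i z i ^+ 2.
  by move: opt; under eq_bigr do rewrite qE.
rewrite sE in opt.
have qs : \sum_i q i ^+ 2 <= 2 * \sum_i z i * q i.
  by move: opt; lra.
have zD : (\sum_i z i * q i) ^+ 2 <= frob2 Z * frob2 D.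
  by rewrite dot_outer_sum; exact: mx_inner_cs.
move: low qs zD; rewrite -/(q _).
set s := \sum_i z i * q i; set Q := \sum_i q i ^+ 2 => low qs zD.
have F0 := frob2_ge0 D; have [->|FN0] := eqVneq (frob2 D) 0.
  by rewrite mulr0 mulr_ge0 ?frob2_ge0.
have Fp : 0 < frob2 D by rewrite lt_def FN0.
rewrite -(ler_pM2r Fp) -mulrA -expr2 -exprMn -mulrA.
have cF0 : 0 <= c * frob2 D by rewrite mulr_ge0.
apply: (@le_trans _ _ ((2 * s) ^+ 2)).
  by rewrite lerXn2r ?nnegrE//; lra.
by rewrite exprMn; lra.
Qed.

(** The indices [0 .. 2K] become the points of [[-1, 1]] with step [1 / K]. Matrices over an ordinal
    form a finite type, so the union bound is a finite sum. *)
Definition grid_mx (K : nat) (N : 'M['I_(K.*2.+1)]_d) : 'M[R]_d :=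
  map_mx (fun i : 'I_(K.*2.+1) => ((i : nat)%:R - K%:R) / K%:R) N.

(** All entries are rounded by the same function, which preserves symmetry. *)
Lemma grid_approx K M : (0 < K)%N -> (forall i j, `|M i j| <= 1) ->
  exists N : 'M['I_(K.*2.+1)]_d,
    frob2 (M - grid_mx N) <= (d%:R / K%:R) ^+ 2 /\
    (Defs.symmetric M -> Defs.symmetric (grid_mx N)).
Proof.
move=> K0 M1; have Kp : 0 < K%:R :> R by rewrite ltr0n.
pose f (r : R) : 'I_(K.*2.+1) := inord (Num.truncn ((r + 1) * K%:R)).
have fE r : `|r| <= 1 -> `|r - ((f r : nat)%:R - K%:R) / K%:R| <= 1 / K%:R.
  move=> r1; have /andP[rl rr] : -1 <= r <= 1 by rewrite -ler_norml.
  have y0 : 0 <= (r + 1) * K%:R by rewrite mulr_ge0//; lra.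
  have y2 : (r + 1) * K%:R <= K.*2%:R.
    rewrite -muln2 natrM mulrC ler_wpM2l//; lra.
  have /andP[t1 t2] := truncn_itv y0.
  have tK : (Num.truncn ((r + 1) * K%:R) < K.*2.+1)%N.
    by rewrite ltnS -(ler_nat R) (le_trans t1).
  rewrite /f inordK//; set t := Num.truncn _ in t1 t2 *.
  have -> : r - (t%:R - K%:R) / K%:R = ((r + 1) * K%:R - t%:R) / K%:R.
    by field; rewrite gt_eqF.
  rewrite normrM [`|_^-1|]ger0_norm ?invr_ge0 ?(ltW Kp)// ler_pM2r ?invr_gt0//.
  rewrite ger0_norm ?subr_ge0// lerBlDr -natr1 in t2 *.
  by move: t2; rewrite [1 + _]addrC => /ltW.
exists (map_mx f M); split; last first.
  by move=> Msym; apply/matrixP => i j; rewrite !mxE -[in LHS]Msym mxE.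
have -> : (d%:R / K%:R) ^+ 2 = \sum_(i < d) \sum_(j < d) (1 / K%:R) ^+ 2 :> R.
  by rewrite !sumr_const card_ord -mulrnA -[RHS]mulr_natl natrM; ring.
apply: ler_sum => i _; apply: ler_sum => j _; rewrite !mxE.
rewrite -[leLHS]real_normK ?num_real// lerXn2r ?nnegrE//; exact: fE.
Qed.

Lemma frob2_entry_le M i j : M i j ^+ 2 <= frob2 M.
Proof.
rewrite /frob2 (bigD1 i)//= (bigD1 j)//= -addrA lerDl addr_ge0//.
  by apply: sumr_ge0 => k _; exact: sqr_ge0.
by apply: sumr_ge0 => k _; apply: sumr_ge0 => l _; exact: sqr_ge0.
Qed.

Lemma bilinear_sqr_le (u v : 'cV[R]_d) M :
  dot u (M *m v) ^+ 2 <= frob2 M * (dot u u * dot v v).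
Proof.
apply: le_trans (dot_cs _ _) _; rewrite mulrCA ler_wpM2l ?dot_ge0//.
exact: dot_mulmx_le.
Qed.

Lemma frob2_le_double M N : frob2 M <= 2 * frob2 N + 2 * frob2 (M - N).
Proof.
rewrite /frob2 !mulr_sumr -big_split; apply: ler_sum => i _ /=.
rewrite !mulr_sumr -big_split; apply: ler_sum => j _ /=.
by rewrite !mxE; have := sqr_ge0 (M i j - 2 * N i j); nra.
Qed.

Lemma sum_norm4_le a h T : (h <= 1)%N ->
  \sum_(t < T) dot (a (t + h)%N) (a (t + h)%N) * dot (a t) (a t) <=
  \sum_(t < T.+1) dot (a t) (a t) ^+ 2.
Proof.
move=> h1; pose n t := dot (a t) (a t) ^+ 2.
have n0 t : 0 <= n t by exact: sqr_ge0.
have shift : \sum_(t < T) n (t + h)%N <= \sum_(t < T.+1) n t.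
  case: h h1 => [_|[_|//]].
    by under eq_bigr do rewrite addn0; rewrite big_ord_recr /= lerDl.
  rewrite big_ord_recl /= addrC.
  by under eq_bigr do rewrite addn1; rewrite lerDl.
have noshift : \sum_(t < T) n t <= \sum_(t < T.+1) n t.
  by rewrite [leRHS]big_ord_recr /= lerDl.
apply: (@le_trans _ _ (2^-1 * (\sum_(t < T) n (t + h)%N + \sum_(t < T) n t))).
  rewrite -big_split mulr_sumr; apply: ler_sum => t _ /=; rewrite /n.
  by have := sqr_ge0 (dot (a (t + h)%N) (a (t + h)%N) - dot (a t) (a t)); nra.
by move: shift noshift; lra.
Qed.

(* On the grid the hypothesis is a lower bound; away from it the quadratic form is
   controlled by the crude bound [W] on the fourth moments of the design. *)
Lemma design_lower_bound a h T n K (W : R) : (h <= 1)%N ->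
  (n.*2 <= T)%N -> (T <= 3 * n)%N -> (0 < K)%N -> (d.*2 <= K)%N ->
  \sum_(t < T.+1) dot (a t) (a t) ^+ 2 <= W ->
  (d%:R / K%:R) ^+ 2 * W <= T%:R / 192 ->
  (forall N : 'M['I_(K.*2.+1)]_d,
     (h = 0%N -> Defs.symmetric (grid_mx N)) -> 4^-1 <= frob2 (grid_mx N) ->
     n%:R * frob2 (grid_mx N) / 4 <=
     \sum_(k < n) dot (a (k.*2 + h)%N) (grid_mx N *m a k.*2) ^+ 2) ->
  forall M, (h = 0%N -> Defs.symmetric M) ->
  T%:R / 192 * frob2 M <= \sum_(t < T) dot (a (t + h)%N) (M *m a t) ^+ 2.
Proof.
move=> h1 nT Tn K0 dK sW KW grid M Msym.
pose S M' := \sum_(t < T) dot (a (t + h)%N) (M' *m a t) ^+ 2.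
have [F0|F0] := eqVneq (frob2 M) 0.
  by rewrite F0 mulr0 sumr_ge0// => t _; exact: sqr_ge0.
have Fp : 0 < frob2 M by rewrite lt_def F0 frob2_ge0.
have fp : 0 < frob M by rewrite sqrtr_gt0.
pose M' := (frob M)^-1 *: M.
have F1 : frob2 M' = 1 by rewrite frob2Z exprVn sqr_frob mulVf.
have SM : S M = frob2 M * S M'.
  rewrite /S mulr_sumr; apply: eq_bigr => t _.
  by rewrite -scalemxAl dotZr exprMn exprVn sqr_frob mulrA mulfV ?mul1r.
suff : T%:R / 192 <= S M'.
  by move=> le; rewrite -/(S M) SM mulrC ler_wpM2l ?frob2_ge0.
have M'1 i j : `|M' i j| <= 1.
  rewrite -(@ler_pXn2r _ 2) ?nnegrE// expr1n real_normK ?num_real// -F1.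
  exact: frob2_entry_le.
have [N [NF Nsym]] := grid_approx K0 M'1.
(* A squared distance of at most 1/4 from a matrix of norm 1 leaves [|N|^2 >= 1/2 - 1/4], the
   threshold demanded of grid points. *)
have dK2 : (d%:R / K%:R) ^+ 2 <= 4^-1 :> R.
  have -> : 4^-1 = (2^-1) ^+ 2 :> R by field.
  rewrite lerXn2r ?nnegrE ?divr_ge0// ler_pdivrMr ?ltr0n// mulrC ler_pdivlMr//.
  by rewrite -natrM muln2 ler_nat.
have N4 : 4^-1 <= frob2 (grid_mx N).
  have := frob2_le_double M' (grid_mx N); rewrite F1 => b.
  by have := le_trans NF dK2; lra.
have Nlow := fun s => grid N s N4.
(* The grid bound is at least [n / 16], and [T <= 3 n]. *)
have SN : T%:R / 48 <= S (grid_mx N).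
  apply: (@le_trans _ _ (n%:R * frob2 (grid_mx N) / 4)); last first.
    apply: le_trans (Nlow _) _.
      by move=> h0; apply: Nsym; rewrite /Defs.symmetric linearZ /= Msym.
    apply: (@sum_even_le R (fun t => dot (a (t + h)%N) (grid_mx N *m a t) ^+ 2) n T nT).
    by move=> t; exact: sqr_ge0.
  have Tn' : T%:R <= 3 * n%:R :> R by rewrite -natrM ler_nat.
  by have n0 : 0 <= n%:R :> R by []; nra.
have SD : S (M' - grid_mx N) <= T%:R / 192.
  apply: le_trans KW; apply: (@le_trans _ _ (frob2 (M' - grid_mx N) *
      \sum_(t < T) dot (a (t + h)%N) (a (t + h)%N) * dot (a t) (a t))).
    by rewrite mulr_sumr; apply: ler_sum => t _; exact: bilinear_sqr_le.
  apply: ler_pM => //; first exact: frob2_ge0.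
    by apply: sumr_ge0 => t _; rewrite mulr_ge0 ?dot_ge0.
  exact: le_trans (sum_norm4_le _ _ h1) sW.
(* Hence [2 S M' >= T / 48 - T / 96], which is where 192 comes from. *)
have : S (grid_mx N) <= 2 * S M' + 2 * S (M' - grid_mx N).
  rewrite /S !mulr_sumr -big_split; apply: ler_sum => t _ /=.
  rewrite mulmxBl dotDr -scaleN1r dotZr.
  set p := dot _ _; set q := dot _ _.
  by have := sqr_ge0 (2 * q - p); nra.
by have : 0 <= T%:R :> R by []; lra.
Qed.

End least_squares.

(** * Union bound and Markov's inequality in additive form *)

Section mean_le.
Context {R : realType} {dO : measure_display} {O : measurableType dO}.
Variable P : probability O R.

(** A bad event is represented by a nonnegative variable reaching 1 on it: adding variables adds
    means, so the union bound is a sum and Markov's inequality is used once at the end. *)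
Definition mean_le (f : O -> R) b := [/\ measurable_fun setT f,
  forall om, 0 <= f om & (\int[P]_om (f om)%:E <= b%:E)%E].

Lemma mean_leD f g a b : mean_le f a -> mean_le g b ->
  mean_le (fun om => f om + g om) (a + b).
Proof.
move=> [mf f0 fa] [mg g0 gb]; split.
- exact: measurable_funD.
- by move=> om; rewrite addr_ge0.
- under eq_integral do rewrite EFinD.
  rewrite ge0_integralD//; last 4 first.
  + by move=> om _; rewrite lee_fin.
  + exact/measurable_EFinP.
  + by move=> om _; rewrite lee_fin.
  + exact/measurable_EFinP.
  by rewrite EFinD leeD.
Qed.

Lemma mean_leZ c f a : 0 <= c -> mean_le f a -> mean_le (fun om => c * f om) (c * a).
Proof.
move=> c0 [mf f0 fa]; split.
- exact: measurable_funM.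
- by move=> om; rewrite mulr_ge0.
- under eq_integral do rewrite EFinM.
  rewrite ge0_integralZl//; last 2 first.
  + exact/measurable_EFinP.
  + by move=> om _; rewrite lee_fin.
  by rewrite EFinM lee_wpmul2l// lee_fin.
Qed.

Lemma mean_le_sum (I : finType) (Q : pred I) (f : I -> O -> R) a : 0 <= a ->
  (forall i, Q i -> mean_le (f i) a) ->
  mean_le (fun om => \sum_(i | Q i) f i om) (#|I|%:R * a).
Proof.
move=> a0 fi; have -> : #|I| = size (index_enum I).
  by rewrite cardT enumT [index_enum I]unlock.
elim: (index_enum I) => [|i r IH].
  under [X in mean_le X]eq_fun do rewrite big_nil; rewrite mul0r; split=> //.
  by rewrite integral0.
have -> : (size (i :: r))%:R * a = a + (size r)%:R * a by rewrite /= -natr1; ring.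
under [X in mean_le X]eq_fun do rewrite big_cons.
have [Qi|nQi] := boolP (Q i); first exact: mean_leD (fi _ Qi) IH.
case: IH => mf f0 fa; split=> //; apply: le_trans fa _.
by rewrite lee_fin lerDr.
Qed.

Lemma mean_le_trans f a b : a <= b -> mean_le f a -> mean_le f b.
Proof. by move=> ab [mf f0 fa]; split=> //; apply: le_trans fa _; rewrite lee_fin. Qed.

Lemma mean_le_markov f b : mean_le f b ->
  measurable [set om | f om < 1] /\ ((1 - b)%:E <= P [set om | (f om < 1)%R])%E.
Proof.
move=> [mf f0 fb].
have mE : measurable [set om | 1 <= f om].
  by rewrite -[X in measurable X]setTI; exact: measurable_fun_le.
have EC : [set om | f om < 1] = ~` [set om | 1 <= f om].
  by apply/seteqP; split=> om /=; rewrite ltNge => /negP.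
rewrite EC; split; first exact: measurableC.
rewrite probability_setC// EFinB leeB//.
apply: le_trans fb.
have -> : P [set om | 1 <= f om] = (\int[P]_om (\1_[set om | 1 <= f om] om)%:E)%E.
  by rewrite integral_indic// setIT.
apply: ge0_le_integral => //.
- by apply/measurable_EFinP; exact: measurable_indic.
- exact/measurable_EFinP.
- move=> om _; rewrite lee_fin indicE.
  by case: (boolP (om \in _)) => //; rewrite inE.
Qed.
End mean_le.

(** Half of the sample must beat [m d^2 (d^2 ln (2K + 1) + ln (8 / delta))]. Both logarithms are at
    most [L], so [T] of order [d^4 L] suffices. *)
Lemma sample_size_choice (R : realType) (b c m delta : R) (d T : nat) :
  3 <= b -> 1 <= m -> 2 * b + 3 <= c -> 6 * m <= c ->
  (0 < d)%N -> 0 < delta -> delta < 1 ->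
  c * d%:R ^+ 4 * ln (c * d%:R ^+ 2 / delta) <= T%:R ->
  exists K n : nat, [/\ (n.*2 <= T <= 3 * n)%N, (0 < T)%N, (d.*2 <= K)%N,
    b * d%:R ^+ 2 / delta <= K%:R :> R &
    (K.*2.+1)%:R ^+ (d * d) * expR (- (n%:R / (m * d%:R ^+ 2))) <= delta / 8].
Proof.
move=> b3 m1 cb cm d0 de0 de1 size.
have D1 : 1 <= d%:R :> R by rewrite ler1n.
set D : R := d%:R in D1 size *.
have D2 : 1 <= D ^+ 2 by rewrite exprn_ege1.
have D4 : 1 <= D ^+ 4 by rewrite exprn_ege1.
have D42 : D ^+ 4 = D ^+ 2 * D ^+ 2 by rewrite -exprD.
have D24 : D ^+ 2 <= D ^+ 4 by rewrite D42 ler_peMl ?sqr_ge0.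
have q1 : 1 <= D ^+ 2 / delta.
  by rewrite ler_pdivlMr// mul1r; apply: le_trans (ltW de1) _.
have Dq : D ^+ 2 <= D ^+ 2 / delta.
  by rewrite ler_pdivlMr// ler_piMr ?sqr_ge0// ltW.
have q8 : 8 / delta <= 8 * (D ^+ 2 / delta).
  by rewrite mulrA ler_pM2r ?invr_gt0// ler_peMr.
set q := D ^+ 2 / delta in q1 Dq q8.
have qE a : a * D ^+ 2 / delta = a * q by rewrite /q mulrA.
rewrite !qE in size *.
set L := ln (c * q) in size.
have c9 : 9 <= c by lra.
have cq0 : c <= c * q by rewrite ler_peMr//; lra.
have y0 : 0 < c * q by lra.
(* From [ln (1 / y) <= 1 / y - 1] at [y = c q >= 2]. It ensures [T >= 2], without which
   [T <= 3 * T./2] could fail. *)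
have L0 : 2^-1 <= L.
  have : ln ((c * q)^-1) <= (c * q)^-1 - 1.
    have := @le_ln1Dx R ((c * q)^-1 - 1); rewrite [1 + _]addrC subrK; apply.
    by rewrite ltrBrDr addNr invr_gt0.
  rewrite lnV ?posrE// -/L.
  have : (c * q)^-1 <= 2^-1 by rewrite lef_pV2 ?posrE//; lra.
  by clear; lra.
have DL2 : D ^+ 2 * L <= D ^+ 4 * L by rewrite ler_wpM2r//; lra.
have DL : L <= D ^+ 2 * L by rewrite ler_peMl//; lra.
have T5 : 6 * (m * (D ^+ 4 * L)) <= T%:R.
  apply: le_trans size; rewrite mulrA -[leRHS]mulrA ler_wpM2r//; lra.
have T2 : (2 <= T)%N.
  rewrite -(ler_nat R); apply: le_trans T5.
  have : D ^+ 4 * L <= m * (D ^+ 4 * L) by rewrite ler_peMl//; lra.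
  by move: L0 DL2 DL; clear; lra.
have z0 : 0 <= b * q by apply: mulr_ge0; lra.
pose K := (Num.truncn (b * q)).+1; exists K, T./2.
have /andP[K1 K2] := truncn_itv z0.
rewrite -natr1 in K2.
have KU : K%:R <= b * q + 1 by rewrite /K -natr1; move: K1; clear; lra.
have KL : b * q <= K%:R by rewrite /K -natr1 ltW.
split; [clear -T2; lia | exact: ltnW | | exact: KL | ].
  rewrite -(ler_nat R) -muln2 natrM -/D mulrC; apply: le_trans KL.
  apply: ler_pM => //; first lra.
  apply: le_trans Dq; rewrite expr2 ler_peMl//; lra.
have eK : (K.*2.+1)%:R <= c * q.
  rewrite -natr1 -muln2 natrM.
  have : (2 * b + 3) * q <= c * q by rewrite ler_wpM2r//; lra.
  by move: KU q1; clear; lra.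
have K0 : 0 < (K.*2.+1)%:R :> R by rewrite ltr0n.
have l1 : ln (K.*2.+1)%:R <= L by rewrite ler_ln ?posrE.
rewrite -[(K.*2.+1)%:R]lnK ?posrE// -expRM_natl -expRD.
have d8 : 0 < delta / 8 by rewrite divr_gt0.
rewrite -[leRHS]lnK ?posrE// ler_expR.
have l2 : - L <= ln (delta / 8).
  rewrite -lnV ?posrE// ler_ln ?posrE ?invr_gt0//.
  rewrite -[leRHS]invrK lef_pV2 ?posrE ?invr_gt0// invf_div.
  apply: (le_trans q8); apply: ler_wpM2r; lra.
have n3 : T%:R <= 3 * T./2%:R :> R by rewrite -natrM ler_nat; clear -T2; lia.
have DDL : (d * d)%:R * ln (K.*2.+1)%:R <= D ^+ 2 * L.
  by rewrite natrM -/D -expr2 ler_wpM2l ?sqr_ge0.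
have : (D ^+ 2 + 1) * L <= T./2%:R / (m * D ^+ 2).
  rewrite ler_pdivlMr; last by rewrite mulr_gt0//; lra.
  have -> : (D ^+ 2 + 1) * L * (m * D ^+ 2) = m * (D ^+ 4 * L + D ^+ 2 * L).
    by rewrite D42; ring.
  have : m * (D ^+ 4 * L + D ^+ 2 * L) <= m * (D ^+ 4 * L + D ^+ 4 * L).
    by rewrite ler_pM2l ?lerD2l//; lra.
  by move: T5 n3; clear; lra.
by move: l2 DDL; clear; lra.
Qed.

(** * The good event *)

Section assembly.
Context {R : realType} {dO : measure_display} {O : measurableType dO}.
Variables (d T : nat) (A Sw Sinf : 'M[R]_d) (sig : R).
Variable P : probability O R.
Variables (beta x w : nat -> O -> 'cV[R]_d) (eps : nat -> O -> R).
Hypotheses (Sw_psd : psd Sw) (Sinf_psd : psd Sinf).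
Hypothesis SinfE : Sinf = A *m Sinf *m A^T + Sw.
Hypothesis betaS : forall t, (t <= T)%N ->
  forall om, beta t.+1 om = A *m beta t om + w t om.
Hypothesis x_gauss : forall t, (t <= T)%N -> vec_gaussian P (x t) 1%:M.
Hypothesis w_gauss : forall t, (t <= T)%N -> vec_gaussian P (w t) Sw.
Hypothesis eps_gauss : forall t, (t <= T)%N -> real_gaussian P (eps t) 0 (sig ^+ 2).
Hypothesis beta0_gauss : vec_gaussian P (beta 0%N) Sinf.
Hypothesis G_indep :
  mutually_independent P (@model_events R O d T (beta 0%N) x w eps).
Hypothesis d_gt0 : (0 < d)%N.

Local Notation all_moments := (all_moments P).

(** At the target the residuals are exactly the centred products: the [sig ^+ 2] subtracted at lag 0
    is the observation-noise part of the variance. *)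
Lemma least_squares_noise h (a : nat -> 'cV[R]_d) om M c : 0 <= c ->
  let r t := obs beta eps a (t + h) om * obs beta eps a t om - sig ^+ 2 *+ (h == 0%N) in
  let Th := A ^+ h *m Sinf in
  \sum_(t < T) (r t - dot (a (t + h)%N) (M *m a t)) ^+ 2 <=
  \sum_(t < T) (r t - dot (a (t + h)%N) (Th *m a t)) ^+ 2 ->
  c * frob2 (M - Th) <= \sum_(t < T) dot (a (t + h)%N) ((M - Th) *m a t) ^+ 2 ->
  c ^+ 2 * frob2 (M - Th) <= 4 * frob2 (noise T A Sinf sig beta eps h a om).
Proof.
move=> c0 r Th opt low.
have -> : noise T A Sinf sig beta eps h a om =
    \sum_(t < T) (r t - dot (a (t + h)%N) (Th *m a t)) *: (a (t + h)%N *m (a t)^T).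
  apply: eq_bigr => t _; congr (_ *: _).
  rewrite /centered /obs_cov /autocov leq_addr addKn /r /Th mulmxA.
  have -> : (t + h == t)%N = (h == 0)%N by rewrite -[X in _ == X]addn0 eqn_add2l.
  ring.
exact: (@least_squares_error R d 'I_T (fun t => a (t + h)%N) (fun t => a t)
  (fun t => r t)).
Qed.

(** The grid points for which the lower tail is requested: symmetric at lag 0, and bounded away from
    zero. *)
Definition good_grid h K (N : 'M['I_(K.*2.+1)]_d) : bool :=
  ((h == 0%N) ==> ((grid_mx R N)^T == grid_mx R N)) && (4^-1 <= frob2 (grid_mx R N)).

(** A term is at least 1 as soon as the lower bound fails at its grid point, so a sum below 1
    certifies all grid points simultaneously. *)
Definition grid_deficit h K n om : R :=
  \sum_(N : 'M['I_(K.*2.+1)]_d | good_grid h N)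
     expR ((210 * d%:R ^+ 2 * frob2 (grid_mx R N))^-1 *
       (n%:R * frob2 (grid_mx R N) / 4 -
        \sum_(k < n) even_sample x h (grid_mx R N) k om)).

Lemma grid_deficit_mean h K n : (h <= 1)%N -> (n.*2 <= T)%N ->
  mean_le P (grid_deficit h K n)
    ((K.*2.+1)%:R ^+ (d * d) * expR (- (n%:R / (840 * d%:R ^+ 2)))).
Proof.
move=> h1 nT; rewrite -natrX.
rewrite -[X in (X ^ _)%N]card_ord -card_mx; apply: mean_le_sum; first exact: expR_ge0.
move=> N /andP[Nsym N4].
have Np : 0 < frob2 (grid_mx R N) by apply: lt_le_trans N4.
split; last first.
- apply: (even_samples_lower_tail x_gauss w_gauss eps_gauss beta0_gauss G_indep
    d_gt0) => // h0.
  by move: Nsym; rewrite h0 => /eqP.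
- by move=> om; exact: expR_ge0.
apply: measurableT_comp => //; apply: measurable_funM => //.
apply: measurable_funB => //; apply: measurable_sum => k.
apply: all_moments_measurable.
apply: (even_sample_all_moments x_gauss d_gt0) => //.
by apply: leq_trans nT; rewrite leq_double.
Qed.

Lemma grid_deficit_lt1 h K n om : grid_deficit h K n om < 1 ->
  forall N : 'M['I_(K.*2.+1)]_d,
  (h = 0%N -> Defs.symmetric (grid_mx R N)) -> 4^-1 <= frob2 (grid_mx R N) ->
  n%:R * frob2 (grid_mx R N) / 4 <=
  \sum_(k < n) dot (x (k.*2 + h)%N om) (grid_mx R N *m x k.*2 om) ^+ 2.
Proof.
move=> Z1 N Nsym N4.
have gN : good_grid h N.
  by rewrite /good_grid N4 andbT; apply/implyP => /eqP /Nsym /eqP.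
have Np : 0 < frob2 (grid_mx R N) by apply: lt_le_trans N4.
move: Z1; rewrite /grid_deficit (bigD1 N)//=.
set e := expR _; set s := \sum_(i | _) _ => es.
have s0 : 0 <= s by apply: sumr_ge0 => ? _; exact: expR_ge0.
have : e < expR 0 by rewrite expR0; apply: le_lt_trans es; rewrite lerDl.
rewrite /e ltr_expR pmulr_rlt0; first by rewrite subr_lt0 => /ltW.
by rewrite invr_gt0 mulr_gt0// mulr_gt0// exprn_gt0 ?ltr0n.
Qed.

Definition norm4_sum om : R := \sum_(t < T.+1) dot (x t om) (x t om) ^+ 2.

Lemma norm4_sum_mean : mean_le P norm4_sum (T.+1%:R * (3 * d%:R ^+ 2)).
Proof.
rewrite -[X in X%:R * _]card_ord; apply: mean_le_sum.
  by rewrite mulr_ge0// exprn_ge0.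
move=> t _; have tT : (t <= T)%N by rewrite -ltnS.
have am : all_moments (fun om => dot (x t om) (x t om) ^+ 2).
  by apply: all_momentsX; exact: (x_dot_all_moments x_gauss).
split; first exact: all_moments_measurable am.
  by move=> om; exact: sqr_ge0.
by rewrite ev_EFin// lee_fin; apply: std_norm4_1; exact: x_gauss.
Qed.

(* The crude fourth moment bound only has to hold with probability [delta / 8] and may
   therefore be of order [d^2 T / delta]: the grid is fine enough to absorb it. *)
Lemma good_event (delta B : R) K n : 0 < delta -> delta < 1 -> (0 < T)%N ->
  (n.*2 <= T)%N -> (T <= 3 * n)%N -> (d.*2 <= K)%N ->
  96 * d%:R ^+ 2 / delta <= K%:R ->
  (K.*2.+1)%:R ^+ (d * d) * expR (- (n%:R / (840 * d%:R ^+ 2))) <= delta / 8 ->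
  0 < B ->
  (forall h, (h <= 1)%N ->
    mean_le P (fun om => frob2 (noise T A Sinf sig beta eps h (x^~ om) om)) B) ->
  exists E : set O, [/\ measurable E, ((1 - delta)%:E <= P E)%E &
    forall om, E om -> forall h, (h <= 1)%N ->
      frob2 (noise T A Sinf sig beta eps h (x^~ om) om) <= 8 * B / delta /\
      forall M, (h = 0%N -> Defs.symmetric M) ->
        T%:R / 192 * frob2 M <= \sum_(t < T) dot (x (t + h)%N om) (M *m x t om) ^+ 2].
Proof.
move=> de0 de1 T0 nT Tn dK dqK Zd B0 noiseB.
have D0 : 0 < d%:R :> R by rewrite ltr0n.
have D2 : 0 < d%:R ^+ 2 :> R by rewrite exprn_gt0.
have Tp : 0 < T%:R :> R by rewrite ltr0n.
(* The mean of [norm4_sum] is at most [(T + 1) * 3 d^2 <= 6 d^2 T], and [8 * 6 = 48] brings the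
   normalized mean down to [delta / 8]. *)
pose w0 : R := 48 * d%:R ^+ 2 * T%:R / delta.
have w0p : 0 < w0 by rewrite divr_gt0// mulr_gt0// mulr_gt0.
pose N h om := frob2 (noise T A Sinf sig beta eps h (x^~ om) om).
(* Five failure variables, two grids, one crude moment and two noises, each of mean at most
   [delta / 8]. *)
pose U om := grid_deficit 0 K n om + grid_deficit 1 K n om +
  (w0^-1 * norm4_sum om + ((8 * B / delta)^-1 * N 0%N om + (8 * B / delta)^-1 * N 1%N om)).
have B8 : 0 < 8 * B / delta by rewrite divr_gt0// mulr_gt0.
have gZ h : (h <= 1)%N -> mean_le P (grid_deficit h K n) (delta / 8).
  by move=> h1; apply: mean_le_trans Zd _; exact: grid_deficit_mean.
have gW : mean_le P (fun om => w0^-1 * norm4_sum om) (delta / 8).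
  apply: mean_le_trans (mean_leZ _ norm4_sum_mean); last by rewrite invr_ge0 ltW.
  rewrite mulrC ler_pdivrMr//.
  have -> : delta / 8 * w0 = (2 * T%:R) * (3 * d%:R ^+ 2).
    by rewrite /w0; field; rewrite gt_eqF.
  rewrite ler_pM2r; last by rewrite mulr_gt0.
  by rewrite -natrM ler_nat mul2n -addnn -addn1 leq_add2l.
have gN h : (h <= 1)%N -> mean_le P (fun om => (8 * B / delta)^-1 * N h om) (delta / 8).
  move=> h1; apply: mean_le_trans (mean_leZ _ (noiseB h h1)); last by rewrite invr_ge0 ltW.
  rewrite ler_pdivrMl//.
  have -> : 8 * B / delta * (delta / 8) = B by field; rewrite gt_eqF.
  exact: lexx.
have Um : mean_le P U delta.
  apply: mean_le_trans (mean_leD (mean_leD (gZ 0%N _) (gZ 1%N _))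
    (mean_leD gW (mean_leD (gN 0%N _) (gN 1%N _)))) => //.
  by clear Zd dqK; lra.
have := mean_le_markov Um; set E := [set om | U om < 1] => -[mE PE].
exists E; split => // om; rewrite /E /= => U1 h h1.
have Z0 h' : 0 <= grid_deficit h' K n om.
  by apply: sumr_ge0 => i _; exact: expR_ge0.
have W0 : 0 <= w0^-1 * norm4_sum om.
  by rewrite mulr_ge0 ?invr_ge0 ?(ltW w0p)// sumr_ge0// => i _; exact: sqr_ge0.
have N0 h' : 0 <= (8 * B / delta)^-1 * N h' om.
  by rewrite mulr_ge0 ?invr_ge0 ?(ltW B8)// frob2_ge0.
have [Zh Wh Nh] : [/\ grid_deficit h K n om < 1, w0^-1 * norm4_sum om < 1 &
    (8 * B / delta)^-1 * N h om < 1].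
  clear Zd dqK; have := (Z0 0%N, Z0 1%N, N0 0%N, N0 1%N); move: U1 W0; rewrite /U.
  by case: h h1 => [_|[_|//]]; move=> U1 W0 [[[? ?] ?] ?]; split; lra.
split.
  by move: Nh; rewrite ltr_pdivrMl// mulr1 => /ltW.
apply: (@design_lower_bound R d (x^~ om) h T n K w0) => //.
- by clear -dK d_gt0; lia.
- by move: Wh; rewrite ltr_pdivrMl// mulr1 => /ltW.
(* The factor 96 in the mesh makes its squared bound times [w0] equal to [delta T / 192], since
   [48 / 96^2 = 1 / 192]. *)
- have dK0 : d%:R / K%:R <= delta / (96 * d%:R).
    rewrite ler_pdivrMr; last by apply: lt_le_trans dqK; rewrite divr_gt0// mulr_gt0.
    rewrite [leLHS](_ : _ = delta / (96 * d%:R) * (96 * d%:R ^+ 2 / delta)); last first.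
      by field; rewrite !gt_eqF.
    by rewrite ler_wpM2l// divr_ge0 ?(ltW de0)// mulr_ge0.
  have K0 : 0 <= d%:R / K%:R :> R by rewrite divr_ge0.
  apply: (@le_trans _ _ ((delta / (96 * d%:R)) ^+ 2 * w0)).
    by rewrite ler_pM2r// lerXn2r// nnegrE// (le_trans K0).
  have -> : (delta / (96 * d%:R)) ^+ 2 * w0 = delta * (T%:R / 192).
    by rewrite /w0; field; rewrite !gt_eqF.
  by rewrite ler_piMl ?(ltW de1)// divr_ge0.
- exact: grid_deficit_lt1.
Qed.

Variables (tau0 gam : R).
Hypotheses (gam0 : 0 < gam) (gam1 : gam < 1).
Hypothesis (tau1 : 1 <= tau0).
Hypothesis opnorm_pow : forall k, opnorm (A ^+ k) <= tau0 * gam ^+ k.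

Lemma noise_mean h : (h <= 1)%N ->
  mean_le P (fun om => frob2 (noise T A Sinf sig beta eps h (x^~ om) om))
  (1260 * T%:R * d%:R ^+ 2 *
    (sig ^+ 4 + tau0 ^+ 2 / (1 - gam ^+ 2) * opnorm Sinf ^+ 2 * d%:R ^+ 2)).
Proof.
move=> h1; split.
- apply: measurable_frob2_noise => // [t j tT|t j tT|t tT].
  + by case: (x_gauss tT).
  + move: (leqW tT); elim: t j {tT} => [|t IH] j; first by case: beta0_gauss.
    move=> tT; under eq_fun do rewrite betaS// mxE.
    apply: measurable_funD; last by case: (w_gauss tT).
    under eq_fun do rewrite mxE; apply: measurable_sum => k.
    by apply: measurable_funM => //; apply: IH; exact: ltnW.
  + by case: (eps_gauss tT).
- by move=> om; exact: frob2_ge0.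
- exact: (noise_second_moment Sw_psd Sinf_psd SinfE betaS x_gauss w_gauss eps_gauss
    beta0_gauss G_indep d_gt0 gam0 gam1 tau1 opnorm_pow).
Qed.

End assembly.

(** * Error rate and conclusion *)

Lemma error_rate (R : realFieldType) (T D V W delta F N : R) :
  0 < T -> 0 < delta -> 0 <= D -> 0 <= V -> V <= W ->
  (T / 192) ^+ 2 * F <= 4 * N -> N <= 8 * (1260 * T * D * V) / delta ->
  F <= 100 ^+ 5 * D / (T * delta) * W.
Proof.
move=> T0 de0 D0 V0 VW FN NB.
have -> : F = (192 / T) ^+ 2 * ((T / 192) ^+ 2 * F) by field; rewrite gt_eqF.
apply: (@le_trans _ _ ((192 / T) ^+ 2 * (4 * (8 * (1260 * T * D * V) / delta)))).
  rewrite ler_wpM2l ?sqr_ge0//; apply: le_trans FN _.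
  by rewrite ler_pM2l.
have -> : (192 / T) ^+ 2 * (4 * (8 * (1260 * T * D * V) / delta)) =
    192 ^+ 2 * (32 * 1260) * (D / (T * delta) * V).
  by field; rewrite !gt_eqF.
have -> : 100 ^+ 5 * D / (T * delta) * W = 100 ^+ 5 * (D / (T * delta) * W).
  by rewrite !mulrA.
have q0 : 0 <= D / (T * delta) by rewrite divr_ge0// mulr_ge0 ?ltW.
have n0 k : 0 <= k%:R :> R by exact: ler0n.
(* The constant [192^2 * 32 * 1260], about [1.5 * 10^9], is compared with [100^5] through powers of
   100 to keep the numerals small. *)
have c1 : 192 <= 2 * 100 :> R by clear; lra.
have c2 : 32 * 1260 <= 5 * 100 ^+ 2 :> R by clear; lra.
have c3 : (2 * 100) ^+ 2 * (5 * 100 ^+ 2) <= 100 ^+ 5 :> R.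
  rewrite (_ : _ * _ = 20 * 100 ^+ 4); last by ring.
  rewrite [leRHS]exprS; apply: ler_wpM2r; last by clear; lra.
  exact: exprn_ge0.
have c4 : 192 ^+ 2 * (32 * 1260) <= (2 * 100) ^+ 2 * (5 * 100 ^+ 2) :> R.
  apply: ler_pM c2; [exact: sqr_ge0|exact: (mulr_ge0 (n0 _) (n0 _))|].
  by apply: lerXn2r c1; [exact: n0|exact: (mulr_ge0 (n0 _) (n0 _))].
apply: ler_pM (le_trans c4 c3) _.
- exact: (mulr_ge0 (sqr_ge0 _) (mulr_ge0 (n0 _) (n0 _))).
- exact: mulr_ge0.
- by rewrite ler_wpM2l.
Qed.

Lemma dim_gt0_spectral_radius_ge0 (R : realType) d (A : 'M[R]_d) : (0 < d)%N ->
  0 <= spectral_radius A.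
Proof. by case: d A => // d A _; exact: spectral_radius_ge0. Qed.

Theorem theorem1 :
  forall R : realType, exists c : R, 0 < c /\
  forall (d : nat) (A Sw Sinf : 'M[R]_d) (sig gam delta : R) (T : nat)
    (dO : measure_display) (O : measurableType dO) (P : probability O R)
    (beta x w : nat -> O -> 'cV[R]_d) (eps y : nat -> O -> R),
  (1 <= d)%N ->
  spectral_radius A < 1 ->
  psd Sw ->
  0 < sig ->
  psd Sinf -> Sinf = A *m Sinf *m A^T + Sw ->
  spectral_radius A < gam -> gam < 1 ->
  0 < delta -> delta < 1 ->
  (* the model, for t = 0, ..., T *)
  (forall t, (t <= T)%N -> forall om, beta t.+1 om = A *m beta t om + w t om) ->
  (forall t, (t <= T)%N -> forall om,
      y t om = ((x t om)^T *m beta t om) 0 0 + eps t om) ->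
  (forall t, (t <= T)%N -> vec_gaussian P (x t) 1%:M) ->
  (forall t, (t <= T)%N -> vec_gaussian P (w t) Sw) ->
  (forall t, (t <= T)%N -> real_gaussian P (eps t) 0 (sig ^+ 2)) ->
  vec_gaussian P (beta 0%N) Sinf ->
  mutually_independent P (@model_events R O d T (beta 0%N) x w eps) ->
  c * (d%:R) ^+ 4 * ln (c * (d%:R) ^+ 2 / delta) <= T%:R ->
  exists E : set O, measurable E /\ ((1 - delta)%:E <= P E)%E /\
    forall om, E om ->
      (forall M, is_Sigma_hat T sig (fun t => x t om) (fun t => y t om) M ->
         frob (M - Sinf) <=
         Num.sqrt (c * (d%:R) ^+ 2 / (T%:R * delta) *
           (sig ^+ 4 + tau A gam ^+ 2 / (1 - gam ^+ 2) * opnorm Sinf ^+ 2 *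
              ((d%:R) ^+ 2 + ln (2 * T%:R / delta) ^+ 2)))) /\
      (forall M, is_M_hat T (fun t => x t om) (fun t => y t om) M ->
         frob (M - A *m Sinf) <=
         Num.sqrt (c * (d%:R) ^+ 2 / (T%:R * delta) *
           (sig ^+ 4 + tau A gam ^+ 3 / (1 - gam ^+ 2) * opnorm Sinf ^+ 2 *
              ((d%:R) ^+ 2 + ln (2 * T%:R / delta) ^+ 2)))).
Proof.
(* The error rate dictates this constant; it also exceeds [2 * 96 + 3] and [6 * 840], which the
   choice of grid and sample size asks for. *)
move=> R; exists (100 ^+ 5); split; first exact: exprn_gt0.
move=> d A Sw Sinf sig gam delta T dO O P beta x w eps y d1 _ Sw_psd sig0 Sinf_psd SinfE
  Ag g1 de0 de1 betaS yE x_gauss w_gauss eps_gauss beta0_gauss G_indep size.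
have g0 : 0 < gam := le_lt_trans (dim_gt0_spectral_radius_ge0 A d1) Ag.
have tau1 := tau_ge1 d1 Ag.
have tauP k := opnorm_power_le_tau k d1 Ag.
set tau0 := tau A gam in tau1 tauP *.
have [||||K [n [/andP[nT Tn] T0 dK dqK Zd]]] :=
    @sample_size_choice R 96 (100 ^+ 5) 840 delta d T _ _ _ _ d1 de0 de1 size.
- by clear; lra.
- by clear; lra.
- by clear; lra.
- by clear; lra.
have gg : 0 < 1 - gam ^+ 2 by rewrite subr_gt0 expr_lt1// ltW.
pose G := (1 - gam ^+ 2)^-1 * opnorm Sinf ^+ 2.
have G0 : 0 <= G by apply: mulr_ge0; [rewrite invr_ge0 ltW|exact: sqr_ge0].
have D0 : 0 < d%:R ^+ 2 :> R by rewrite exprn_gt0// ltr0n.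
pose V := sig ^+ 4 + tau0 ^+ 2 / (1 - gam ^+ 2) * opnorm Sinf ^+ 2 * d%:R ^+ 2.
have VE a b : a / (1 - gam ^+ 2) * opnorm Sinf ^+ 2 * b = a * G * b.
  by rewrite /G !mulrA.
have V0 : 0 < V.
  rewrite /V VE; apply: ltr_wpDr; last exact: exprn_gt0.
  exact: (mulr_ge0 (mulr_ge0 (sqr_ge0 _) G0) (ltW D0)).
have Tp : 0 < T%:R :> R by rewrite ltr0n.
pose B := 1260 * T%:R * d%:R ^+ 2 * V.
have B0 : 0 < B.
  by apply: mulr_gt0 V0; apply: mulr_gt0 D0; apply: mulr_gt0 Tp; rewrite ltr0n.
have noiseB h : (h <= 1)%N ->
    mean_le P (fun om => frob2 (noise T A Sinf sig beta eps h (x^~ om) om)) B.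
  exact: (noise_mean Sw_psd Sinf_psd SinfE betaS x_gauss w_gauss eps_gauss beta0_gauss
    G_indep d1 g0 g1 tau1 tauP).
have [E [mE PE Egood]] := good_event x_gauss w_gauss eps_gauss beta0_gauss G_indep
  d1 de0 de1 T0 nT Tn dK dqK Zd B0 noiseB.
exists E; split=> //; split=> // om /Egood good.
have obsE t : (t <= T)%N -> obs beta eps (x^~ om) t om = y t om.
  by move=> tT; rewrite yE// -mulmxE.
(* Both estimates are treated together; the exponent [h.+2] yields [tau^2] at lag 0 and [tau^3] at
   lag 1. *)
have rate h M : (h <= 1)%N -> (h = 0%N -> Defs.symmetric M) ->
    (h = 0%N -> Defs.symmetric (A ^+ h *m Sinf)) ->
    let r t := obs beta eps (x^~ om) (t + h) om * obs beta eps (x^~ om) t om -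
      sig ^+ 2 *+ (h == 0%N) in
    \sum_(t < T) (r t - dot (x (t + h)%N om) (M *m x t om)) ^+ 2 <=
    \sum_(t < T) (r t - dot (x (t + h)%N om) (A ^+ h *m Sinf *m x t om)) ^+ 2 ->
    frob (M - A ^+ h *m Sinf) <= Num.sqrt (100 ^+ 5 * d%:R ^+ 2 / (T%:R * delta) *
           (sig ^+ 4 + tau0 ^+ (h.+2) / (1 - gam ^+ 2) * opnorm Sinf ^+ 2 *
              ((d%:R) ^+ 2 + ln (2 * T%:R / delta) ^+ 2))).
  move=> h1 Ms As r opt; have [NB low] := good h h1.
  apply: ler_wsqrtr.
  apply: (error_rate Tp de0 (ltW D0) (ltW V0) _ _ NB).
    (* The noise bound carries [tau^2] and [d^2]; since [tau >= 1] and squares are nonnegative, it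
       is below the stated expression with [tau^(h+2)] and the squared logarithm. *)
    rewrite /V !VE lerD2l; apply: ler_pM.
    - by apply: mulr_ge0 G0; exact: sqr_ge0.
    - exact: ltW.
    - by apply: ler_wpM2r => //; exact: ler_weXn2l.
    - by rewrite lerDl sqr_ge0.
  apply: (least_squares_noise _ opt).
    by rewrite divr_ge0.
  apply: low => h0; rewrite /Defs.symmetric linearB /=.
  by rewrite (Ms h0) (As h0).
split=> M.
- case=> Msym opt.
  have E0 : A ^+ 0 *m Sinf = Sinf by rewrite expr0 mul1mx.
  have [Ssym _] := Sinf_psd.
  have objE N : obj_Sigma T sig (x^~ om) (y^~ om) N =
      \sum_(t < T) (obs beta eps (x^~ om) (t + 0) om * obs beta eps (x^~ om) t om -
        sig ^+ 2 *+ (0 == 0)%N - dot (x (t + 0)%N om) (N *m x t om)) ^+ 2.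
    apply: eq_bigr => t _; rewrite addn0 obsE ?(ltnW (ltn_ord t))// qformE.
    by rewrite mulr1n; congr (_ ^+ 2); ring.
  have := rate 0%N M isT (fun _ => Msym); rewrite E0; apply; first by [].
  by rewrite -!objE; exact: opt.
- move=> opt.
  have objE N : obj_M T (x^~ om) (y^~ om) N =
      \sum_(t < T) (obs beta eps (x^~ om) (t + 1) om * obs beta eps (x^~ om) t om -
        sig ^+ 2 *+ (1 == 0)%N - dot (x (t + 1)%N om) (N *m x t om)) ^+ 2.
    apply: eq_bigr => t _; rewrite addn1 !obsE ?(ltnW (ltn_ord t))//.
    by rewrite subr0 /dot mulmxA mulrC.
  have := rate 1%N M isT; rewrite expr1; apply => //.
  by rewrite -!objE; exact: opt.
Qed.
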